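(* Let $\nu$ be a Beurling weight and let $w \in W_{\nu}$ satisfy $w(z) \neq 0$ for all $z \in \mathcal{R}_{\nu}$ and $\mathrm{wind}(w,0) = 0$. Consider the complex measure $d\mu(z) = w(z)\,\frac{|dz|}{2\pi}$ on the unit circle $\Gamma$. Then there exists $n_0 = n_0(\nu)$ such that for every $n \geq n_0$ the monic orthogonal polynomial $\Phi_n$ of degree $n$ for $d\mu$ exists and is unique, and \[ \sum_{n \geq n_0} \nu_n\,|\Phi_n(0)| < \infty . \]
   Context: $\Gamma = \{z \in \mathbb{C} : |z| = 1\}$. For $\varphi \in L^1(\Gamma)$, $\varphi_k = \int_{-\pi}^{\pi} e^{-ik\theta}\varphi(e^{i\theta})\frac{d\theta}{2\pi}$ denotes the $k$-th Fourier coefficient. A Beurling weight is a sequence $\nu = (\nu_k)_{k \in \mathbb{Z}}$ with $\nu_j \geq 1$, $\nu_j = \nu_{-j}$ and $\nu_{j+k} \leq \nu_j \nu_k$ for all $j,k \in \mathbb{Z}$. The Beurling class is $W_{\nu} = \{\varphi \in L^1(\Gamma) : \sum_{j \in \mathbb{Z}} \nu_j |\varphi_j| < \infty\}$. Let $A(\nu) = \lim_{k\to\infty} \frac{\log \nu_k}{k}$ (this limit exists and is $\geq 0$), and $\mathcal{R}_{\nu} = \{z \in \mathbb{C} : e^{-A(\nu)} \leq |z| \leq e^{A(\nu)}\}$; every $\varphi \in W_\nu$ extends (via its Fourier series $\sum_j \varphi_j z^j$) to a function continuous on $\mathcal{R}_\nu$ and analytic in its interior, and ''$w(z)\neq 0$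 on $\mathcal{R}_\nu$'' refers to this extension. $\mathrm{wind}(w,0)$ is the winding number of $w|_\Gamma$ about $0$. For a (possibly complex) weight $w$, a monic orthogonal polynomial of degree $n$ is a polynomial $\Phi_n(z) = z^n + \dots$ satisfying $\int_\Gamma \Phi_n(z)\, z^{-k}\, w(z)\,|dz| = 0$ for $0 \leq k \leq n-1$.
   Formalization: The formal n_0 may depend on both ν and w; an n_0 depending on ν alone, as ''n_0 = n_0(ν)'' suggests, is impossible (e.g. w(z) = W(z^m) with W = exp(ix(z+1/z)/2), J_0(x) = 0, fails for all 1 ≤ n ≤ m). *)

(* Defs.v *)
From HB Require Import structures.
From mathcomp Require Import all_boot all_order all_algebra.
From mathcomp Require Import all_classical all_reals all_analysis.
From mathcomp Require Import complex.
Set Implicit Arguments. Unset Strict Implicit. Unset Printing Implicit Defensive.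
Import Order.TTheory GRing.Theory Num.Theory.
Import numFieldNormedType.Exports.
Local Open Scope classical_set_scope.
Local Open Scope ring_scope.

Section Defs.
Variable R : realType.
Local Notation C := R[i].

Definition cabs (z : C) : R := Num.sqrt (complex.Re z ^+ 2 + complex.Im z ^+ 2).

Definition expi (t : R) : C := Complex (cos t) (sin t).

Definition cint (f : R -> C) : C :=
  Complex (Rintegral lebesgue_measure `[- pi, pi]%classic (fun t => complex.Re (f t)))
          (Rintegral lebesgue_measure `[- pi, pi]%classic (fun t => complex.Im (f t))).

Definition L1circ (phi : C -> C) : Prop :=
  lebesgue_measure.-integrable `[- pi, pi]%classic
      (fun t => (complex.Re (phi (expi t)))%:E) /\
  lebesgue_measure.-integrable `[- pi, pi]%classic
      (fun t => (complex.Im (phi (expi t)))%:E).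

Definition fourier (phi : C -> C) (k : int) : C :=
  cint (fun t => expi (- (k%:~R * t)) * phi (expi t)) / Complex (2 * pi) 0.

Definition beurling_weight (nu : int -> R) : Prop :=
  (forall j, 1 <= nu j) /\ (forall j, nu j = nu (- j)) /\
  (forall j k, nu (j + k) <= nu j * nu k).

(* sum_{j in Z} a_j as the limit of the nonnegative-term series over
   j = 0, 1, -1, 2, -2, ... (grouped) *)
Definition zseries (a : int -> R) : nat -> R :=
  series (fun n : nat => a (n%:Z) + a (- (n.+1)%:Z)).

Definition in_W (nu : int -> R) (phi : C -> C) : Prop :=
  L1circ phi /\ cvgn (zseries (fun j => nu j * cabs (fourier phi j))).

Definition A_nu (nu : int -> R) : R := limn (fun k : nat => ln (nu k%:Z) / k%:R).

Definition annulus (nu : int -> R) : set C :=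
  [set z | expR (- A_nu nu) <= cabs z <= expR (A_nu nu)].

Definition fpartial (phi : C -> C) (z : C) (N : nat) : C :=
  \sum_(j < N) (fourier phi j%:Z * z ^ (j%:Z)
                + fourier phi (- (j.+1)%:Z) * z ^ (- (j.+1)%:Z)).

Definition fext (phi : C -> C) (z : C) : C :=
  Complex (limn (fun N => complex.Re (fpartial phi z N)))
          (limn (fun N => complex.Im (fpartial phi z N))).

Definition wind (F : R -> C) (n : int) : Prop :=
  exists a : R -> R,
    {within `[- pi, pi]%classic, continuous a} /\
    (forall t, - pi <= t <= pi -> F t = Complex (cabs (F t)) 0 * expi (a t)) /\
    a pi - a (- pi) = 2 * pi * n%:~R.

Definition monic_OP (w : C -> C) (n : nat) (Phi : {poly C}) : Prop :=
  Phi \is monic /\ size Phi = n.+1 /\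
  forall k : nat, (k < n)%N ->
    cint (fun t => Phi.[expi t] * (expi t) ^- k * w (expi t)) = 0.

End Defs.

(* Main.v *)
Require Import Defs.
From HB Require Import structures.
From mathcomp Require Import all_boot all_order all_algebra.
From mathcomp Require Import all_classical all_reals all_analysis.
From mathcomp Require Import complex.
From mathcomp Require Import measurable_realfun ring lra zify.
Import Order.TTheory GRing.Theory Num.Theory.
Import numFieldNormedType.Exports.
Local Open Scope classical_set_scope.
Local Open Scope ring_scope.
Set Implicit Arguments. Unset Strict Implicit. Unset Printing Implicit Defensive.

(* Sequences in l^1(Z) form a commutative ring [ell1] under convolution, in
   which a Beurling weight gives a submultiplicative (extended) norm; [nbnd]
   says that this norm is at most a given real. The weight function w is
   identified with its Fourier coefficients.

   - Wiener's lemma, after Newman: w is close to a Laurent polynomial P without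
     zeros on a slightly larger annulus, Cauchy estimates there bound the powers
     of 1/P in the weighted norm, so 1/w = sum_m (P - w)^m / P^(m + 1) converges.
   - Knowing 1/w, one can choose P with w = P (1 + u) and u of norm at most 1/3.
     P is factored by its roots and 1 + u by a fixed-point argument, so
     w = z^k w_+ w_- with factors invertible in the one-sided subalgebras, and
     the winding number forces k = 0.
   - Baxter: with b = w_- / w_+ and c = w_+ / w_-, the coefficients of
     z^(-n) Phi_n w_+ are [c a]_(>= -n), where a is the solution of
     a = const + [b [c a]_(< -n)]_(>= 0), a contraction for large n. All these
     solutions have one common termwise majorant A, and Phi_n(0) is a multiple
     of the coefficient of c a at -n, so nu_n |Phi_n(0)| is dominated by a
     convolution of two sequences of finite norm. *)

(** Two approximations by Laurent polynomials are needed because the norm of 1/P is not controlled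
    by the distance from P to w. For P merely close to w, the powers of (P - w)/P decay
    geometrically up to a constant. This is enough to invert w, but the factorization of 1 + u needs
    the norm of u itself to be small. Once 1/w is known, its norm is a fixed number against which a
    finer P is chosen. The series of w may diverge outside the closed annulus, so only P can be
    continued past it. The room gained there pays for comparing nu_k with exp((A + e)|k|). In
    Baxter's equation a coefficient of b must carry an index below -n to one that is at least 0, so
    only b_k with k > n takes part; this tail makes the contraction. The equation expresses that
    z^(-n) Phi_n w has no coefficients from -n to -1, a gap that lets its two sides be treated
    separately. Bounding each solution alone would bound nu_n |Phi_n(0)| but not its sum, since each
    n reads one coefficient of a different solution; hence the common majorant. *)

(** * The modulus of a complex number as a real number *)

Section Cabs.
Variable R : realType.
Local Notation C := R[i].
Implicit Types x y z : C.

Lemma cabsE z : (cabs z)%:C%C = `|z|.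
Proof. by rewrite normc_def. Qed.

Lemma cabs_ge0 z : 0 <= cabs z.
Proof. exact: sqrtr_ge0. Qed.
Hint Extern 0 (is_true (_ <= cabs _)) => exact: cabs_ge0 : core.
Hint Extern 0 (is_true (_ <= (cabs _)%:E)%E) => (rewrite lee_fin; exact: cabs_ge0) : core.

Lemma cabsM x y : cabs (x * y) = cabs x * cabs y.
Proof. by apply: (@complexI R); rewrite rmorphM /= !cabsE normrM. Qed.

Lemma cabsN x : cabs (- x) = cabs x.
Proof. by apply: (@complexI R); rewrite !cabsE normrN. Qed.

Lemma cabsB x y : cabs (x - y) = cabs (y - x).
Proof. by rewrite -cabsN opprB. Qed.

Lemma cabs0 : cabs (0 : C) = 0.
Proof. by apply: (@complexI R); rewrite cabsE normr0. Qed.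

Lemma cabs1 : cabs (1 : C) = 1.
Proof. by apply: (@complexI R); rewrite cabsE normr1. Qed.

Lemma cabs_eq0 x : (cabs x == 0) = (x == 0).
Proof. by rewrite -(inj_eq (@complexI R)) cabsE normr_eq0. Qed.

Lemma cabs_gt0 x : (0 < cabs x) = (x != 0).
Proof. by rewrite lt_def cabs_eq0 cabs_ge0 andbT. Qed.

Lemma ler_cabsD x y : cabs (x + y) <= cabs x + cabs y.
Proof. by rewrite -lecR rmorphD /= !cabsE ler_normD. Qed.

Lemma cabsX x n : cabs (x ^+ n) = cabs x ^+ n.
Proof. by elim: n => [|n IH]; rewrite ?cabs1 // !exprS cabsM IH. Qed.

Lemma cabsV x : cabs x^-1 = (cabs x)^-1.
Proof. by apply: (@complexI R); rewrite fmorphV /= !cabsE normfV. Qed.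

Lemma cabsXz x (k : int) : cabs (x ^ k) = cabs x ^ k.
Proof. by case: k => n; rewrite ?NegzE -?invr_expz ?cabsV -!exprnP cabsX. Qed.

Lemma cabs_real (x : R) : cabs x%:C%C = `|x|.
Proof. by rewrite /cabs /= expr0n /= addr0 sqrtr_sqr. Qed.

Lemma ler_cabs_sum I (r : seq I) (P : pred I) (F : I -> C) :
  cabs (\sum_(i <- r | P i) F i) <= \sum_(i <- r | P i) cabs (F i).
Proof.
elim/big_rec2: _ => [|i y x _ h]; first by rewrite cabs0.
by rewrite (le_trans (ler_cabsD _ _)) // lerD2l.
Qed.

Lemma normr_Re_cabs x : `|complex.Re x| <= cabs x.
Proof. by rewrite -lecR cabsE normc_ge_Re. Qed.

Lemma normr_Im_cabs x : `|complex.Im x| <= cabs x.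
Proof. by rewrite /cabs -sqrtr_sqr ler_sqrt ?addr_ge0 ?sqr_ge0// lerDr sqr_ge0. Qed.

Lemma cabs_le_ReIm x : cabs x <= `|complex.Re x| + `|complex.Im x|.
Proof.
rewrite /cabs -[leRHS]ger0_norm ?addr_ge0// -sqrtr_sqr ler_sqrt ?sqr_ge0//.
rewrite sqrrD !real_normK ?num_real// -addrA (addrC (_ *+ _)) addrA lerDl.
by rewrite mulrn_wge0// mulr_ge0.
Qed.

Lemma cReD x y : complex.Re (x + y) = complex.Re x + complex.Re y.
Proof. by case: x y => ? ? []. Qed.
Lemma cImD x y : complex.Im (x + y) = complex.Im x + complex.Im y.
Proof. by case: x y => ? ? []. Qed.
Lemma cReM x y : complex.Re (x * y) = complex.Re x * complex.Re y - complex.Im x * complex.Im y.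
Proof. by case: x y => ? ? []. Qed.
Lemma cImM x y : complex.Im (x * y) = complex.Re x * complex.Im y + complex.Im x * complex.Re y.
Proof. by case: x y => ? ? []. Qed.

End Cabs.
#[global] Hint Extern 0 (is_true (_ <= cabs _)) => exact: cabs_ge0 : core.
#[global] Hint Extern 0 (is_true (_ <= (cabs _)%:E)%E) => (rewrite lee_fin; exact: cabs_ge0) : core.

(** * Unordered sums of nonnegative extended reals *)

Section Esum.
Local Open Scope ereal_scope.

(** The inequality [H] comes from finite subsums; the converse is [H] again for the factor [c^-1],
    the case [c = 0] being separate. *)
Lemma esumZl (R : realType) (T : choiceType) (f : T -> \bar R) (c : R) :
  (forall i, 0 <= f i) -> (0 <= c)%R ->
  \esum_(i in setT) (c%:E * f i) = c%:E * \esum_(i in setT) f i.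
Proof.
move=> f0 c0.
have H (d : R) (g : T -> \bar R) : (0 <= d)%R -> (forall i, 0 <= g i) ->
    \esum_(i in setT) (d%:E * g i) <= d%:E * \esum_(i in setT) g i.
  move=> d0 g0; apply: ge_ereal_sup => _ [F [finF _] <-].
  rewrite -ge0_mule_fsumr//; apply: lee_pmul => //.
    by apply: fsume_ge0 => // i _.
  by apply: esum_ge; exists F.
have [->|c1] := eqVneq c 0%R.
  by rewrite mul0e esum1// => i _; rewrite mul0e.
apply/eqP; rewrite eq_le H//=.
have cf : (c%:E * (c^-1)%:E)%E = 1%:E by rewrite -EFinM divff.
rewrite -[leRHS]mul1e -cf -muleA lee_wpmul2l ?lee_fin//.
apply: le_trans (H _ _ _ _); rewrite ?invr_ge0//.
  apply: le_esum => i _.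
  by rewrite muleA -EFinM mulVf// mul1e.
by move=> i; rewrite mule_ge0.
Qed.

Lemma esum_swap (R : realType) (T T' : choiceType) (a : T -> T' -> \bar R) :
  (forall i j, 0 <= a i j) ->
  \esum_(i in setT) \esum_(j in setT) a i j =
  \esum_(j in setT) \esum_(i in setT) a i j.
Proof.
move=> a0; rewrite !esum_esum//.
rewrite (_ : setT `*`` _ = setT); last by rewrite predeqE.
rewrite (_ : setT `*`` _ = setT); last by rewrite predeqE.
rewrite (@reindex_esum R _ _ [set: T' * T]%type [set: T * T']%type (fun k => (k.2, k.1)))//.
split => //; first by move=> [x y] [x' y'] _ _ [-> ->].
by move=> [x y] _; exists (y, x).
Qed.

Lemma ge_esum1 (R : realType) (T : choiceType) (a : T -> \bar R) (i : T) :
  (forall i, 0 <= a i) -> a i <= \esum_(j in setT) a j.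
Proof.
by move=> a0; apply: esum_ge; exists [set i]; rewrite ?fsbig_set1.
Qed.

End Esum.

Lemma in_set1_eq (T : choiceType) (i j : T) : (j \in [set i]%classic) = (j == i).
Proof. by apply/idP/eqP; rewrite inE. Qed.

(** * Absolutely convergent complex sums *)

Section Csum.
Variable R : realType.
Local Notation C := R[i].

(** Positive and negative parts are summed separately, which reduces real and complex sums to
    unordered sums of nonnegative terms. *)
Definition rsum (T : choiceType) (g : T -> R) : R :=
  fine (\esum_(i in [set: T]) (Num.max (g i) 0)%:E) -
  fine (\esum_(i in [set: T]) (Num.max (- g i) 0)%:E).

Definition abs_summable (T : choiceType) (f : T -> C) : Prop :=
  (\esum_(i in [set: T]) (cabs (f i))%:E < +oo)%E.

(* [rsum] and [csum] are junk on families that are not absolutely summable. *)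
Definition csum (T : choiceType) (f : T -> C) : C :=
  Complex (rsum (fun i => complex.Re (f i))) (rsum (fun i => complex.Im (f i))).

Section OneType.
Variable T : choiceType.
Implicit Types (p q g : T -> R) (f : T -> C).

Lemma esum_fin p : (forall i, 0 <= p i) ->
  (\esum_(i in [set: T]) (p i)%:E < +oo)%E ->
  (\esum_(i in [set: T]) (p i)%:E)%E \is a fin_num.
Proof.
move=> p0 h; rewrite ge0_fin_numE//.
by apply: esum_ge0 => i _; rewrite lee_fin.
Qed.

Lemma esum_lt_trans p q : (forall i, p i <= q i) ->
  (\esum_(i in [set: T]) (q i)%:E < +oo)%E ->
  (\esum_(i in [set: T]) (p i)%:E < +oo)%E.
Proof.
by move=> h; apply: le_lt_trans; apply: le_esum => i _; rewrite lee_fin.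
Qed.

Lemma esum_ltD p q : (forall i, 0 <= p i) -> (forall i, 0 <= q i) ->
  (\esum_(i in [set: T]) (p i)%:E < +oo)%E ->
  (\esum_(i in [set: T]) (q i)%:E < +oo)%E ->
  (\esum_(i in [set: T]) (p i + q i)%:E < +oo)%E.
Proof.
move=> p0 q0 hp hq; under eq_esum do rewrite EFinD.
by rewrite esumD ?lte_add_pinfty// => i _; rewrite lee_fin.
Qed.

Lemma fine_esumD p q : (forall i, 0 <= p i) -> (forall i, 0 <= q i) ->
  (\esum_(i in [set: T]) (p i)%:E < +oo)%E ->
  (\esum_(i in [set: T]) (q i)%:E < +oo)%E ->
  fine (\esum_(i in [set: T]) (p i + q i)%:E)%E =
  fine (\esum_(i in [set: T]) (p i)%:E)%E + fine (\esum_(i in [set: T]) (q i)%:E)%E.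
Proof.
move=> p0 q0 hp hq; under eq_esum do rewrite EFinD.
rewrite esumD ?fineD ?esum_fin//; by move=> i _; rewrite lee_fin.
Qed.

Lemma fine_esum_ge0 p : (forall i, 0 <= p i) ->
  0 <= fine (\esum_(i in [set: T]) (p i)%:E)%E.
Proof. by move=> p0; rewrite fine_ge0// esum_ge0// => i _; rewrite lee_fin. Qed.

Lemma le_fine_esum p q : (forall i, 0 <= p i) -> (forall i, p i <= q i) ->
  (\esum_(i in [set: T]) (q i)%:E < +oo)%E ->
  fine (\esum_(i in [set: T]) (p i)%:E)%E <= fine (\esum_(i in [set: T]) (q i)%:E)%E.
Proof.
move=> p0 pq hq.
have q0 i : 0 <= q i := le_trans (p0 i) (pq i).
rewrite fine_le ?esum_fin//; first exact: esum_lt_trans hq.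
by apply: le_esum => i _; rewrite lee_fin.
Qed.

(** Since [P + q = Q + p] termwise, any summable nonnegative decomposition of [g] may replace the
    canonical one; additivity, scaling and Fubini all rest on this freedom. *)
Lemma rsumE g p q : (forall i, 0 <= p i) -> (forall i, 0 <= q i) ->
  (\esum_(i in [set: T]) (p i)%:E < +oo)%E ->
  (\esum_(i in [set: T]) (q i)%:E < +oo)%E ->
  (forall i, g i = p i - q i) ->
  rsum g = fine (\esum_(i in [set: T]) (p i)%:E) - fine (\esum_(i in [set: T]) (q i)%:E).
Proof.
move=> p0 q0 hp hq gE; rewrite /rsum.
set P := fun i => Num.max (g i) 0; set Q := fun i => Num.max (- g i) 0.
have P0 i : 0 <= P i by rewrite /P le_max lexx orbT.
have Q0 i : 0 <= Q i by rewrite /Q le_max lexx orbT.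
have PQ i : P i + q i = Q i + p i.
  rewrite /P /Q gE; case: (leP (p i - q i) 0); case: (leP (- (p i - q i)) 0); lra.
have hP : (\esum_(i in [set: T]) (P i)%:E < +oo)%E.
  apply: esum_lt_trans hp => i; rewrite /P gE ge_max p0 andbT; have := q0 i; lra.
have hQ : (\esum_(i in [set: T]) (Q i)%:E < +oo)%E.
  apply: esum_lt_trans hq => i; rewrite /Q gE ge_max q0 andbT; have := p0 i; lra.
have := fine_esumD P0 q0 hP hq; have := fine_esumD Q0 p0 hQ hp.
under eq_esum do rewrite -PQ.
move=> ->; rewrite /P /Q.
move: (fine _) (fine _) (fine _) (fine _) => x1 x2 x3 x4; lra.
Qed.

Lemma eq_rsum g h : g =1 h -> rsum g = rsum h.
Proof. by move=> /funext->. Qed.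

Lemma eq_csum f f' : f =1 f' -> csum f = csum f'.
Proof. by move=> /funext->. Qed.

Lemma abs_summable_le f p : (forall i, cabs (f i) <= p i) ->
  (\esum_(i in [set: T]) (p i)%:E < +oo)%E -> abs_summable f.
Proof. exact: esum_lt_trans. Qed.

Lemma abs_summableD f f' : abs_summable f -> abs_summable f' ->
  abs_summable (fun i => f i + f' i).
Proof.
move=> h h'; apply: (@abs_summable_le _ (fun i => cabs (f i) + cabs (f' i))).
  by move=> i; exact: ler_cabsD.
exact: esum_ltD.
Qed.

Lemma abs_summableZ (c : C) f : abs_summable f -> abs_summable (fun i => c * f i).
Proof.
move=> h; rewrite /abs_summable; under eq_esum do rewrite cabsM EFinM.
rewrite esumZl//; exact: lte_mul_pinfty.
Qed.

Lemma abs_summable_Re f : abs_summable f ->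
  (\esum_(i in [set: T]) `|complex.Re (f i)|%:E < +oo)%E.
Proof. by apply: esum_lt_trans => i; exact: normr_Re_cabs. Qed.

Lemma abs_summable_Im f : abs_summable f ->
  (\esum_(i in [set: T]) `|complex.Im (f i)|%:E < +oo)%E.
Proof. by apply: esum_lt_trans => i; exact: normr_Im_cabs. Qed.

Definition rpos g i := Num.max (g i) 0.
Definition rneg g i := Num.max (- g i) 0.

Lemma rpos_ge0 g i : 0 <= rpos g i.
Proof. by rewrite /rpos le_max lexx orbT. Qed.
Lemma rneg_ge0 g i : 0 <= rneg g i.
Proof. by rewrite /rneg le_max lexx orbT. Qed.
Hint Resolve rpos_ge0 rneg_ge0 : core.
Lemma rpos_le g i : rpos g i <= `|g i|.
Proof. by rewrite /rpos ge_max ler_norm normr_ge0. Qed.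
Lemma rneg_le g i : rneg g i <= `|g i|.
Proof. by rewrite /rneg ge_max -{1}normrN ler_norm normr_ge0. Qed.
Lemma rpos_neg g i : g i = rpos g i - rneg g i.
Proof. by rewrite /rpos /rneg; case: (leP (g i) 0); case: (leP (- (g i)) 0); lra. Qed.

Lemma esum_rpos g : (\esum_(i in [set: T]) `|g i|%:E < +oo)%E ->
  (\esum_(i in [set: T]) (rpos g i)%:E < +oo)%E.
Proof. by apply: esum_lt_trans; exact: rpos_le. Qed.

Lemma esum_rneg g : (\esum_(i in [set: T]) `|g i|%:E < +oo)%E ->
  (\esum_(i in [set: T]) (rneg g i)%:E < +oo)%E.
Proof. by apply: esum_lt_trans; exact: rneg_le. Qed.

Lemma rsumD g h : (\esum_(i in [set: T]) `|g i|%:E < +oo)%E ->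
  (\esum_(i in [set: T]) `|h i|%:E < +oo)%E ->
  rsum (fun i => g i + h i) = rsum g + rsum h.
Proof.
move=> hg hh.
rewrite (@rsumE (fun i => g i + h i) (fun i => rpos g i + rpos h i)
  (fun i => rneg g i + rneg h i)).
- rewrite (fine_esumD (rpos_ge0 g) (rpos_ge0 h) (esum_rpos hg) (esum_rpos hh)).
  rewrite (fine_esumD (rneg_ge0 g) (rneg_ge0 h) (esum_rneg hg) (esum_rneg hh)).
  by rewrite opprD addrACA.
- by move=> i; rewrite addr_ge0.
- by move=> i; rewrite addr_ge0.
- by apply: (esum_ltD (rpos_ge0 g) (rpos_ge0 h)); exact: esum_rpos.
- by apply: (esum_ltD (rneg_ge0 g) (rneg_ge0 h)); exact: esum_rneg.
- move=> i; rewrite {1}(rpos_neg g) {1}(rpos_neg h); lra.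
Qed.

Lemma rsumZ (c : R) g : (\esum_(i in [set: T]) `|g i|%:E < +oo)%E ->
  rsum (fun i => c * g i) = c * rsum g.
Proof.
move=> hg; have hp := esum_rpos hg; have hn := esum_rneg hg.
have E (d : R) (p : T -> R) : 0 <= d -> (forall i, 0 <= p i) ->
    (\esum_(i in [set: T]) (p i)%:E < +oo)%E ->
    (\esum_(i in [set: T]) (d * p i)%:E < +oo)%E /\
    fine (\esum_(i in [set: T]) (d * p i)%:E)%E = d * fine (\esum_(i in [set: T]) (p i)%:E)%E.
  move=> d0 p0 fp; under eq_esum do rewrite EFinM.
  rewrite esumZl//; split; first by rewrite lte_mul_pinfty.
  by rewrite fineM// esum_fin.
have [c0|c0] := leP 0 c.
  have [p1 p2] := E _ _ c0 (rpos_ge0 g) hp; have [n1 n2] := E _ _ c0 (rneg_ge0 g) hn.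
  rewrite (rsumE _ _ p1 n1).
  - by rewrite p2 n2 /rsum mulrBr.
  - by move=> i; rewrite mulr_ge0.
  - by move=> i; rewrite mulr_ge0.
  - by move=> i; rewrite -mulrBr -rpos_neg.
have c1 : 0 <= - c by lra.
have [p1 p2] := E _ _ c1 (rpos_ge0 g) hp; have [n1 n2] := E _ _ c1 (rneg_ge0 g) hn.
rewrite (rsumE _ _ n1 p1).
- by rewrite p2 n2 /rsum mulrBr !mulNr opprK addrC.
- by move=> i; rewrite mulr_ge0.
- by move=> i; rewrite mulr_ge0.
- by move=> i; rewrite {1}(rpos_neg g); lra.
Qed.

Lemma rsum_le g : (\esum_(i in [set: T]) `|g i|%:E < +oo)%E ->
  ((rsum g)%:E <= \esum_(i in [set: T]) `|g i|%:E)%E.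
Proof.
move=> hg; rewrite -(fineK (esum_fin _ hg))// lee_fin /rsum lerBlDr.
apply: (@le_trans _ _ (fine (\esum_(i in [set: T]) `|g i|%:E)%E)).
  apply: le_fine_esum => //; first exact: rpos_ge0. exact: rpos_le.
by rewrite lerDl fine_esum_ge0//; exact: rneg_ge0.
Qed.

Lemma csumD f f' : abs_summable f -> abs_summable f' ->
  csum (fun i => f i + f' i) = csum f + csum f'.
Proof.
move=> h h'; rewrite /csum.
under eq_rsum do rewrite cReD.
under [X in Complex _ X]eq_rsum do rewrite cImD.
by rewrite (rsumD (abs_summable_Re h) (abs_summable_Re h'))
  (rsumD (abs_summable_Im h) (abs_summable_Im h')).
Qed.

Lemma csumZ (c : C) f : abs_summable f ->
  csum (fun i => c * f i) = c * csum f.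
Proof.
move=> h; rewrite /csum.
have hR := abs_summable_Re h; have hI := abs_summable_Im h.
have Z (d : R) (g : T -> R) : (\esum_(i in [set: T]) `|g i|%:E < +oo)%E ->
    (\esum_(i in [set: T]) `|d * g i|%:E < +oo)%E.
  move=> hg; under eq_esum do rewrite normrM EFinM.
  by rewrite esumZl// ?lte_mul_pinfty// esum_fin.
under eq_rsum do rewrite cReM -mulNr.
under [X in Complex _ X]eq_rsum do rewrite cImM.
rewrite (rsumD (Z _ _ hR) (Z _ _ hI)) (rsumD (Z _ _ hI) (Z _ _ hR)).
rewrite (rsumZ _ hR) (rsumZ _ hI) (rsumZ _ hI) (rsumZ _ hR); case: c => a b /=.
by rewrite -[RHS]/(Complex _ _) mulNr.
Qed.

Lemma csumN f : abs_summable f -> csum (fun i => - f i) = - csum f.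
Proof.
move=> h; rewrite -[RHS]mulN1r -csumZ//; apply: eq_csum => i; by rewrite mulN1r.
Qed.

Lemma csum0 : csum (fun _ : T => 0 : C) = 0.
Proof.
have h : abs_summable (fun _ : T => 0 : C).
  by rewrite /abs_summable esum1// => i _; rewrite cabs0.
have E := etrans (csumZ 0 h) (mul0r _).
by rewrite -[RHS]E; apply: eq_csum => i; rewrite mul0r.
Qed.

(* Rotate so that the sum becomes a nonnegative real: only then is the
   constant in the triangle inequality equal to 1. *)
Lemma cabs_csum f : abs_summable f ->
  ((cabs (csum f))%:E <= \esum_(i in [set: T]) (cabs (f i))%:E)%E.
Proof.
move=> h; have [e|n0] := eqVneq (csum f) 0.
  by rewrite e cabs0; apply: esum_ge0.
set s := csum f; pose c := (cabs s)%:C%C / s.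
have cs : c * s = (cabs s)%:C%C by rewrite /c divfK.
have c1 : cabs c = 1.
  rewrite /c cabsM cabsV cabs_real ger0_norm// divff// cabs_eq0//.
have hc := abs_summableZ c h.
have -> : cabs s = rsum (fun i => complex.Re (c * f i)).
  by have := congr1 (@complex.Re R) (csumZ c h); rewrite -/s cs /= => ->.
apply: le_trans (rsum_le (abs_summable_Re hc)) _.
apply: le_esum => i _; rewrite lee_fin (le_trans (normr_Re_cabs _))//.
by rewrite cabsM c1 mul1r.
Qed.

Lemma abs_summable_pt (i : T) (x : C) : abs_summable (fun j => if j == i then x else 0).
Proof.
rewrite /abs_summable.
have -> : (\esum_(j in [set: T]) (cabs (if j == i then x else 0))%:E =
   \esum_(j in [set i]) (cabs x)%:E)%E.
  rewrite [RHS]esum_mkcond; apply: eq_esum => j _; rewrite in_set1_eq.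
  by case: eqP => // _; rewrite cabs0.
by rewrite esum_set1 ?ltry// lee_fin.
Qed.

Lemma csum_pt (i : T) (x : C) : csum (fun j => if j == i then x else 0) = x.
Proof.
have E (y : R) : 0 <= y -> (\esum_(j in [set: T]) (if j == i then y else 0)%:E)%E = y%:E.
  move=> y0; transitivity (\esum_(j in [set i]) y%:E)%E.
    by rewrite [RHS]esum_mkcond; apply: eq_esum => j _; rewrite in_set1_eq; case: eqP.
  by rewrite esum_set1.
have F (y : R) : rsum (fun j => if j == i then y else 0) = y.
  rewrite (@rsumE _ (fun j => if j == i then Num.max y 0 else 0)
    (fun j => if j == i then Num.max (-y) 0 else 0)).
  - rewrite !E ?le_max ?lexx ?orbT//=.
    by case: (leP y 0); case: (leP (-y) 0); lra.
  - by move=> j; case: eqP; rewrite // le_max lexx orbT.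
  - by move=> j; case: eqP; rewrite // le_max lexx orbT.
  - by rewrite E ?ltry// le_max lexx orbT.
  - by rewrite E ?ltry// le_max lexx orbT.
  - by move=> j; case: eqP => _; [case: (leP y 0); case: (leP (-y) 0)|]; lra.
rewrite /csum; under eq_rsum do rewrite (fun_if (@complex.Re R)).
under [X in Complex _ X]eq_rsum do rewrite (fun_if (@complex.Im R)).
by rewrite !F; case: x.
Qed.

Lemma csum_sum (I : Type) (r : seq I) (F : I -> T -> C) :
  (forall i, abs_summable (F i)) ->
  abs_summable (fun t => \sum_(i <- r) F i t) /\
  csum (fun t => \sum_(i <- r) F i t) = \sum_(i <- r) csum (F i).
Proof.
move=> h; elim: r => [|i r [IH1 IH2]].
  rewrite big_nil -[RHS]csum0; split; last by apply: eq_csum => t; rewrite big_nil.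
  by rewrite /abs_summable esum1// => t _; rewrite big_nil cabs0.
have E : (fun t => \sum_(j <- i :: r) F j t) = (fun t => F i t + \sum_(j <- r) F j t).
  by apply/funext => t; rewrite big_cons.
by rewrite E big_cons csumD// IH2; split => //; exact: abs_summableD.
Qed.

End OneType.

Lemma bij_setTT (T T' : Type) (e : T -> T') : bijective e -> set_bij setT setT e.
Proof.
case=> g eK gK; split => //; first by move=> x y _ _; exact: can_inj eK _ _.
by move=> y _; exists (g y).
Qed.

Lemma abs_summable_reindex (T T' : choiceType) (e : T -> T') (f : T' -> C) :
  bijective e -> abs_summable f -> abs_summable (fun i => f (e i)).
Proof.
move=> be; rewrite /abs_summable (@reindex_esum R T T' setT setT e)//.
exact: bij_setTT.
Qed.

Lemma csum_reindex (T T' : choiceType) (e : T -> T') (f : T' -> C) :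
  bijective e -> csum (fun i => f (e i)) = csum f.
Proof.
move=> be.
have E (p : T' -> \bar R) : (\esum_(i in setT) p (e i) = \esum_(j in setT) p j)%E.
  by rewrite [RHS](@reindex_esum R T T' setT setT e)//; exact: bij_setTT.
by rewrite /csum /rsum; congr Complex; rewrite -!E.
Qed.

(** Tonelli is applied separately to the positive and negative parts of the real and imaginary
    parts. *)
Lemma csum_swap (T T' : choiceType) (f : T -> T' -> C) :
  (\esum_(i in [set: T]) \esum_(j in [set: T']) (cabs (f i j))%:E < +oo)%E ->
  csum (fun i => csum (f i)) = csum (fun j => csum (f ^~ j)).
Proof.
have key : forall g : T -> T' -> R,
   (\esum_(i in [set: T]) \esum_(j in [set: T']) (`|g i j|)%:E < +oo)%E ->
   rsum (fun i => rsum (g i)) = rsum (fun j => rsum (g ^~ j)).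
  move=> g hg.
  have K (U V : choiceType) (h : U -> V -> R) : (forall i j, 0 <= h i j) ->
      (\esum_(i in [set: U]) \esum_(j in [set: V]) (h i j)%:E < +oo)%E ->
      forall i, (\esum_(j in [set: V]) (h i j)%:E < +oo)%E.
    move=> h0 hh i; apply: le_lt_trans hh.
    apply: (@ge_esum1 _ _ (fun i => \esum_(j in [set: V]) (h i j)%:E)%E) => k.
    by apply: esum_ge0 => j _; rewrite lee_fin.
  (* The inner sums of positive and negative parts form an admissible decomposition for [rsumE], so
     an iterated sum is a difference of two double sums of nonnegative terms. *)
  have main (U V : choiceType) (h : U -> V -> R) :
      (\esum_(i in [set: U]) \esum_(j in [set: V]) (`|h i j|)%:E < +oo)%E ->
      rsum (fun i => rsum (h i)) =
      fine (\esum_(i in [set: U]) \esum_(j in [set: V]) (rpos (h i) j)%:E)%E -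
      fine (\esum_(i in [set: U]) \esum_(j in [set: V]) (rneg (h i) j)%:E)%E.
    move=> hh.
    have hp : (\esum_(i in [set: U]) \esum_(j in [set: V]) (rpos (h i) j)%:E < +oo)%E.
      apply: le_lt_trans hh; apply: le_esum => i _; apply: le_esum => j _.
      by rewrite lee_fin rpos_le.
    have hn : (\esum_(i in [set: U]) \esum_(j in [set: V]) (rneg (h i) j)%:E < +oo)%E.
      apply: le_lt_trans hh; apply: le_esum => i _; apply: le_esum => j _.
      by rewrite lee_fin rneg_le.
    have fp i := esum_fin (rpos_ge0 (h i)) (K _ _ _ (fun i => rpos_ge0 (h i)) hp i).
    have fn i := esum_fin (rneg_ge0 (h i)) (K _ _ _ (fun i => rneg_ge0 (h i)) hn i).
    rewrite (@rsumE _ _ (fun i => fine (\esum_(j in [set: V]) (rpos (h i) j)%:E)%E)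
       (fun i => fine (\esum_(j in [set: V]) (rneg (h i) j)%:E)%E)).
    - under eq_esum do rewrite fineK//.
      by under [X in _ - fine X]eq_esum do rewrite fineK//.
    - by move=> i; apply: fine_esum_ge0; exact: rpos_ge0.
    - by move=> i; apply: fine_esum_ge0; exact: rneg_ge0.
    - by under eq_esum do rewrite fineK//.
    - by under eq_esum do rewrite fineK//.
    - by [].
  rewrite (main _ _ g hg) (main _ _ (fun j i => g i j)); last first.
    by rewrite esum_swap// => i j; rewrite lee_fin.
  congr (fine _ - fine _); apply: esum_swap => i j; rewrite lee_fin.
    exact: rpos_ge0.
  exact: rneg_ge0.
move=> h; rewrite /csum; congr Complex; apply: key; apply: le_lt_trans h;
  apply: le_esum => i _; apply: le_esum => j _; rewrite lee_fin.
  exact: normr_Re_cabs.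
exact: normr_Im_cabs.
Qed.

Lemma csum_nneg (T : choiceType) (p : T -> R) : (forall i, 0 <= p i) ->
  (\esum_(i in [set: T]) (p i)%:E < +oo)%E ->
  csum (fun i => (p i)%:C%C) = (fine (\esum_(i in [set: T]) (p i)%:E)%E)%:C%C.
Proof.
move=> p0 hp.
have E0 : (\esum_(i in [set: T]) (0 : R)%:E = 0)%E by rewrite esum1.
have R0 : rsum (fun _ : T => 0 : R) = 0.
  by rewrite (@rsumE _ _ (fun=> 0) (fun=> 0)) ?E0 ?ltry ?subrr// => i; rewrite subrr.
rewrite /csum; congr Complex; last exact: R0.
rewrite (@rsumE _ _ p (fun=> 0)) ?E0 ?ltry//=; first by rewrite subr0.
by move=> i; rewrite subr0.
Qed.

End Csum.

(* Otherwise unification unfolds [csum] and diverges in practice. *)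
Global Opaque csum.

(** * The convolution algebra and its weighted norms *)

Section Norm.
Variable R : realType.
Local Notation C := R[i].
Implicit Types (nu : int -> R) (f g : int -> C).

(** Extended-real valued, since an absolutely summable sequence can have infinite norm for a growing
    weight. *)
Definition nrm nu f : \bar R := (\esum_(k in [set: int]) (nu k * cabs (f k))%:E)%E.

Definition nbnd nu f (a : R) : Prop := (nrm nu f <= a%:E)%E.

Lemma beurling_ge1 nu : beurling_weight nu -> forall k, 1 <= nu k.
Proof. by case. Qed.

Lemma beurling_ge0 nu : beurling_weight nu -> forall k, 0 <= nu k.
Proof. by case=> h _ k; exact: le_trans (h k). Qed.

Lemma beurling_even nu : beurling_weight nu -> forall k, nu (- k) = nu k.
Proof. by case=> _ [h _] k; rewrite -h. Qed.

Lemma beurlingD nu : beurling_weight nu -> forall j k, nu (j + k) <= nu j * nu k.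
Proof. by case=> _ [_]. Qed.

Section Weight.
Variable nu : int -> R.
Hypothesis nuP : beurling_weight nu.
Let nu1 := beurling_ge1 nuP.
Let nu0 := beurling_ge0 nuP.
Let term_ge0 f k : (0 <= (nu k * cabs (f k))%:E)%E.
Proof. by rewrite lee_fin mulr_ge0. Qed.

Lemma nrm_ge0 f : (0 <= nrm nu f)%E.
Proof. by apply: esum_ge0 => k _. Qed.

Lemma nbnd_ge0 f a : nbnd nu f a -> 0 <= a.
Proof. by move=> h; rewrite -lee_fin (le_trans (nrm_ge0 f)). Qed.

Lemma nbnd_le f a b : a <= b -> nbnd nu f a -> nbnd nu f b.
Proof. by move=> ab h; apply: le_trans h _; rewrite lee_fin. Qed.

Lemma nbnd_lt f a : nbnd nu f a -> (nrm nu f < +oo)%E.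
Proof. by move=> h; apply: le_lt_trans h _; rewrite ltry. Qed.

Lemma nrm_nbnd f : (nrm nu f < +oo)%E -> exists a, nbnd nu f a.
Proof.
move=> h; exists (fine (nrm nu f)); rewrite /nbnd fineK//.
by rewrite ge0_fin_numE// nrm_ge0.
Qed.

Lemma nbnd_mono f g a : (forall k, cabs (f k) <= cabs (g k)) -> nbnd nu g a -> nbnd nu f a.
Proof.
move=> h; apply: le_trans; apply: le_esum => k _.
by rewrite lee_fin ler_wpM2l.
Qed.

Lemma nbnd_pt f a k : nbnd nu f a -> nu k * cabs (f k) <= a.
Proof.
move=> h; rewrite -lee_fin; apply: le_trans h.
exact: (@ge_esum1 _ _ (fun k => (nu k * cabs (f k))%:E)).
Qed.

Lemma nbnd_cabs f a k : nbnd nu f a -> cabs (f k) <= a.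
Proof. by move=> h; apply: le_trans (nbnd_pt k h); rewrite ler_peMl. Qed.

Lemma nbnd_summable f a : nbnd nu f a -> abs_summable f.
Proof.
move=> h; apply: le_lt_trans (nbnd_lt h); apply: le_esum => k _.
by rewrite lee_fin ler_peMl.
Qed.

Lemma nbndD f g a b : nbnd nu f a -> nbnd nu g b ->
  nbnd nu (fun k => f k + g k) (a + b).
Proof.
move=> hf hg; rewrite /nbnd EFinD; apply: le_trans (leeD hf hg).
rewrite -esumD//; apply: le_esum => k _.
by rewrite -EFinD lee_fin -mulrDr ler_wpM2l// ler_cabsD.
Qed.

Definition cconv f g k := csum (fun j => f j * g (k - j)).

Lemma cconv_summable f g k a : abs_summable f -> (forall j, cabs (g j) <= a) ->
  abs_summable (fun j => f j * g (k - j)).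
Proof.
move=> hf hg; have := abs_summableZ a%:C%C hf.
have a0 : 0 <= a := le_trans (cabs_ge0 (g 0)) (hg 0).
apply: esum_lt_trans => j.
by rewrite !cabsM cabs_real ger0_norm// mulrC ler_wpM2r.
Qed.

Lemma bij_subz (k : int) : bijective (fun j : int => j - k).
Proof. by exists (fun j => j + k) => j; rewrite ?addrK ?subrK. Qed.

Lemma bij_revz (k : int) : bijective (fun j : int => k - j).
Proof. by exists (fun j => k - j) => j; rewrite opprB addrC subrK. Qed.

(** Submultiplicativity bounds [nu k] by [nu j * nu (k - j)], and Tonelli separates the two sums.
    The double sum is kept in the statement because it also justifies the exchanges of summation
    behind associativity and behind evaluation of products. *)
Lemma esum_conv f g a b : nbnd nu f a -> nbnd nu g b ->
  (\esum_(k in [set: int]) \esum_(j in [set: int])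
     (nu k * cabs (f j * g (k - j)))%:E <= (a * b)%:E)%E.
Proof.
move=> hf hg; rewrite esum_swap; last first.
  by move=> k j; rewrite lee_fin mulr_ge0.
apply: (@le_trans _ _ (\esum_(j in [set: int]) (b%:E * (nu j * cabs (f j))%:E))%E).
  apply: le_esum => j _.
  apply: (@le_trans _ _ (\esum_(k in [set: int])
     ((nu j * cabs (f j))%:E * (nu (k - j) * cabs (g (k - j)))%:E))%E).
    apply: le_esum => k _; rewrite -EFinM lee_fin cabsM.
    rewrite mulrACA ler_wpM2r ?mulr_ge0//.
    by rewrite -{1}(subrKC j k) beurlingD.
  rewrite esumZl ?mulr_ge0// muleC lee_wpmul2r//.
  have <- := @reindex_esum R int int setT setT (fun k => k - j)
    (fun i => (nu i * cabs (g i))%:E) (bij_setTT (bij_subz j)).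
  exact: hg.
rewrite esumZl ?(nbnd_ge0 hg)//.
by rewrite mulrC EFinM lee_wpmul2l// lee_fin (nbnd_ge0 hg).
Qed.

Lemma nbnd_conv f g a b : nbnd nu f a -> nbnd nu g b -> nbnd nu (cconv f g) (a * b).
Proof.
move=> hf hg; apply: le_trans (esum_conv hf hg); apply: le_esum => k _.
under eq_esum do rewrite EFinM.
rewrite esumZl// EFinM lee_wpmul2l ?lee_fin//.
apply: cabs_csum; apply: (@cconv_summable _ _ _ b); first exact: nbnd_summable hf.
by move=> j; exact: nbnd_cabs hg.
Qed.

Lemma nbnd_small f : (forall e, 0 < e -> nbnd nu f e) -> forall k, f k = 0.
Proof.
move=> h k; apply/eqP; rewrite -cabs_eq0 eq_le cabs_ge0 andbT.
apply/ler_addgt0Pl => e e0; rewrite addr0; exact: nbnd_cabs (h e e0).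
Qed.

End Weight.

(** The trivial weight makes plain absolute summability an instance of the weighted estimates. *)
Definition wt1 (k : int) : R := 1.

Lemma wt1P : beurling_weight wt1.
Proof. by split=> //; split => // j k; rewrite mulr1. Qed.

Lemma abs_summableE f : abs_summable f -> exists a, nbnd wt1 f a.
Proof.
move=> h; apply: nrm_nbnd; first exact: wt1P.
by rewrite /nrm; under eq_esum do rewrite mul1r.
Qed.

Lemma nbnd_wt1 nu f a : beurling_weight nu -> nbnd nu f a -> nbnd wt1 f a.
Proof.
move=> nuP; apply: le_trans; apply: le_esum => k _.
by rewrite lee_fin ler_wpM2r// beurling_ge1.
Qed.

End Norm.

Section Ell1.
Variable R : realType.
Local Notation C := R[i].

(** Membership asks for plain absolute summability, not for a finite weighted norm, so that one ring
    serves [nu], the trivial weight and the exponential weights at once. *)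
Record ell1 := Ell1 { ecoef :> int -> C; ecoefP : abs_summable ecoef }.
Implicit Types f g h : ell1.

HB.instance Definition _ := gen_eqMixin ell1.
HB.instance Definition _ := gen_choiceMixin ell1.

Lemma ell1_eq f g : (forall k, f k = g k) -> f = g.
Proof.
case: f g => f fP [g gP] /= /funext e; move: fP gP; rewrite e => fP gP.
by rewrite (Prop_irrelevance fP gP).
Qed.

Lemma ell1_bnd f : exists a, nbnd (@wt1 R) f a.
Proof. exact/abs_summableE/ecoefP. Qed.

Lemma ell1_sup f : exists a, forall k, cabs (f k) <= a.
Proof.
by have [a h] := ell1_bnd f; exists a => k; apply: nbnd_cabs h; exact: wt1P.
Qed.

Lemma conv_summable f g k : abs_summable (fun j => f j * g (k - j)).
Proof. by have [a h] := ell1_sup g; exact: cconv_summable (ecoefP f) h. Qed.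

Lemma ell1_zeroP : abs_summable (fun _ : int => 0 : C).
Proof. by rewrite /abs_summable esum1 ?ltry// => i _; rewrite cabs0. Qed.
Lemma ell1_oppP f : abs_summable (fun k => - f k).
Proof. by apply: esum_lt_trans (ecoefP f) => k; rewrite cabsN. Qed.
Lemma ell1_mulP f g : abs_summable (cconv f g).
Proof.
have [a ha] := ell1_bnd f; have [b hb] := ell1_bnd g.
by have := nbnd_conv (wt1P R) ha hb; apply: nbnd_summable; exact: wt1P.
Qed.

Definition ell1_add f g := Ell1 (abs_summableD (ecoefP f) (ecoefP g)).
Definition ell1_zero := Ell1 ell1_zeroP.
Definition ell1_opp f := Ell1 (ell1_oppP f).
Definition ell1_mul f g := Ell1 (ell1_mulP f g).
Definition ell1_delta (i : int) (x : C) := Ell1 (abs_summable_pt i x).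
Definition ell1_one := ell1_delta 0 1.

Lemma ell1_addA : associative ell1_add.
Proof. by move=> f g h; apply: ell1_eq => k /=; rewrite addrA. Qed.
Lemma ell1_addC : commutative ell1_add.
Proof. by move=> f g; apply: ell1_eq => k /=; rewrite addrC. Qed.
Lemma ell1_add0 : left_id ell1_zero ell1_add.
Proof. by move=> f; apply: ell1_eq => k /=; rewrite add0r. Qed.
Lemma ell1_addN : left_inverse ell1_zero ell1_opp ell1_add.
Proof. by move=> f; apply: ell1_eq => k /=; rewrite addNr. Qed.

HB.instance Definition _ := GRing.isZmodule.Build ell1 ell1_addA ell1_addC ell1_add0 ell1_addN.

Lemma ell1_mulC : commutative ell1_mul.
Proof.
move=> f g; apply: ell1_eq => k /=; rewrite /cconv.
rewrite -(csum_reindex _ (bij_revz k)); apply: eq_csum => j.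
by rewrite mulrC opprB addrC subrK.
Qed.

Lemma ell1_mulDl : left_distributive ell1_mul ell1_add.
Proof.
move=> f g h; apply: ell1_eq => k /=; rewrite /cconv -csumD; try exact: conv_summable.
by apply: eq_csum => j; rewrite mulrDl.
Qed.

Lemma ell1_mul1 : left_id ell1_one ell1_mul.
Proof.
move=> f; apply: ell1_eq => k /=; rewrite /cconv.
rewrite -[RHS](csum_pt (0 : int)); apply: eq_csum => j.
by case: eqP => [->|_]; rewrite ?mul0r// mul1r subr0.
Qed.

(** Both bracketings are iterated sums of [f i * g (j - i) * h (k - j)]. The double sum converges
    absolutely because [h] is bounded and the convolution estimate applies to [f] and [g]. *)
Lemma ell1_mulA : associative ell1_mul.
Proof.
move=> f g h; apply: ell1_eq => k /=; rewrite /cconv.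
pose F i j := f i * g (j - i) * h (k - j).
transitivity (csum (fun i => csum (F i))).
  apply: eq_csum => i; rewrite -(csum_reindex _ (bij_subz i)) -csumZ.
    by apply: eq_csum => j; rewrite /F mulrA opprB addrA subrK.
  have [a ha] := ell1_sup h.
  apply: (@abs_summable_reindex _ _ _ (fun j => j - i)
    (fun j => g j * h (k - i - j))); first exact: bij_subz.
  exact: conv_summable.
rewrite csum_swap.
  apply: eq_csum => j; rewrite mulrC -csumZ; last exact: conv_summable.
  by apply: eq_csum => i; rewrite mulrC.
have [a ha] := ell1_bnd f; have [b hb] := ell1_bnd g; have [c hc] := ell1_sup h.
have c0 : 0 <= c := le_trans (cabs_ge0 (h 0)) (hc 0).
rewrite esum_swap; last by move=> i j.
apply: (@le_lt_trans _ _ (c%:E * (a * b)%:E)%E); last by rewrite -EFinM ltry.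
apply: le_trans (lee_wpmul2l _ (esum_conv (wt1P R) ha hb)); last by rewrite lee_fin.
rewrite -esumZl//; last by move=> j; apply: esum_ge0 => i _; rewrite lee_fin mulr_ge0.
apply: le_esum => j _; rewrite -esumZl//; last by move=> i; rewrite lee_fin mulr_ge0.
apply: le_esum => i _; rewrite -EFinM lee_fin mul1r /F cabsM mulrC.
by rewrite ler_wpM2r.
Qed.

Lemma ell1_one_neq0 : ell1_one != ell1_zero.
Proof.
apply/eqP => /(congr1 (fun f : ell1 => f 0)) /=.
by move/eqP; rewrite oner_eq0.
Qed.

HB.instance Definition _ := GRing.Zmodule_isComNzRing.Build ell1
  ell1_mulA ell1_mulC ell1_mul1 ell1_mulDl ell1_one_neq0.

Lemma ecoefD f g k : (f + g) k = f k + g k. Proof. by []. Qed.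
Lemma ecoefN f k : (- f) k = - f k. Proof. by []. Qed.
Lemma ecoefB f g k : (f - g) k = f k - g k. Proof. by []. Qed.
Lemma ecoef0 k : (0 : ell1) k = 0. Proof. by []. Qed.
Lemma ecoefM f g k : (f * g) k = csum (fun j => f j * g (k - j)). Proof. by []. Qed.
Lemma ecoef_sum I (r : seq I) (P : pred I) (F : I -> ell1) k :
  (\sum_(i <- r | P i) F i) k = \sum_(i <- r | P i) F i k.
Proof. by elim/big_rec2: _ => // i y x _ <-. Qed.

Definition lconst (c : C) : ell1 := ell1_delta 0 c.
(** The monomial z^i, when a sequence is read as a Laurent series. *)
Definition dl (i : int) : ell1 := ell1_delta i 1.

Lemma ecoef_dl i k : dl i k = if k == i then 1 else 0. Proof. by []. Qed.

Lemma ecoef_dlM i f k : (dl i * f) k = f (k - i).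
Proof.
rewrite ecoefM -[RHS](csum_pt i); apply: eq_csum => j; rewrite ecoef_dl.
by case: eqP => [->|_]; rewrite ?mul0r// mul1r.
Qed.

Lemma ecoef_lconstM c f k : (lconst c * f) k = c * f k.
Proof.
rewrite ecoefM -[RHS](csum_pt (0 : int)); apply: eq_csum => j /=.
by case: eqP => [->|_]; rewrite ?mul0r// subr0.
Qed.

Lemma dlD i j : dl (i + j) = dl i * dl j.
Proof. by apply: ell1_eq => k; rewrite ecoef_dlM !ecoef_dl subr_eq addrC. Qed.

Lemma dl0 : dl 0 = 1. Proof. by []. Qed.

Lemma dlVK i : dl i * dl (- i) = 1.
Proof. by rewrite -dlD subrr. Qed.

Lemma lconst_is_zmod : {morph lconst : x y / x - y}.
Proof. by move=> x y; apply: ell1_eq => k /=; case: eqP; rewrite ?subr0. Qed.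
Lemma lconst_is_mul : {morph lconst : x y / x * y} * (lconst 1 = 1).
Proof.
split=> // x y; apply: ell1_eq => k; rewrite ecoef_lconstM /=.
by case: eqP; rewrite ?mulr0.
Qed.
HB.instance Definition _ := GRing.isZmodMorphism.Build C ell1 lconst lconst_is_zmod.
HB.instance Definition _ :=
  GRing.isMonoidMorphism.Build C ell1 lconst (lconst_is_mul.2, lconst_is_mul.1).

Lemma lprojP (p : pred int) f : abs_summable (fun k => if p k then f k else 0).
Proof. by apply: esum_lt_trans (ecoefP f) => k; case: ifP; rewrite ?cabs0. Qed.
(** For the index set [nneg] this is the Riesz projection onto nonnegative frequencies. *)
Definition lproj (p : pred int) f := Ell1 (lprojP p f).

Lemma ecoef_lproj p f k : lproj p f k = if p k then f k else 0. Proof. by []. Qed.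

Lemma lprojD p : {morph lproj p : f g / f + g}.
Proof. by move=> f g; apply: ell1_eq => k /=; case: ifP; rewrite ?addr0. Qed.
Lemma lprojN p : {morph lproj p : f / - f}.
Proof. by move=> f; apply: ell1_eq => k /=; case: ifP; rewrite ?oppr0. Qed.

Definition supp (p : pred int) f := forall k, ~~ p k -> f k = 0.

Lemma supp_lproj p f : supp p (lproj p f).
Proof. by move=> k /negbTE; rewrite ecoef_lproj => ->. Qed.

Lemma lproj_id p f : supp p f -> lproj p f = f.
Proof. by move=> h; apply: ell1_eq => k; rewrite ecoef_lproj; case: ifPn => // /h. Qed.

Lemma lproj_supp0 (p q : pred int) f : supp q f -> (forall k, q k -> ~~ p k) -> lproj p f = 0.
Proof.
move=> h pq; apply: ell1_eq => k; rewrite ecoef_lproj; case: ifP => // pk.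
by apply: h; apply: contraL pk => /pq.
Qed.

Lemma lprojC (p q : pred int) f : (forall k, q k = ~~ p k) -> f = lproj p f + lproj q f.
Proof.
by move=> e; apply: ell1_eq => k; rewrite ecoefD !ecoef_lproj e; case: ifP; rewrite ?addr0 ?add0r.
Qed.

Lemma suppD p f g : supp p f -> supp p g -> supp p (f + g).
Proof. by move=> hf hg k pk; rewrite ecoefD hf ?hg ?addr0. Qed.
Lemma suppN p f : supp p f -> supp p (- f).
Proof. by move=> hf k pk; rewrite ecoefN hf ?oppr0. Qed.
Lemma suppB p f g : supp p f -> supp p g -> supp p (f - g).
Proof. by move=> hf hg; apply: suppD => //; exact: suppN. Qed.

Lemma suppM (p q r : pred int) f g : supp p f -> supp q g ->
  (forall i j, p i -> q j -> r (i + j)) -> supp r (f * g).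
Proof.
move=> hf hg pqr k rk; rewrite ecoefM -[RHS](@csum0 R int); apply: eq_csum => j.
have [pj|/hf->] := boolP (p j); last by rewrite mul0r.
have [qj|/hg->] := boolP (q (k - j)); last by rewrite mulr0.
by have := pqr _ _ pj qj; rewrite subrKC (negbTE rk).
Qed.

Lemma supp_dl (p : pred int) i : p i -> supp p (dl i).
Proof. by move=> pi k; rewrite ecoef_dl; case: eqP => // ->; rewrite pi. Qed.

Lemma supp_lconst (p : pred int) c : p 0 -> supp p (lconst c).
Proof. by move=> p0 k /=; case: eqP => // ->; rewrite p0. Qed.

Definition nneg : pred int := fun k => 0 <= k.
Definition npos : pred int := fun k => k <= 0.

Lemma supp_nnegM f g : supp nneg f -> supp nneg g -> supp nneg (f * g).
Proof. by move=> hf hg; apply: suppM hf hg _ => i j; exact: addr_ge0. Qed.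
Lemma supp_nposM f g : supp npos f -> supp npos g -> supp npos (f * g).
Proof. move=> hf hg; apply: suppM hf hg _ => i j; rewrite /npos; lia. Qed.

Section Bounds.
Variable nu : int -> R.
Hypothesis nuP : beurling_weight nu.

Lemma nbndM f g a b : nbnd nu f a -> nbnd nu g b -> nbnd nu (f * g) (a * b).
Proof. exact: nbnd_conv. Qed.

Lemma nbndA f g a b : nbnd nu f a -> nbnd nu g b -> nbnd nu (f + g) (a + b).
Proof. exact: nbndD. Qed.

Lemma nbndN f a : nbnd nu f a -> nbnd nu (- f) a.
Proof. by apply: nbnd_mono => // k; rewrite ecoefN cabsN. Qed.

Lemma nbndB f g a b : nbnd nu f a -> nbnd nu g b -> nbnd nu (f - g) (a + b).
Proof. by move=> hf hg; apply: nbndA => //; exact: nbndN. Qed.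

Lemma nbnd_lproj p f a : nbnd nu f a -> nbnd nu (lproj p f) a.
Proof.
by apply: nbnd_mono => // k; rewrite ecoef_lproj; case: ifP; rewrite ?cabs0.
Qed.

Lemma nbnd_delta i c : nbnd nu (ell1_delta i c) (nu i * cabs c).
Proof.
rewrite /nbnd /nrm -(@esum_set1 R int i (fun=> (nu i * cabs c)%:E)).
  rewrite [leRHS]esum_mkcond; apply: le_esum => j _; rewrite in_set1_eq /=.
  by case: eqP => [->|_]; rewrite ?cabs0 ?mulr0.
by rewrite lee_fin mulr_ge0// beurling_ge0.
Qed.

Lemma nbnd_eq0 f : (forall e, 0 < e -> nbnd nu f e) -> f = 0.
Proof. by move=> h; apply: ell1_eq => k; exact: nbnd_small h k. Qed.

End Bounds.
End Ell1.

(** * Geometric series *)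

Section Geometric.
Variable R : realType.
Implicit Types (q K : R).

Lemma esum_nat_le (a : nat -> R) B : (forall k, 0 <= a k) ->
  (forall n, \sum_(k < n) a k <= B) -> (\esum_(k in [set: nat]) (a k)%:E <= B%:E)%E.
Proof.
move=> a0 h; rewrite -nneseries_esumT; last by move=> n; rewrite lee_fin.
apply: lime_le; first by apply: is_cvg_nneseries => n _ _; rewrite lee_fin.
by apply: nearW => n; rewrite sumEFin big_mkord lee_fin.
Qed.

(** Multiplied by [1 - q] the sum telescopes; [maxn m n] covers the case where the range ends before
    [m]. *)
Lemma geometric_tail_le q K m n : 0 <= q -> q < 1 -> 0 <= K ->
  \sum_(k < n) (if (k < m)%N then 0 else K * q ^+ k) <= K * q ^+ m / (1 - q).
Proof.
move=> q0 q1 K0.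
have d0 : 0 < 1 - q by rewrite subr_gt0.
suff : \sum_(k < n) (if (k < m)%N then 0 else K * q ^+ k) * (1 - q) <=
    K * q ^+ m - K * q ^+ maxn m n.
  rewrite -mulr_suml ler_pdivlMr// => /le_trans; apply.
  by rewrite gerBl mulr_ge0// exprn_ge0.
elim: n => [|n IH]; first by rewrite big_ord0 maxn0 subrr.
rewrite big_ord_recr /=; apply: le_trans (lerD IH (lexx _)) _.
case: ltnP => nm.
  by rewrite mul0r addr0 (maxn_idPl nm).
rewrite (maxn_idPr (leqW nm)) exprS.
by rewrite le_eqVlt; apply/orP; left; apply/eqP; ring.
Qed.

Lemma geometric_small q K : 0 <= q -> q < 1 -> 0 <= K -> forall e, 0 < e ->
  exists m, K * q ^+ m <= e.
Proof.
move=> q0 q1 K0 e e0.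
have [->|K1] := eqVneq K 0; first by exists 0%N; rewrite mul0r ltW.
have Kp : 0 < K by rewrite lt_def K1.
have : (fun m => q ^+ m) @ \oo --> (0 : R) by apply: cvg_expr; rewrite ger0_norm.
move/cvgrPdist_le => /(_ (e / K)); rewrite divr_gt0// => /(_ isT) [m _ /(_ m (leqnn m))] /=.
rewrite sub0r normrN ger0_norm ?exprn_ge0// => h.
by exists m; rewrite mulrC -ler_pdivlMr.
Qed.

End Geometric.

(** * Completeness, fixed points, Neumann series and truncation *)

Section Complete.
Variable R : realType.
Local Notation C := R[i].
Local Notation L := (ell1 R).
Variable nu : int -> R.
Hypothesis nuP : beurling_weight nu.
Implicit Types (f g u : L) (a b e q r K M : R).

(** The sum is taken coefficientwise, and Tonelli over indices and terms gives the norm bounds. *)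
Lemma ell1_complete (a : nat -> L) (K q : R) : 0 <= q -> q < 1 ->
  (forall k, nbnd nu (a k) (K * q ^+ k)) ->
  exists2 s : L, (forall m, nbnd nu (s - \sum_(k < m) a k) (K * q ^+ m / (1 - q))) &
    forall j, s j = csum (fun k => a k j).
Proof.
move=> q0 q1 ha.
have K0 : 0 <= K by have := nbnd_ge0 nuP (ha 0%N); rewrite expr0 mulr1.
(* [b m] is the series with its first [m] terms erased: [m = 0] gives the sum itself, a general [m]
   its remainder. *)
pose b m k : L := if (k < m)%N then 0 else a k.
have hb m k : nbnd nu (b m k) (if (k < m)%N then 0 else K * q ^+ k).
  rewrite /b; case: ifP => // _.
  by rewrite /nbnd /nrm esum1// => j _; rewrite ecoef0 cabs0 mulr0.
have tot m : (\esum_(j in [set: int]) \esum_(k in [set: nat])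
    (nu j * cabs (b m k j))%:E <= (K * q ^+ m / (1 - q))%:E)%E.
  rewrite esum_swap; last by move=> *; rewrite lee_fin mulr_ge0// beurling_ge0.
  apply: le_trans (_ : (_ <= \esum_(k in [set: nat])
     (if (k < m)%N then 0 else K * q ^+ k)%:E)%E) _.
    by apply: le_esum => k _; exact: hb.
  apply: esum_nat_le => [k|n]; last exact: geometric_tail_le.
  by case: ifP => // _; rewrite mulr_ge0// exprn_ge0.
have bs m j : abs_summable (fun k => b m k j).
  apply: (@le_lt_trans _ _ (K * q ^+ m / (1 - q))%:E); last by rewrite ltry.
  apply: le_trans (tot m).
  apply: (@le_trans _ _ (\esum_(k in [set: nat]) (nu j * cabs (b m k j))%:E)%E).
    by apply: le_esum => k _; rewrite lee_fin ler_peMl// beurling_ge1.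
  apply: (@ge_esum1 _ _ (fun j => \esum_(k in [set: nat]) (nu j * cabs (b m k j))%:E)%E).
  by move=> i; apply: esum_ge0 => k _; rewrite lee_fin mulr_ge0// beurling_ge0.
have tl m : nbnd nu (fun j => csum (fun k => b m k j)) (K * q ^+ m / (1 - q)).
  apply: le_trans (tot m); apply: le_esum => j _.
  under eq_esum do rewrite EFinM.
  rewrite esumZl ?(beurling_ge0 nuP)// EFinM lee_wpmul2l ?lee_fin ?(beurling_ge0 nuP)//.
  exact: cabs_csum.
exists (Ell1 (nbnd_summable nuP (tl 0%N))) => // m.
apply: nbnd_mono (tl m) => // j.
rewrite ecoefB ecoef_sum /=.
rewrite (_ : csum _ = \sum_(i < m) a i j + csum (fun k => b m k j)).
  by rewrite addrAC subrr add0r.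
have hp (i : 'I_m) : abs_summable (fun k : nat => if k == i then a i j else 0).
  exact: abs_summable_pt.
have [h1 h2] := csum_sum (index_enum 'I_m) hp.
rewrite (eq_bigr (fun i : 'I_m => csum (fun k : nat => if k == i then a i j else 0))); last first.
  by move=> i _; rewrite csum_pt.
rewrite -h2 -csumD//; apply: eq_csum => k; rewrite /b /=.
case: ltnP => km; last first.
  by rewrite big1 ?add0r// => i _; case: eqP => // e; have := ltn_ord i; rewrite -e ltnNge km.
rewrite addr0 (bigD1 (Ordinal km))//= eqxx big1 ?addr0// => i /eqP ne.
by case: eqP => // e; case: ne; apply: val_inj.
Qed.

(** The solution is the series of the iterates of [a]. Convergence comes from their decay with ratio
    [q], while [M] expresses that [T] is bounded, which allows passing to the limit in the recursion
    for the partial sums. *)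
Lemma ell1_fixpoint (T : L -> L) (a : L) (K q M : R) : 0 <= q -> q < 1 ->
  {morph T : x y / x + y} -> (forall f b, nbnd nu f b -> nbnd nu (T f) (M * b)) ->
  (forall k, nbnd nu (iter k T a) (K * q ^+ k)) ->
  exists s : L, [/\ s = a + T s,
    forall m, nbnd nu (s - \sum_(k < m) iter k T a) (K * q ^+ m / (1 - q)) &
    forall p, (forall k, supp p (iter k T a)) -> supp p s].
Proof.
move=> q0 q1 TD Tb ha.
have [s hs sE] := ell1_complete q0 q1 ha.
have K0 : 0 <= K by have := nbnd_ge0 nuP (ha 0%N); rewrite expr0 mulr1.
have T0 : T 0 = 0 by apply: (addIr (T 0)); rewrite -TD !add0r.
have TN f : T (- f) = - T f by apply: (addIr (T f)); rewrite -TD !addNr.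
have rec m : \sum_(k < m.+1) iter k T a = a + T (\sum_(k < m) iter k T a).
  elim: m => [|m IH]; first by rewrite big_ord_recr !big_ord0 T0 /= add0r addr0.
  by rewrite big_ord_recr {1}IH /= [in RHS]big_ord_recr /= TD addrA.
have d0 : 0 < 1 - q by rewrite subr_gt0.
exists s; split=> //; last first.
  move=> p hp j pj; rewrite sE -[RHS](@csum0 R nat); apply: eq_csum => k.
  exact: hp.
have M0 : 0 <= M * K.
  by have := nbnd_ge0 nuP (Tb _ _ (ha 0%N)); rewrite expr0 mulr1.
apply/eqP; rewrite -subr_eq0; apply/eqP.
apply: (nbnd_eq0 nuP) => e e0.
have D0 : 0 <= (K + M * K) / (1 - q) by apply: divr_ge0; [exact: addr_ge0|exact: ltW].
have [m hm] := geometric_small q0 q1 D0 e0.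
have -> : s - (a + T s) = (s - \sum_(k < m.+1) iter k T a) - T (s - \sum_(k < m) iter k T a).
  by rewrite rec TD TN; ring.
apply: nbnd_le hm _.
apply: nbnd_le (nbndB nuP (hs m.+1) (Tb _ _ (hs m))).
rewrite !mulrA -mulrDl [leRHS]mulrAC ler_wpM2r ?invr_ge0 ?(ltW d0)// mulrDl.
rewrite lerD2r ler_wpM2l// exprS ler_piMl ?exprn_ge0// ltW//.
Qed.

(** For an element whose powers decay geometrically although its own norm may exceed 1; this is the
    situation of (P - w)/P in Wiener's lemma. *)
Lemma neumann_pow u (K q M : R) : 0 <= q -> q < 1 -> nbnd nu u M ->
  (forall k, nbnd nu (u ^+ k) (K * q ^+ k)) ->
  exists s : L, (1 - u) * s = 1 /\ nbnd nu s (K / (1 - q)).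
Proof.
move=> q0 q1 hu hk.
have itE k : iter k (fun f => u * f) 1 = u ^+ k.
  by elim: k => //= k ->; rewrite exprS.
have [|||s [sE sb _]] := @ell1_fixpoint (fun f => u * f) 1 K q M q0 q1.
- by move=> f g; rewrite mulrDr.
- by move=> f b; exact: nbndM.
- by move=> k; rewrite itE.
exists s; split; first by rewrite mulrBl mul1r {1}sE addrK.
by have := sb 0%N; rewrite big_ord0 subr0 expr0 mulr1.
Qed.

(** The iteration starts at [u] and not at 1, so [s] is the sum of u^k over k >= 1. Its bound then
    does not involve the norm [nu 0] of the unit, and its support stays in every index set closed
    under addition that contains the support of [u]. *)
Lemma neumann_small u (r : R) : r < 1 -> nbnd nu u r ->
  exists s : L, [/\ (1 - u) * (1 + s) = 1, nbnd nu s (r / (1 - r)) &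
    forall p : pred int, (forall i j, p i -> p j -> p (i + j)) -> supp p u -> supp p s].
Proof.
move=> r1 hu; have r0 := nbnd_ge0 nuP hu.
have itb k : nbnd nu (iter k (fun f => u * f) u) (r * r ^+ k).
  elim: k => [|k IH] /=; first by rewrite expr0 mulr1.
  by rewrite exprS; exact: nbndM.
have [|||s [sE sb ss]] := @ell1_fixpoint (fun f => u * f) u r r r r0 r1.
- by move=> f g; rewrite mulrDr.
- by move=> f b; exact: nbndM.
- exact: itb.
exists s; split.
- rewrite mulrBl mul1r mulrDr mulr1 {1}sE; ring.
- by have := sb 0%N; rewrite big_ord0 subr0 expr0 mulr1.
- move=> p pD pu; apply: ss; elim=> //= k IH.
  exact: suppM pu IH _.
Qed.

Definition win (n : nat) : pred int := fun k => (`|k| < n)%N.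

(** A finite index set whose partial sum exceeds the norm minus [e] lies in some window, and what
    remains outside that window weighs at most [e]. *)
Lemma nbnd_tail f (a e : R) : nbnd nu f a -> 0 < e ->
  exists n, nbnd nu (f - lproj (win n) f) e.
Proof.
move=> hf e0.
have ff : nrm nu f \is a fin_num by rewrite ge0_fin_numE ?nrm_ge0// (nbnd_lt hf).
have : (nrm nu f - e%:E < nrm nu f)%E by rewrite lteBlDr// lteDl// lte_fin.
move=> /ereal_sup_gt [_ [F [/finite_seqP[s ->] _] <-]] hF.
pose n := (\max_(i <- s) `|i|).+1%N.
exists n.
have F0 k : (0 <= (nu k * cabs (f k))%:E)%E.
  by rewrite lee_fin mulr_ge0// beurling_ge0.
have split : nrm nu f = ((\esum_(k in [set k | win n k]) (nu k * cabs (f k))%:E) +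
    nrm nu (f - lproj (win n) f)%R)%E.
  rewrite /nrm (esumID [set k | win n k])//; congr (_ + _)%E; rewrite !setTI//.
  rewrite esum_mkcond; apply: eq_esum => k _.
  rewrite ecoefB ecoef_lproj; have [wk|wk] := boolP (win n k).
    by rewrite memNset/= ?subrr ?cabs0 ?mulr0//; apply.
  by rewrite mem_set/= ?subr0//; exact/negP.
have le1 : (\sum_(k \in [set` s]) (nu k * cabs (f k))%:E <=
    \esum_(k in [set k | win n k]) (nu k * cabs (f k))%:E)%E.
  apply: esum_ge; exists [set` s] => //; split; first exact: finite_seq.
  by move=> k /= ks; rewrite /win /n ltnS; apply: leq_bigmax_seq.
rewrite /nbnd; move: hF le1 split.
move: (\sum_(k \in _) _)%E (esum _ _) => x y hx xy sp.
have yf : y \is a fin_num.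
  by move: ff; rewrite sp fin_numD => /andP[].
rewrite sp in hx ff.
move: ff; rewrite fin_numD => /andP[_ zf].
move: (nrm nu (f - _)) zf hx => z; case: z => [z| |]// _; case: y yf xy {sp} => [y| |]// _.
case: x => [x| |]//=; rewrite ?lee_fin ?lte_fin//; lra.
Qed.

End Complete.

(** * The exponential map onto the unit circle *)

Section Expi.
Variable R : realType.
Local Notation C := R[i].
Implicit Types (t : R).

Lemma expiD s t : expi (s + t) = expi s * expi t :> C.
Proof.
rewrite /expi cosD sinD; apply/eqP; rewrite eq_complex /=.
by rewrite eqxx /=; apply/eqP; ring.
Qed.

Lemma expi0 : expi 0 = 1 :> C.
Proof. by rewrite /expi cos0 sin0. Qed.

Lemma cabs_expi t : cabs (expi t) = 1.
Proof. by rewrite /cabs /= cos2Dsin2 sqrtr1. Qed.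

Lemma expi_neq0 t : expi t != 0 :> C.
Proof. by rewrite -cabs_eq0 cabs_expi oner_eq0. Qed.

Lemma expiN t : expi (- t) = (expi t)^-1 :> C.
Proof. by apply: (mulIf (expi_neq0 t)); rewrite -expiD addNr expi0 mulVf// expi_neq0. Qed.

Lemma expiMn t n : expi (t *+ n) = expi t ^+ n :> C.
Proof. by elim: n => [|n IH]; rewrite ?mulr0n ?expi0// mulrS exprS expiD IH. Qed.

Lemma expiMz t (k : int) : expi (k%:~R * t) = expi t ^ k :> C.
Proof.
case: k => n; first by rewrite -pmulrn mulr_natl expiMn.
by rewrite NegzE rmorphN /= mulNr expiN -pmulrn mulr_natl expiMn -exprnN.
Qed.

Lemma expi_2pi : expi (2 * pi) = 1 :> C.
Proof. by rewrite mulr_natl /expi cos2pi sin2pi. Qed.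

(** By the half-angle formula cos t = 1 - 2 sin(t/2)^2, and the sine is positive between 0 and
    pi. *)
Lemma expi_neq1 t : 0 < t -> t < 2 * pi -> expi t != 1 :> C.
Proof.
move=> t0 t1; apply/eqP => -[c1 _].
have s0 : 0 < sin (t / 2) by apply: sin_gt0_pi; lra.
have e : t = (t / 2) *+ 2 by rewrite -mulr_natr divfK// pnatr_eq0.
move: c1; rewrite e cos_mulr2n cos2sin2 => c1.
have : 0 < sin (t / 2) ^+ 2 by rewrite exprn_gt0.
lra.
Qed.

End Expi.

(** * Evaluation and Cauchy estimates *)

Section Eval.
Variable R : realType.
Local Notation C := R[i].
Local Notation L := (ell1 R).
Implicit Types (f g : L) (z : C) (a b : R).

Definition ev z (f : int -> C) : C := csum (fun k => f k * z ^ k).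

(** This is multiplicativity of evaluation at the point 1; [evM] obtains a general point by
    absorbing z^k into the coefficients. *)
Lemma csum_mul f g : csum (f * g) = csum f * csum g.
Proof.
rewrite (eq_csum (fun k => ecoefM f g k)) csum_swap; last first.
  have [a ha] := ell1_bnd f; have [b hb] := ell1_bnd g.
  have := esum_conv (wt1P R) ha hb; rewrite /wt1.
  under eq_esum do under eq_esum do rewrite mul1r.
  by move=> /le_lt_trans; apply; rewrite ltry.
rewrite [RHS]mulrC -csumZ; last exact: ecoefP.
apply: eq_csum => j; rewrite mulrC -csumZ; last exact: ecoefP.
by rewrite -(csum_reindex (fun i => f j * g i) (bij_subz j)).
Qed.

(** Domination of the powers of [z] by the weight makes |f_k z^k| at most nu_k |f_k|, which is what
    evaluation needs. It covers the unit circle for every Beurling weight as well as the annuli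
    introduced below. *)
Definition in_region (nu : int -> R) z : Prop := z != 0 /\ forall k : int, cabs z ^ k <= nu k.

Lemma in_region_expi nu t : beurling_weight nu -> in_region nu (expi t).
Proof.
by move=> nuP; split=> [|k]; rewrite ?expi_neq0// cabs_expi exp1rz beurling_ge1.
Qed.

Section Region.
Variables (nu : int -> R) (z : C).
Hypotheses (nuP : beurling_weight nu) (zP : in_region nu z).

Lemma ev_nbnd f a : nbnd nu f a -> nbnd (@wt1 R) (fun k => f k * z ^ k) a.
Proof.
apply: le_trans; apply: le_esum => k _.
by rewrite lee_fin mul1r cabsM cabsXz mulrC ler_wpM2r//; case: zP.
Qed.

Lemma ev_summable f a : nbnd nu f a -> abs_summable (fun k => f k * z ^ k).
Proof. by move=> /ev_nbnd; apply: nbnd_summable; exact: wt1P. Qed.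

Lemma cabs_ev f a : nbnd nu f a -> cabs (ev z f) <= a.
Proof.
move=> h; rewrite -lee_fin; apply: le_trans (cabs_csum (ev_summable h)) _.
apply: le_trans (ev_nbnd h); apply: le_esum => k _.
by rewrite lee_fin mul1r.
Qed.

Lemma evD f g a b : nbnd nu f a -> nbnd nu g b -> ev z (f + g) = ev z f + ev z g.
Proof.
move=> hf hg; rewrite /ev -csumD; [|exact: ev_summable hf|exact: ev_summable hg].
by apply: eq_csum => k; rewrite mulrDl.
Qed.

Lemma evN f a : nbnd nu f a -> ev z (- f) = - ev z f.
Proof.
move=> hf; rewrite /ev -csumN; last exact: ev_summable hf.
by apply: eq_csum => k; rewrite mulNr.
Qed.

Lemma evB f g a b : nbnd nu f a -> nbnd nu g b -> ev z (f - g) = ev z f - ev z g.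
Proof. by move=> hf hg; rewrite (evD hf (nbndN nuP hg)) (evN hg). Qed.

Lemma evM f g a b : nbnd nu f a -> nbnd nu g b -> ev z (f * g) = ev z f * ev z g.
Proof.
move=> hf hg; rewrite /ev -(csum_mul (Ell1 (ev_summable hf)) (Ell1 (ev_summable hg))).
apply: eq_csum => k; rewrite !ecoefM /= mulrC -csumZ; last exact: conv_summable.
apply: eq_csum => j; rewrite -{1}(subrKC j k) expfzDr; last by case: zP.
by rewrite mulrACA; congr (_ * _); rewrite mulrC.
Qed.

Lemma ev_dl i : ev z (dl R i) = z ^ i.
Proof.
rewrite /ev -[RHS](csum_pt i); apply: eq_csum => k; rewrite ecoef_dl.
by case: eqP => [->|_]; rewrite ?mul1r ?mul0r.
Qed.

Lemma ev_lconst c : ev z (lconst c) = c.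
Proof.
rewrite /ev -[RHS](csum_pt (0 : int)); apply: eq_csum => k /=.
by case: eqP => [->|_]; [exact: mulr1|rewrite mul0r].
Qed.

Lemma ev1 : ev z (1 : L) = 1.
Proof. exact: (ev_dl 0). Qed.

Lemma evX f a m : nbnd nu f a ->
  ev z (f ^+ m) = ev z f ^+ m /\ exists b, nbnd nu (f ^+ m) b.
Proof.
move=> hf; elim: m => [|m [IH [b hb]]].
  by rewrite !expr0 ev1; split => //; eexists; exact: nbnd_delta.
by rewrite !exprS (evM hf hb) IH; split=> //; eexists; exact: nbndM hf hb.
Qed.

End Region.

Lemma ev_sum_csum (r : seq C) f : (forall z, z \in r -> cabs z = 1) ->
  \sum_(z <- r) ev z f = csum (fun k => (\sum_(z <- r) z ^ k) * f k).
Proof.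
move=> h.
have hr : forall z, z \in r -> abs_summable (fun k => f k * z ^ k).
  move=> z zr; have [a ha] := ell1_bnd f.
  apply: ev_summable (ha).
  split=> [|k]; last by rewrite h// exp1rz.
  by rewrite -cabs_eq0 h// oner_eq0.
have {}hr : abs_summable (fun k => (\sum_(z <- r) z ^ k) * f k) /\
   \sum_(z <- r) ev z f = csum (fun k => (\sum_(z <- r) z ^ k) * f k).
  elim: r {h} hr => [|z r IH] hr.
    split; last first.
      by rewrite big_nil -[LHS](@csum0 R int); apply: eq_csum => k; rewrite big_nil mul0r.
    by rewrite /abs_summable esum1// => k _; rewrite big_nil mul0r cabs0.
  have [|s1 s2] := IH; first by move=> y yr; apply: hr; rewrite inE yr orbT.
  have hz := hr z (mem_head _ _).
  have E : (fun k => (\sum_(y <- z :: r) y ^ k) * f k) =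
     (fun k => f k * z ^ k + (\sum_(y <- r) y ^ k) * f k).
    by apply/funext => k; rewrite big_cons mulrDl mulrC.
  rewrite E; split; first exact: abs_summableD.
  by rewrite big_cons s2 csumD.
by case: hr.
Qed.

(* Averages over the N-th roots of unity replace the Cauchy integral. *)
Lemma cauchy_coef0 f (M : R) : (forall z, cabs z = 1 -> cabs (ev z f) <= M) -> cabs (f 0) <= M.
Proof.
move=> h; apply/ler_addgt0Pl => e e0.
have [a ha] := ell1_bnd f.
have [n hn] := nbnd_tail (wt1P R) ha e0.
(* Every index of [win n] has modulus below [N], so averaging over the [N]-th roots of unity kills
   all of them except 0; the remaining indices carry norm at most [e]. *)
pose N := n.+1; pose zeta : C := expi (2 * pi / N%:R).
have N0 : (N%:R : R) != 0 by rewrite pnatr_eq0.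
have N0C : (N%:R : C) != 0 by rewrite pnatr_eq0.
have Np : 0 < (N%:R : R) by rewrite ltr0n.
have zN : zeta ^+ N = 1 by rewrite /zeta -expiMn -[_ *+ N]mulr_natr divfK// expi_2pi.
have z1 (j : nat) : (0 < j < N)%N -> zeta ^+ j != 1.
  move=> /andP[j0 jN]; rewrite /zeta -expiMn -[_ *+ j]mulr_natr.
  have p0 : 0 < 2 * pi :> R by rewrite mulr_gt0 ?pi_gt0.
  apply: expi_neq1; first by rewrite !mulr_gt0 ?invr_gt0 ?ltr0n ?pi_gt0.
  by rewrite -mulrA gtr_pMr// mulrC ltr_pdivrMr// mul1r ltr_nat.
pose r := [seq zeta ^+ i | i <- index_iota 0 N].
have r1 z : z \in r -> cabs z = 1.
  by move=> /mapP[i _ ->]; rewrite cabsX cabs_expi expr1n.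
have szr : size r = N by rewrite size_map size_iota subn0.
pose c (k : int) := (\sum_(z <- r) z ^ k) / N%:R.
have c0 : c 0 = 1.
  rewrite /c; under eq_bigr do rewrite expr0z.
  by rewrite big_const_seq count_predT szr iter_addr_0 divff.
have cN : cabs (N%:R : C) = N%:R.
  by rewrite -(rmorph_nat (real_complex R)) cabs_real ger0_norm ?ler0n.
have cle k : cabs (c k) <= 1.
  rewrite cabsM cabsV cN ler_pdivrMr// mul1r.
  apply: le_trans (ler_cabs_sum _ _ _) _.
  rewrite (eq_big_seq (fun=> 1)); last by move=> z /r1 e1; rewrite cabsXz e1 exp1rz.
  by rewrite big_const_seq count_predT szr iter_addr_0.
have zz k : k != 0 -> (`|k| < N)%N -> zeta ^ k != 1.
  case: k => j j0 jN; first by apply: z1; rewrite jN lt0n j0.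
  by rewrite NegzE -invr_expz invr_eq1 z1.
have cz k : k != 0 -> (`|k| < N)%N -> c k = 0.
  move=> k0 kN; apply/eqP; rewrite mulf_eq0; apply/orP; left.
  rewrite big_map big_mkord.
  under eq_bigr do rewrite exprnP exprz_exp mulrC -exprz_exp -exprnP.
  have := subrX1 (zeta ^ k) N.
  rewrite -[(zeta ^ k) ^+ N]/((zeta ^ k) ^ N) exprz_exp mulrC -exprz_exp [zeta ^ N]zN exp1rz subrr.
  by move=> /esym/eqP; rewrite mulf_eq0 subr_eq0 (negbTE (zz _ k0 kN)).
have cs : abs_summable (fun k => c k * f k).
  apply: abs_summable_le (ecoefP f) => k.
  by rewrite cabsM ler_piMl.
(* The coefficient at 0 is the average of the values plus an error to which no index of the window
   contributes. *)
have -> : f 0 = (\sum_(z <- r) ev z f) / N%:R +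
    csum (fun k => (if k == 0 then f 0 else 0) + - (c k * f k)).
  rewrite csumD; last 2 first.
  - exact: abs_summable_pt.
  - by apply: esum_lt_trans cs => k; rewrite cabsN.
  rewrite csum_pt csumN// ev_sum_csum// mulrC -csumZ; last first.
    have := abs_summableZ N%:R cs; congr abs_summable; apply/funext => k.
    by rewrite mulrA; congr (_ * _); rewrite mulrC divfK.
  rewrite addrCA (_ : csum _ = csum (fun k => c k * f k)) ?subrr ?addr0//.
  by apply: eq_csum => k; rewrite /c mulrA [X in X * _]mulrC.
apply: le_trans (ler_cabsD _ _) _; rewrite addrC lerD//.
  rewrite -lee_fin; apply: le_trans (cabs_csum _) _.
    apply: abs_summableD; first exact: abs_summable_pt.
    by apply: esum_lt_trans cs => k; rewrite cabsN.
  apply: le_trans hn; apply: le_esum => k _; rewrite lee_fin mul1r.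
  have [->|k0] := eqVneq k 0; first by rewrite c0 mul1r subrr cabs0.
  rewrite add0r cabsN cabsM ecoefB ecoef_lproj; case: ifPn => [kn|_].
    by rewrite cz ?cabs0 ?mul0r//; exact: leq_trans kn (leqnSn _).
  by rewrite subr0 ler_piMl.
rewrite cabsM cabsV cN ler_pdivrMr//.
apply: le_trans (ler_cabs_sum _ _ _) _.
apply: (@le_trans _ _ (\sum_(z <- r) M)).
  by rewrite big_seq [leRHS]big_seq; apply: ler_sum => z zr; apply: h; exact: r1.
by rewrite big_const_seq count_predT szr iter_addr_0 mulr_natr.
Qed.

(** Scaling the coefficients by rho^k moves the circle of radius [rho] to the unit circle, and a
    shift by [-k] brings the coefficient in question to index 0. *)
Lemma cauchy_coef nu f a (rho M : R) : beurling_weight nu -> 0 < rho ->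
  (forall k : int, rho ^ k <= nu k) -> nbnd nu f a ->
  (forall z, cabs z = rho -> cabs (ev z f) <= M) ->
  forall k, cabs (f k) * rho ^ k <= M.
Proof.
move=> nuP r0 hr hf h k.
have zP z : cabs z = rho -> in_region nu z.
  by move=> e; split=> [|j]; rewrite ?e// -cabs_eq0 e gt_eqF.
have cr : cabs rho%:C%C = rho by rewrite cabs_real gtr0_norm.
have rn0 : (rho%:C%C : C) != 0 by rewrite -cabs_eq0 cr gt_eqF.
pose g : L := Ell1 (ev_summable (zP _ cr) hf).
have -> : cabs (f k) * rho ^ k = cabs ((dl R (- k) * g) 0).
  by rewrite ecoef_dlM sub0r opprK /= cabsM cabsXz cr.
apply: cauchy_coef0 => z z1.
have z0 : z != 0 by rewrite -cabs_eq0 z1 oner_eq0.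
have hz : in_region (@wt1 R) z by split => // j; rewrite z1 exp1rz.
rewrite (evM hz (nbnd_delta (wt1P R) _ _) (ev_nbnd (zP _ cr) hf : nbnd (@wt1 R) g a)).
rewrite ev_dl cabsM cabsXz z1 exp1rz mul1r.
have -> : ev z g = ev (rho%:C%C * z) f.
  by apply: eq_csum => j /=; rewrite expfzMl mulrA.
by apply: h; rewrite cabsM z1 mulr1 cr.
Qed.

End Eval.

(** * Growth of Beurling weights *)

Section Growth.
Variable R : realType.
Local Notation C := R[i].
Local Notation L := (ell1 R).
Implicit Types (f g : L) (z : C) (a b d e x y : R) (nu : int -> R).

Lemma esum_int (g : int -> \bar R) : (forall k, 0 <= g k)%E ->
  (\esum_(k in [set: int]) g k =
   \esum_(n in [set: nat]) g (Posz n) + \esum_(n in [set: nat]) g (Negz n))%E.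
Proof.
move=> g0; rewrite (esumID (range Posz))// !setTI; congr (_ + _)%E.
  by rewrite esum_image//; move=> m n _ _ [].
rewrite (_ : ~` _ = range Negz); first by rewrite esum_image//; move=> m n _ _ [].
apply/seteqP; split; last by move=> _ [n _ <-] [m _].
by case=> n /= h; [case: h; exists n|exists n].
Qed.

(** Exponential model weights, against which both the growth of [nu] and the decay of Laurent
    coefficients on an annulus are measured. *)
Definition wexp x (k : int) : R := expR (x * `|k|%:R).

Lemma wexpP x : 0 <= x -> beurling_weight (wexp x).
Proof.
move=> x0; split; first by move=> j; rewrite -expR0 ler_expR mulr_ge0.
split=> [j|j k]; first by rewrite /wexp abszN.
by rewrite -expRD ler_expR -mulrDr ler_wpM2l// -natrD ler_nat; lia.
Qed.

(** [annulus nu] is [ann (A_nu nu)]; the parameter is left free so that the annulus can be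
    enlarged. *)
Definition ann x z : Prop := expR (- x) <= cabs z <= expR x.

Lemma ann_in_region x nu z : (forall k, wexp x k <= nu k) -> ann x z -> in_region nu z.
Proof.
move=> h /andP[z1 z2].
have zp : 0 < cabs z by apply: lt_le_trans z1; rewrite expR_gt0.
split; first by rewrite -cabs_gt0.
move=> k; apply: le_trans (h k); rewrite /wexp mulrC expRM_natl.
case: k => n /=.
  by rewrite -exprnP lerXn2r ?nnegrE ?expR_ge0.
rewrite NegzE -invr_expz -exprnP -exprVn lerXn2r ?nnegrE ?expR_ge0 ?invr_ge0//.
by rewrite -[leRHS]invrK lef_pV2 ?posrE ?invr_gt0 ?expR_gt0// -expRN.
Qed.

(** For negative [y] this amounts to expR y + expR (- y) >= 2. *)
Lemma expR_abs_sub1 y : `|expR y - 1| <= expR `|y| - 1.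
Proof.
have [y0|y0] := leP 0 y.
  by rewrite !ger0_norm// subr_ge0 -expR0 ler_expR.
rewrite ltr0_norm ?ltr0_norm//; last by rewrite subr_lt0 -expR0 ltr_expR.
have := expR_ge1Dx y; have := expR_ge1Dx (- y); lra.
Qed.

Lemma expR_sub1_le y : 0 <= y -> y <= 2^-1 -> expR y - 1 <= 2 * y.
Proof.
move=> y0 y1; have := expR_ge1Dx (- y); rewrite expRN => h.
have := expR_gt0 y; set E := expR y in h *; move=> E0.
have : E * (1 - y) <= 1.
  by rewrite mulrC -ler_pdivlMr// div1r.
nra.
Qed.

(** The weight is bounded on the window, here by the sum of its values at 0, ..., n - 1. *)
Lemma nbnd_win nu f n : beurling_weight nu -> supp (win n) f -> exists a, nbnd nu f a.
Proof.
move=> nuP sf; have [a ha] := ell1_bnd f.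
have nu0 := beurling_ge0 nuP.
pose M := \sum_(i < n) nu i%:Z; exists (M * a).
have hM k : win n k -> nu k <= M.
  move=> kn; have -> : nu k = nu `|k|%N.
    by case: k {kn} => // m; rewrite NegzE beurling_even// abszN.
  rewrite /M (bigD1 (Ordinal kn))//= lerDl sumr_ge0// => i _.
have M0 : 0 <= M by rewrite sumr_ge0.
rewrite /nbnd EFinM; apply: le_trans (lee_wpmul2l _ ha); last by rewrite lee_fin.
rewrite -esumZl//; last by move=> k; rewrite lee_fin mulr_ge0.
apply: le_esum => k _; rewrite -EFinM lee_fin mul1r.
have [/hM h|/sf ->] := boolP (win n k); first by rewrite ler_wpM2r.
by rewrite cabs0 !mulr0.
Qed.

Section Fekete.
Variable nu : int -> R.
Hypothesis nuP : beurling_weight nu.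
Let s (k : nat) : R := ln (nu k%:Z).

Let s_ge0 k : 0 <= s k.
Proof. by rewrite ln_ge0// beurling_ge1. Qed.

Let sD j k : s (j + k) <= s j + s k.
Proof.
have p i : 0 < nu i by apply: lt_le_trans (beurling_ge1 nuP i).
rewrite /s -lnM ?posrE// ler_ln ?posrE ?mulr_gt0//.
by rewrite PoszD beurlingD.
Qed.

Let sM q m r : s (q * m + r) <= q%:R * s m + s r.
Proof.
elim: q => [|q IH]; first by rewrite mul0n add0n mul0r add0r.
rewrite mulSn -addnA; apply: le_trans (sD _ _) _.
rewrite -natr1 mulrDl mul1r; move: IH; lra.
Qed.

(** The infimum starts at index 1, the quotient at 0 being a division by zero. *)
Let I := inf [set s k.+1 / k.+1%:R | k in [set: nat]].

Let has_I : has_inf [set s k.+1 / k.+1%:R | k in [set: nat]].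
Proof.
split; first by exists (s 1 / 1); exists 0%N.
by exists 0 => _ [k _ <-]; rewrite divr_ge0.
Qed.

Let I_le k : I * k.+1%:R <= s k.+1.
Proof.
rewrite -ler_pdivlMr ?ltr0n//; apply: inf_lbound; first by case: has_I.
by exists k.
Qed.

(* Fekete's lemma for the subadditive sequence [ln (nu k)]. *)
Let I_cvg : (fun k => s k / k%:R) @ \oo --> I.
Proof.
apply/cvgrPdist_le => /= e e0.
have e20 : 0 < e / 2 by rewrite divr_gt0.
have [_ [m _ <-] hm] := inf_adherent e20 has_I.
(* [B] bounds the contribution of every remainder modulo [m + 1]; after division by the index it is
   at most [e / 2] once the index exceeds 2 B / e. *)
pose B := \sum_(r < m.+1) s r.
have hB r : (r < m.+1)%N -> s r <= B.
  by move=> rm; rewrite /B (bigD1 (Ordinal rm))//= lerDl sumr_ge0.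
have B0 : 0 <= B by rewrite sumr_ge0.
have hN : 2 * B / e < (Num.bound (2 * B / e))%:R.
  by apply: archi_boundP; rewrite divr_ge0 ?mulr_ge0// ltW.
have I0 : 0 <= I.
  by apply: lb_le_inf => [|_ [k _ <-]]; [case: has_I|rewrite divr_ge0].
exists (maxn 1 (Num.bound (2 * B / e))) => // n /=; rewrite geq_max => /andP[n1 nN].
have np : 0 < (n%:R : R) by rewrite ltr0n.
case: n n1 nN np => // n _ nN np.
have lo : I <= s n.+1 / n.+1%:R by rewrite ler_pdivlMr.
rewrite distrC ger0_norm ?subr_ge0// lerBlDl.
rewrite ler_pdivrMr//.
rewrite {1}(divn_eq n.+1 m.+1); apply: le_trans (sM _ _ _) _.
have mp : 0 < (m.+1%:R : R) by rewrite ltr0n.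
have h1 : s m.+1 <= (I + e / 2) * m.+1%:R by rewrite -ler_pdivrMr// ltW.
have h2 := hB _ (ltn_pmod n.+1 (ltn0Sn m)).
have h3 : 2 * B / e < n.+1%:R by apply: lt_le_trans hN _; rewrite ler_nat.
have h4 : B <= e / 2 * n.+1%:R.
  by move: h3; rewrite ltr_pdivrMr// => /ltW; lra.
have h5 : (n.+1 %/ m.+1)%:R * s m.+1 <= (I + e / 2) * n.+1%:R.
  apply: le_trans (ler_wpM2l (ler0n _ _) h1) _.
  rewrite mulrCA ler_wpM2l ?addr_ge0 ?(ltW e20)// -natrM ler_nat.
  exact: leq_trunc_div.
lra.
Qed.

Lemma A_nu_cvg : (fun k : nat => ln (nu k%:Z) / k%:R) @ \oo --> A_nu nu.
Proof. by rewrite /A_nu (cvg_lim _ I_cvg)//; exact: I_cvg. Qed.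

Lemma A_nu_ge0 : 0 <= A_nu nu.
Proof.
rewrite /A_nu (cvg_lim _ I_cvg)//.
by apply: lb_le_inf => [|_ [k _ <-]]; [case: has_I|rewrite divr_ge0].
Qed.

(** The limit in Fekete's lemma is the infimum of the quotients, so the bound holds at every index
    and without a constant. Hence evaluation converges on the whole closed annulus, boundary
    included. *)
Lemma wexp_A_le k : wexp (A_nu nu) k <= nu k.
Proof.
have -> : nu k = nu `|k|%N.
  by case: k => // m; rewrite NegzE beurling_even// abszN.
rewrite /wexp; case: `|k|%N => [|n]; first by rewrite mulr0 expR0 beurling_ge1.
have p : 0 < nu n.+1%:Z by apply: lt_le_trans (beurling_ge1 nuP _).
rewrite -[leRHS]lnK ?posrE// ler_expR /A_nu (cvg_lim _ I_cvg)// ?I_le//.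
Qed.

Lemma beurling_growth e : 0 < e -> exists2 K, 0 <= K & forall k, nu k <= K * wexp (A_nu nu + e) k.
Proof.
move=> e0; have /cvgrPdist_le/(_ _ e0)[N _ hN] := A_nu_cvg.
have nu0 := beurling_ge0 nuP.
exists (1 + \sum_(i < N.+1) nu i%:Z); first by rewrite addr_ge0// sumr_ge0.
move=> k; have -> : nu k = nu `|k|%N.
  by case: k => // m; rewrite NegzE beurling_even// abszN.
rewrite /wexp; move: `|k|%N => {k} n.
have x0 : 0 <= A_nu nu + e by rewrite addr_ge0 ?A_nu_ge0// ltW.
have S0 : 0 <= \sum_(i < N.+1) nu i%:Z by rewrite sumr_ge0.
have [nN|Nn] := leqP n N.
  apply: (@le_trans _ _ (\sum_(i < N.+1) nu i%:Z)).
    have nN' : (n < N.+1)%N by [].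
    by rewrite (bigD1 (Ordinal nN'))//= lerDl sumr_ge0.
  apply: (@le_trans _ _ ((1 + \sum_(i < N.+1) nu i%:Z) * 1)); first by rewrite mulr1 lerDr.
  by rewrite ler_wpM2l ?addr_ge0// -expR0 ler_expR mulr_ge0.
apply: (@le_trans _ _ (1 * expR ((A_nu nu + e) * n%:R))); last first.
  by rewrite ler_wpM2r ?expR_ge0// lerDl.
have p : 0 < nu n%:Z by apply: lt_le_trans (beurling_ge1 nuP _).
rewrite mul1r -[leLHS]lnK ?posrE// ler_expR -ler_pdivrMr; last by rewrite ltr0n; case: n Nn {p}.
have := hN n (ltnW Nn); rewrite /= ler_norml => /andP[h _]; lra.
Qed.

(** Half of [e] absorbs the growth of [nu] beyond its rate, and the other half leaves a geometric
    series. [D] is independent of [f], so one constant serves all powers of an element. *)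
Lemma nbnd_wexp e : 0 < e -> exists2 D, 0 <= D & forall f (M : R),
  (forall k, cabs (f k) * wexp (A_nu nu + e) k <= M) -> nbnd nu f (D * M).
Proof.
move=> e0; have e20 : 0 < e / 2 by rewrite divr_gt0.
have [K K0 hK] := beurling_growth e20.
pose q := expR (- (e / 2)).
have q0 : 0 <= q by rewrite expR_ge0.
have q1 : q < 1 by rewrite -expR0 ltr_expR oppr_lt0.
(* One geometric series for each half of the integers, hence the factor 2. *)
exists (K * (2 / (1 - q))).
  by rewrite mulr_ge0// divr_ge0// subr_ge0 ltW.
move=> f M hf.
have M0 : 0 <= M by apply: le_trans (hf 0); rewrite mulr_ge0// expR_ge0.
have geo (F : nat -> nat) : (forall n, n <= F n)%N ->
    (\esum_(n in [set: nat]) (K * M * q ^+ F n)%:E <= (K * M / (1 - q))%:E)%E.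
  move=> hF; apply: esum_nat_le => [n|n].
    by rewrite mulr_ge0 ?mulr_ge0// exprn_ge0.
  have := @geometric_tail_le R q (K * M) 0 n q0 q1 (mulr_ge0 K0 M0).
  rewrite expr0 mulr1; apply: le_trans; apply: ler_sum => i _ /=.
  by rewrite ler_wpM2l ?mulr_ge0// ler_wiXn2l// ltW.
have tm k : nu k * cabs (f k) <= K * M * q ^+ `|k|%N.
  apply: le_trans (ler_wpM2r (cabs_ge0 _) (hK k)) _.
  rewrite -!mulrA ler_wpM2l//.
  have -> : q ^+ `|k|%N = wexp (A_nu nu + e / 2) k / wexp (A_nu nu + e) k.
    rewrite /wexp -expRN -expRD /q -expRM_natl; congr expR.
    by field.
  rewrite mulrA ler_pdivlMr ?expR_gt0// -mulrA [leRHS]mulrC.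
  by rewrite ler_wpM2l ?expR_ge0.
rewrite /nbnd /nrm esum_int; last first.
  by move=> k; rewrite lee_fin mulr_ge0// beurling_ge0.
rewrite (_ : K * _ * _ = K * M / (1 - q) + K * M / (1 - q)); last by field; lra.
rewrite EFinD; apply: leeD.
  apply: le_trans (geo id (fun=> leqnn _)).
  by apply: le_esum => n _; rewrite lee_fin; exact: tm n.
apply: le_trans (geo S (fun=> leqnSn _)).
by apply: le_esum => n _; rewrite lee_fin; exact: tm (Negz n).
Qed.

Lemma ann_nu z : ann (A_nu nu) z -> in_region nu z.
Proof. apply: ann_in_region; exact: wexp_A_le. Qed.

Lemma ann_wexp x z : ann x z -> in_region (wexp x) z.
Proof. exact: ann_in_region. Qed.

(** Stated for Laurent polynomials, since a general element need not converge outside the closed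
    annulus. The point is moved radially to the nearest point of the annulus, which changes the
    finitely many monomials by a small relative error. *)
Lemma thicken_lower_bound f n a d : supp (win n) f -> nbnd nu f a -> 0 < d ->
  (forall z, ann (A_nu nu) z -> d <= cabs (ev z f)) ->
  exists2 e, 0 < e & forall z, ann (A_nu nu + e) z -> d / 2 <= cabs (ev z f).
Proof.
move=> sf hf d0 hd.
have a0 := nbnd_ge0 nuP hf.
have A0 := A_nu_ge0.
pose m := Num.min d 1.
have m0 : 0 < m by rewrite lt_min d0 ltr01.
have md : m <= d by rewrite ge_min lexx.
have m1 : m <= 1 by rewrite ge_min lexx orbT.
(* This gives e (n + 1) (a + 1) = m / 4: then e (n + 1) <= 1/2, as [expR_sub1_le] requires, and the
   total change 2 e (n + 1) a is at most d / 2. *)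
pose e := m / (4 * (n.+1%:R * (a + 1))).
have np : 0 < (n.+1%:R : R) by rewrite ltr0n.
have ap : 0 < a + 1 by lra.
have e0 : 0 < e by rewrite divr_gt0// !mulr_gt0.
have en : e * n.+1%:R * (a + 1) = m / 4 by rewrite /e; field; rewrite !lt0r_neq0.
have nn : 0 <= e * n.+1%:R by rewrite mulr_ge0 ?ltW.
clearbody e; exists e => // z /andP[z1 z2].
have zp : 0 < cabs z by apply: lt_le_trans z1; rewrite expR_gt0.
have l1 : - (A_nu nu + e) <= ln (cabs z) by rewrite -ler_expR lnK.
have l2 : ln (cabs z) <= A_nu nu + e by rewrite -ler_expR lnK.
(* [t] is ln |z| clamped to [-A, A], so [s1] is the radial displacement on the logarithmic scale. *)
pose t := Num.max (- A_nu nu) (Num.min (A_nu nu) (ln (cabs z))).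
pose s1 := ln (cabs z) - t.
have s1e : `|s1| <= e.
  rewrite ler_norml /s1 /t; have [h|h] := leP (A_nu nu) (ln (cabs z)).
    by rewrite max_r; [apply/andP; split; lra|lra].
  by case: (leP (- A_nu nu) (ln (cabs z))) => ?; apply/andP; split; lra.
have tA : - A_nu nu <= t <= A_nu nu.
  rewrite /t; have [h|h] := leP (A_nu nu) (ln (cabs z)).
    by rewrite max_r; [apply/andP; split; lra|lra].
  by case: (leP (- A_nu nu) (ln (cabs z))) => ?; apply/andP; split; lra.
pose z' := z * (expR (- s1))%:C%C.
have cz' : cabs z' = expR t.
  rewrite cabsM cabs_real ger0_norm ?expR_ge0// -{1}[cabs z]lnK ?posrE// -expRD.
  by congr expR; rewrite /s1; lra.
have z'A : ann (A_nu nu) z' by rewrite /ann cz' !ler_expR.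
have zA : ann (A_nu nu + e) z by rewrite /ann z1.
have zz' : z = z' * (expR s1)%:C%C.
  by rewrite /z' -mulrA -rmorphM -expRD addNr expR0 rmorph1 mulr1.
have wP : beurling_weight (wexp (A_nu nu + e)) by apply: wexpP; lra.
have [b hb] := nbnd_win wP sf.
have S1 := ev_summable (ann_wexp zA) hb.
have S2 := ev_summable (ann_nu z'A) hf.
have S3 : abs_summable (fun k => - (f k * z' ^ k)).
  by apply: esum_lt_trans S2 => k; rewrite cabsN.
have D : cabs (ev z f - ev z' f) <= d / 2.
  rewrite /ev -csumN// -csumD// -lee_fin.
  apply: le_trans (cabs_csum (abs_summableD S1 S3)) _.
  apply: (@le_trans _ _ ((expR (e * n.+1%:R) - 1)%:E * a%:E)%E); last first.
    rewrite -EFinM lee_fin.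
    have q1 : e * n.+1%:R <= 2^-1 by nra.
    have := expR_sub1_le nn q1 => q2.
    nra.
  have E1 : 1 <= expR (e * n.+1%:R) by rewrite -[leLHS]expR0 ler_expR.
  apply: le_trans (lee_wpmul2l _ hf); last by rewrite lee_fin subr_ge0.
  rewrite -esumZl ?subr_ge0//; last first.
    by move=> k; rewrite lee_fin mulr_ge0// beurling_ge0.
  apply: le_esum => k _; rewrite -EFinM lee_fin.
  have [kn|/sf ->] := boolP (win n k); last by rewrite !mul0r subrr cabs0 !mulr0.
  rewrite -mulrBr cabsM mulrA [leRHS]mulrC ler_wpM2l//.
  rewrite {1}zz' expfzMl -{2}[z' ^ k]mulr1 -mulrBr cabsM [leRHS]mulrC.
  apply: ler_pM => //; first by rewrite cabsXz; case: (ann_nu z'A).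
  have -> : ((expR s1)%:C%C : C) ^ k = (expR (s1 * k%:~R))%:C%C.
    have aux (m' : nat) : ((expR s1)%:C%C : C) ^+ m' = (expR (s1 * m'%:R))%:C%C.
      by rewrite -rmorphXn /= mulrC expRM_natl.
    case: k {kn} => j; first exact: aux.
    by rewrite NegzE -invr_expz -exprnP aux -fmorphV -expRN -mulrN rmorphN.
  rewrite -(rmorph1 (real_complex R)) -rmorphB /= cabs_real.
  apply: le_trans (expR_abs_sub1 _) _; rewrite lerD2r ler_expR normrM.
  apply: ler_pM => //.
  by rewrite -intr_norm -natr_absz ler_nat; apply: leqW; exact: ltnW.
move: (hd _ z'A) D; generalize (ev z f) (ev z' f) => v v' h1 h2.
have := ler_cabsD v (v' - v); rewrite [v + _]addrC subrK cabsB; lra.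
Qed.

End Fekete.
End Growth.

(** * Lower bounds on the closed annulus by compactness *)

Section LowerBound.
Variable R : realType.
Local Notation C := R[i].
Local Notation L := (ell1 R).
Implicit Types (f g : L) (z : C) (nu : int -> R) (p q : R * R).

Lemma polar z : z != 0 -> exists t : R, - pi <= t <= pi /\ z = (cabs z)%:C%C * expi t.
Proof.
move=> z0; have r0 : 0 < cabs z by rewrite cabs_gt0.
have r1 := lt0r_neq0 r0.
pose c := complex.Re z / cabs z; pose s := complex.Im z / cabs z.
have cs : c ^+ 2 + s ^+ 2 = 1.
  have r2 : cabs z ^+ 2 = complex.Re z ^+ 2 + complex.Im z ^+ 2.
    by rewrite /cabs sqr_sqrtr// addr_ge0// sqr_ge0.
  by rewrite /c /s !expr_div_n -mulrDl -r2 divff// expf_neq0.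
have c1 : -1 <= c <= 1.
  have := sqr_ge0 s => s0.
  by apply/andP; split; nra.
have zE t : cos t = c -> sin t = s -> z = (cabs z)%:C%C * expi t.
  move=> ct st; rewrite /expi ct st.
  apply/eqP; rewrite eq_complex cReM cImM /= !mul0r subr0 addr0 /c /s.
  by rewrite mulrC divfK// mulrC divfK// !eqxx.
have cc : cos (acos c) = c by apply: acosK; rewrite in_itv.
have ss : sin (acos c) = `|s|.
  by rewrite sin_acos// -cs addrAC subrr add0r sqrtr_sqr.
have a0 := acos_ge0 c1; have a1 := acos_lepi c1; have p0 := pi_gt0 R.
have [s0|s0] := leP 0 s.
  exists (acos c); split; first by apply/andP; split; lra.
  by apply: zE => //; rewrite ss ger0_norm.
exists (- acos c); split; first by apply/andP; split; lra.
by apply: zE; rewrite ?cosN// sinN ss ltr0_norm// opprK.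
Qed.

(** Logarithmic polar coordinates: the closed annulus is the image of a compact rectangle in
    [R * R], where continuity and compactness are then used. *)
Definition polz p : C := (expR p.1)%:C%C * expi p.2.

Lemma polzX p (k : int) : polz p ^ k =
  (expR (k%:~R * p.1))%:C%C * expi (k%:~R * p.2).
Proof.
have aux (m : nat) : ((expR p.1)%:C%C : C) ^+ m = (expR (m%:R * p.1))%:C%C.
  by rewrite -rmorphXn /= expRM_natl.
have {}aux : ((expR p.1)%:C%C : C) ^ k = (expR (k%:~R * p.1))%:C%C.
  case: k => j; first exact: aux.
  by rewrite NegzE -invr_expz -exprnP aux -fmorphV -expRN -mulNr rmorphN.
by rewrite -aux expiMz -expfzMl.
Qed.

Lemma polzX_near p (k : int) (e : R) : 0 < e ->
  \forall q \near p, cabs (polz p ^ k - polz q ^ k) <= e.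
Proof.
move=> e0.
pose h1 (q : R * R) := expR (k%:~R * q.1) * cos (k%:~R * q.2).
pose h2 (q : R * R) := expR (k%:~R * q.1) * sin (k%:~R * q.2).
have c1 : continuous (fun q : R * R => expR (k%:~R * q.1)).
  move=> q; apply: (@continuous_comp _ _ _ (fun q : R * R => k%:~R * q.1) expR); last exact: continuous_expR.
  by apply: cvgMr; exact: cvg_fst.
have c2 : continuous (fun q : R * R => cos (k%:~R * q.2)).
  move=> q; apply: (@continuous_comp _ _ _ (fun q : R * R => k%:~R * q.2) cos); last exact: continuous_cos.
  by apply: cvgMr; exact: cvg_snd.
have c3 : continuous (fun q : R * R => sin (k%:~R * q.2)).
  move=> q; apply: (@continuous_comp _ _ _ (fun q : R * R => k%:~R * q.2) sin); last exact: continuous_sin.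
  by apply: cvgMr; exact: cvg_snd.
have d1 : h1 q @[q --> p] --> h1 p by apply: cvgM; [exact: c1|exact: c2].
have d2 : h2 q @[q --> p] --> h2 p by apply: cvgM; [exact: c1|exact: c3].
have e20 : 0 < e / 2 by rewrite divr_gt0.
move/cvgrPdist_le : d1 => /(_ _ e20) d1; move/cvgrPdist_le : d2 => /(_ _ e20) d2.
near=> q.
have n1 : `|h1 p - h1 q| <= e / 2 by near: q.
have n2 : `|h2 p - h2 q| <= e / 2 by near: q.
apply: le_trans (cabs_le_ReIm _) _.
rewrite !polzX [X in `|X|]cReD cImD.
rewrite (_ : complex.Re _ + complex.Re _ = h1 p - h1 q); last first.
  by rewrite /h1 /expi /= !mul0r !subr0.
rewrite (_ : complex.Im _ + complex.Im _ = h2 p - h2 q); last first.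
  by rewrite /h2 /expi /= !mul0r !addr0.
by rewrite [leRHS](splitr e) lerD.
Unshelve. all: by end_near. Qed.

Section Wt.
Variable nu : int -> R.
Hypothesis nuP : beurling_weight nu.

(** An e/3 argument: both values are within e/3 of those of a truncation, which involves finitely
    many continuous powers. *)
Lemma ev_polz_near f a p (e : R) : nbnd nu f a -> in_region nu (polz p) -> 0 < e ->
  \forall q \near p, in_region nu (polz q) -> cabs (ev (polz p) f - ev (polz q) f) <= e.
Proof.
move=> hf hp e0; have e30 : 0 < e / 3 by rewrite divr_gt0.
have a0 := nbnd_ge0 nuP hf; have ap : 0 < a + 1 by rewrite ltr_wpDl.
have [n hn] := nbnd_tail nuP hf e30.
set P := lproj (win n) f.
have hP : nbnd nu P a by exact: nbnd_lproj.
pose e' := e / 3 / (a + 1).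
have e'0 : 0 < e' by rewrite divr_gt0.
have nearP : \forall q \near p, forall i : 'I_n,
    cabs (polz p ^ i - polz q ^ i) <= e' /\ cabs (polz p ^ (- i%:Z) - polz q ^ (- i%:Z)) <= e'.
  apply: (filter_forall (nbhs_filter (p : R * R))) => i.
  by apply: filterI; exact: polzX_near.
apply: filterS nearP => q qP hq.
have E1 : cabs (ev (polz p) f - ev (polz p) P) <= e / 3.
  by rewrite -(evB nuP hp hf hP); apply: cabs_ev hn.
have E2 : cabs (ev (polz q) f - ev (polz q) P) <= e / 3.
  by rewrite -(evB nuP hq hf hP); apply: cabs_ev hn.
have E3 : cabs (ev (polz p) P - ev (polz q) P) <= e / 3.
  have s1 := ev_summable hp hP.
  have s2 : abs_summable (fun k => - (P k * polz q ^ k)).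
    by apply: esum_lt_trans (ev_summable hq hP) => k; rewrite cabsN.
  rewrite /ev -(csumN (ev_summable hq hP)) -(csumD s1 s2) -lee_fin.
  apply: le_trans (cabs_csum (abs_summableD s1 s2)) _.
  apply: (@le_trans _ _ (e'%:E * a%:E)%E); last first.
    rewrite -EFinM lee_fin /e' mulrAC ler_pdivrMr; last exact: ap.
    by rewrite ler_wpM2l ?(ltW e30)// lerDl.
  apply: le_trans (lee_wpmul2l _ hP); last by rewrite lee_fin ltW.
  rewrite -esumZl ?(ltW e'0)//; last first.
    by move=> k; rewrite lee_fin mulr_ge0// beurling_ge0.
  apply: le_esum => k _; rewrite -EFinM lee_fin.
  rewrite -mulrBr cabsM [leRHS]mulrA mulrC.
  have [kn|kn] := boolP (win n k); last by rewrite /P ecoef_lproj (negbTE kn) cabs0 !mulr0.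
  rewrite ler_wpM2r//.
  apply: (@le_trans _ _ e'); last by rewrite ler_peMr ?(ltW e'0)// beurling_ge1.
  have := qP (Ordinal kn); case: k kn => j kn [h1 h2]; first exact: h1.
  by rewrite NegzE.
move: E1 E2 E3.
generalize (ev (polz p) f) (ev (polz p) P) (ev (polz q) f) (ev (polz q) P).
move=> x1 x2 x3 x4 E1 E2 E3.
rewrite (_ : x1 - x3 = (x1 - x2) + (x2 - x4) - (x3 - x4)); last by ring.
apply: le_trans (ler_cabsD _ _) _; rewrite (_ : e = e / 3 + e / 3 + e / 3); last by field.
apply: lerD; last by rewrite cabsN.
by apply: le_trans (ler_cabsD _ _) _; apply: lerD.
Qed.

Let K : set (R * R) := `[- A_nu nu, A_nu nu]%classic `*` `[- pi, pi]%classic.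

Lemma ann_polz p : K p -> ann (A_nu nu) (polz p).
Proof.
case=> /=; rewrite in_itv /= => /andP[h1 h2] _.
rewrite /ann cabsM cabs_expi mulr1 cabs_real ger0_norm ?expR_ge0//.
by rewrite !ler_expR h1 h2.
Qed.

Lemma ann_polar z : ann (A_nu nu) z -> exists2 p, K p & z = polz p.
Proof.
move=> /[dup] zA /andP[z1 z2].
have [z0 _] := ann_nu nuP zA.
have [t [t1 ->]] := polar z0.
have zp : 0 < cabs z by rewrite cabs_gt0.
exists (ln (cabs z), t); last by rewrite /polz /= lnK.
split; rewrite /= in_itv//=.
by apply/andP; split; rewrite -ler_expR (lnK zp).
Qed.

(** Without a lower bound, points with values below 1/(m + 1) would cluster at a zero in the
    annulus. *)
Lemma ev_lower_bound f a : nbnd nu f a ->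
  (forall z, ann (A_nu nu) z -> ev z f != 0) ->
  exists2 d : R, 0 < d & forall z, ann (A_nu nu) z -> d <= cabs (ev z f).
Proof.
move=> hf f0; apply: contrapT => noD.
have Ex m : exists p, K p /\ cabs (ev (polz p) f) < m.+1%:R^-1.
  apply: contrapT => nop; apply: noD; exists m.+1%:R^-1; first by rewrite invr_gt0.
  move=> z /ann_polar[p Kp ->]; rewrite leNgt; apply/negP => lt.
  by apply: nop; exists p.
have [u uP] := choice Ex.
have cK : compact K by apply: compact_setX; exact: segment_compact.
have [|p [Kp cl]] := cK (u @ \oo) _; first by exists 0%N => // m _; exact: (uP m).1.
apply/negP: (f0 _ (ann_polz Kp)); rewrite negbK -cabs_eq0 eq_le cabs_ge0 andbT.
have hp := ann_nu nuP (ann_polz Kp).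
apply/ler_addgt0Pl => e e0; rewrite addr0.
have e20 : 0 < e / 2 by rewrite divr_gt0.
have nearP := ev_polz_near hf hp e20.
have [M hM] : exists M : nat, M.+1%:R^-1 <= e / 2.
  exists (Num.bound (e / 2)^-1).
  rewrite -[leRHS]invrK lef_pV2 ?posrE ?invr_gt0 ?ltr0n//.
  apply: ltW; apply: lt_le_trans (archi_boundP _) _; first by rewrite invr_ge0 ltW.
  by rewrite ler_nat.
have [|q [[m Mm qE] qP]] := cl (u @` [set m | (M <= m)%N]) _ _ nearP.
  by exists M => // m /= Mm; exists m.
subst q.
have [Ku hu] := uP m.
have E1 := qP (ann_nu nuP (ann_polz Ku)).
have E2 : cabs (ev (polz (u m)) f) <= e / 2.
  apply: le_trans (ltW hu) _; apply: le_trans hM.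
  by rewrite lef_pV2 ?posrE ?ltr0n// ler_nat.
move: E1 E2; generalize (ev (polz p) f) (ev (polz (u m)) f) => x1 x2 E1 E2.
have := ler_cabsD (x1 - x2) x2; rewrite subrK => h.
by apply: le_trans h _; rewrite (splitr e) lerD.
Qed.

End Wt.
End LowerBound.

(** * Winding numbers *)

Section Winding.
Variable R : realType.
Local Notation C := R[i].
Local Notation L := (ell1 R).
Implicit Types (F G : R -> C) (nu : int -> R) (f g u : L).

Lemma eq_wind F G n : F =1 G -> wind F n -> wind G n.
Proof. by move=> /funext->. Qed.

Lemma wind_mul F G m n : wind F m -> wind G n -> wind (fun t => F t * G t) (m + n).
Proof.
case=> a [ca [ha a2]] [b [cb [hb b2]]].
exists (fun t => a t + b t); split; first exact: within_continuousD.
split; last by rewrite rmorphD /= mulrDr -a2 -b2; ring.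
move=> t ht; rewrite expiD {1}ha// {1}hb// mulrACA; congr (_ * _).
apply/eqP; rewrite eq_complex /=.
by rewrite cabsM !mul0r !mulr0 subr0 addr0 !eqxx.
Qed.

Lemma wind_expi (n : int) : wind (fun t : R => expi t ^ n) n.
Proof.
exists (fun t => n%:~R * t); split.
  by apply: continuous_subspaceT => t; apply: cvgMr; exact: cvg_id.
split; last by ring.
by move=> t _; rewrite cabsXz cabs_expi exp1rz expiMz complexr0 mul1r.
Qed.

Lemma wind_const (c : C) : c != 0 -> wind (fun _ : R => c) 0.
Proof.
move=> c0; have [s [_ cE]] := polar c0.
exists (fun=> s); split; first by apply: continuous_subspaceT => t; exact: cvg_cst.
by split => //; rewrite subrr mulr0.
Qed.

(** Two continuous arguments differ by a function [c] with [expi (c t) = 1]. If the winding numbers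
    differed, [c] would grow by at least 2 pi for a suitable order of the two, hence take the value
    c(-pi) + pi, at which [expi] is -1. *)
Lemma wind_unique F m n : (forall t, F t != 0) -> wind F m -> wind F n -> m = n.
Proof.
move=> F0.
have key (m' n' : int) : wind F m' -> wind F n' -> ~ (n' < m').
  case=> a [ca [ha a2]] [b [cb [hb b2]]] lt.
  pose c t := a t - b t.
  have cc : {within `[- pi, pi]%classic, continuous c} by exact: within_continuousB.
  have p0 := pi_gt0 R.
  have c1 t : - pi <= t <= pi -> expi (c t) = 1 :> C.
    move=> ht; have := ha t ht; rewrite {1}(hb t ht).
    have n0 : Complex (cabs (F t)) 0 != 0 :> C.
      by rewrite complexr0 -(rmorph0 (real_complex R)) (inj_eq (@complexI R)) cabs_eq0.
    by move=> /(mulfI n0) e; rewrite expiD expiN e divff// expi_neq0.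
  have cpi : c pi - c (- pi) = 2 * pi * (m' - n')%:~R.
    by rewrite rmorphB /= mulrBr -a2 -b2 /c; ring.
  have d1 : 1 <= (m' - n')%:~R :> R by rewrite ler1z; lia.
  have h1 : - pi <= pi :> R by lra.
  have h2 : c (- pi) + pi <= c pi by nra.
  have [|t tI ct] := @IVT R c (- pi) pi (c (- pi) + pi) h1 cc.
    by rewrite ge_min le_max h2 orbT andbT lerDl (ltW p0).
  have := c1 t; rewrite in_itv /= in tI; move=> /(_ tI).
  rewrite ct expiD c1 ?mul1r; last by rewrite lexx h1.
  by rewrite /expi cospi => -[]; lra.
move=> hm hn; have := key _ _ hm hn; have := key _ _ hn hm; lia.
Qed.

Lemma expi_polz t : expi t = polz (0, t) :> C.
Proof. by rewrite /polz expR0 mul1r. Qed.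

Lemma ev_expi_continuous f :
  continuous (fun t : R => complex.Re (ev (expi t) f)) /\
  continuous (fun t : R => complex.Im (ev (expi t) f)).
Proof.
have [a ha] := ell1_bnd f.
have near (t e : R) : 0 < e -> \forall s \near t, cabs (ev (expi t) f - ev (expi s) f) <= e.
  move=> e0.
  have ht : in_region (wt1 R) (polz (0, t)).
    by rewrite -expi_polz; apply: in_region_expi; exact: wt1P.
  have h := ev_polz_near (wt1P R) ha ht e0.
  case: h => -[U V] [/= U0 Vt] UV; apply: filterS Vt => s Vs; rewrite !expi_polz.
  apply: (UV (0, s)); first by split => //; exact: nbhs_singleton.
  by rewrite -expi_polz; apply: in_region_expi; exact: wt1P.
split=> t; apply/cvgrPdist_le => e e0; apply: filterS (near t e e0) => s /=;
  apply: le_trans.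
  by apply: le_trans (normr_Re_cabs _); rewrite cReD; case: (ev (expi s) f).
by apply: le_trans (normr_Im_cabs _); rewrite cImD; case: (ev (expi s) f).
Qed.

Lemma expi_atan (x y : R) : 0 < x ->
  Complex x y = Complex (cabs (Complex x y)) 0 * expi (atan (y / x)).
Proof.
move=> x0; set v := y / x.
have y0 : y = x * v by rewrite /v mulrC divfK// gt_eqF.
have s0 : 0 < Num.sqrt (1 + v ^+ 2) by rewrite sqrtr_gt0 ltr_pwDl// sqr_ge0.
have cE : cabs (Complex x y) = x * Num.sqrt (1 + v ^+ 2).
  rewrite /cabs /= y0 exprMn -[X in X + _]mulr1 -mulrDr sqrtrM ?sqr_ge0//.
  by rewrite sqrtr_sqr gtr0_norm.
have c0 : cos (atan v) = (Num.sqrt (1 + v ^+ 2))^-1 by rewrite cos_atan.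
have sE : sin (atan v) = v * cos (atan v).
  have e : sin (atan v) / cos (atan v) = v := atanK v.
  by rewrite -{2}e divfK// c0 invr_eq0 gt_eqF.
apply/eqP; rewrite eq_complex /= !mul0r subr0 addr0 cE sE c0.
have S0 := lt0r_neq0 s0; apply/andP; split; apply/eqP; first by rewrite mulfK.
by rewrite mulrACA divff// mulr1.
Qed.

(** The curve stays in the right half-plane, where the arctangent is a continuous argument that
    takes the same value at both ends. *)
Lemma wind_ev_near1 u (r : R) : nbnd (@wt1 R) u r -> r < 1 ->
  wind (fun t => ev (expi t) (1 - u)) 0.
Proof.
move=> hu r1.
have hz t := in_region_expi t (wt1P R).
have h1 := nbnd_delta (wt1P R) 0 (1 : C).
have x0 t : 0 < complex.Re (ev (expi t) (1 - u)).
  rewrite (evB (wt1P R) (hz t) h1 hu) (ev1 (expi t)) cReD /=.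
  have := cabs_ev (hz t) hu; have := normr_Re_cabs (- ev (expi t) u).
  rewrite cabsN; move: (complex.Re _) (cabs _) => x y h2 h3.
  have : `|x| < 1 by apply: le_lt_trans r1; exact: le_trans h3.
  rewrite ltr_norml => /andP[]; lra.
have [cr ci] := ev_expi_continuous (1 - u).
exists (fun t => atan (complex.Im (ev (expi t) (1 - u)) / complex.Re (ev (expi t) (1 - u)))).
split.
  apply: continuous_subspaceT => t.
  apply: (@continuous_comp _ _ _ (fun t => complex.Im (ev (expi t) (1 - u)) /
    complex.Re (ev (expi t) (1 - u))) atan); last exact: continuous_atan.
  apply: cvgM; first exact: ci.
  by apply: cvgV; [rewrite gt_eqF|exact: cr].
split; last first.
  have -> : expi (- pi) = expi pi :> C by rewrite /expi cosN sinN sinpi oppr0.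
  by rewrite subrr mulr0.
move=> t _; have := @expi_atan _ (complex.Im (ev (expi t) (1 - u))) (x0 t).
by case: (ev _ _).
Qed.

End Winding.

(** * Wiener's lemma and Wiener-Hopf factorization *)

Section Factorization.
Variable R : realType.
Local Notation C := R[i].
Local Notation L := (ell1 R).
Implicit Types (f g u : L) (p : {poly C}) (k : int).

Definition has_bnd (nu : int -> R) f := exists a, nbnd nu f a.

(** For [P] equal to [nneg] or [npos]: [f] is a unit of the one-sided subalgebra of finite norm. The
    inverse is kept explicit because Baxter's equation is written with it. *)
Definition unit_on (nu : int -> R) (P : pred int) f f' : Prop :=
  [/\ supp P f, supp P f', f * f' = 1, has_bnd nu f & has_bnd nu f'].

(** Factorization and winding number travel together: exponents and winding numbers both add under
    products, so the exponent found algebraically is also the winding number. *)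
Definition wiener_hopf nu f k : Prop :=
  (exists g g' h h', [/\ unit_on nu nneg g g', unit_on nu npos h h' & f = dl R k * (g * h)]) /\
  wind (fun t => ev (expi t) f) k.

Section Weighted.
Variable nu : int -> R.
Hypothesis nuP : beurling_weight nu.

Lemma has_bndM f g : has_bnd nu f -> has_bnd nu g -> has_bnd nu (f * g).
Proof. by move=> [a ha] [b hb]; exists (a * b); exact: nbndM. Qed.

Lemma has_bndA f g : has_bnd nu f -> has_bnd nu g -> has_bnd nu (f + g).
Proof. by move=> [a ha] [b hb]; exists (a + b); exact: nbndA. Qed.

Lemma has_bndX f (m : nat) : has_bnd nu f -> has_bnd nu (f ^+ m).
Proof.
move=> hf; elim: m => [|m IH]; last by rewrite exprS; exact: has_bndM.
by rewrite expr0; eexists; exact: nbnd_delta.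
Qed.

Lemma has_bnd_delta k c : has_bnd nu (ell1_delta k c).
Proof. by eexists; exact: nbnd_delta. Qed.

Lemma unit_on1 (P : pred int) : P 0 -> unit_on nu P 1 1.
Proof.
by move=> P0; split; rewrite ?mulr1//; try exact: supp_dl; exact: has_bnd_delta.
Qed.

Lemma unit_onM (P : pred int) f f' g g' : (forall i j, P i -> P j -> P (i + j)) ->
  unit_on nu P f f' -> unit_on nu P g g' -> unit_on nu P (f * g) (f' * g').
Proof.
move=> PD [s1 s2 e1 b1 b2] [s3 s4 e2 b3 b4]; split; try exact: has_bndM.
- exact: suppM s1 s3 PD.
- exact: suppM s2 s4 PD.
- by rewrite mulrACA e1 e2 mulr1.
Qed.

Lemma nnegD i j : nneg i -> nneg j -> nneg (i + j).
Proof. exact: addr_ge0. Qed.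
Lemma nposD i j : npos i -> npos j -> npos (i + j).
Proof. rewrite /npos; lia. Qed.

Lemma ev_expiM f g t : ev (expi t) (f * g) = ev (expi t) f * ev (expi t) g :> C.
Proof.
have [a ha] := ell1_bnd f; have [b hb] := ell1_bnd g.
by rewrite (evM (in_region_expi t (wt1P R)) ha hb).
Qed.

Lemma wiener_hopfM f g j k : wiener_hopf nu f j -> wiener_hopf nu g k ->
  wiener_hopf nu (f * g) (j + k).
Proof.
move=> [[g1 [g1' [h1 [h1' [u1 v1 e1]]]]] w1] [[g2 [g2' [h2 [h2' [u2 v2 e2]]]]] w2]; split.
  exists (g1 * g2), (g1' * g2'), (h1 * h2), (h1' * h2'); split.
  - exact: unit_onM nnegD u1 u2.
  - exact: unit_onM nposD v1 v2.
  - by rewrite e1 e2 dlD; ring.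
apply: eq_wind (wind_mul w1 w2) => t; by rewrite ev_expiM.
Qed.

Lemma wiener_hopf_dl k : wiener_hopf nu (dl R k) k.
Proof.
split.
  exists 1, 1, 1, 1; split; [exact: unit_on1|exact: unit_on1|by rewrite !mulr1].
by apply: eq_wind (wind_expi R k) => t; rewrite ev_dl.
Qed.

Lemma wiener_hopf_const c : c != 0 -> wiener_hopf nu (lconst c) 0.
Proof.
move=> c0; split.
  exists (lconst c), (lconst c^-1), 1, 1; split; [|exact: unit_on1|by rewrite mulr1 mul1r].
  split; try exact: supp_lconst; try exact: has_bnd_delta.
  by rewrite -rmorphM /= divff// rmorph1.
by apply: eq_wind (wind_const c0) => t; rewrite ev_lconst.
Qed.

Lemma unit_on_neumann (P : pred int) u (r : R) : P 0 -> (forall i j, P i -> P j -> P (i + j)) ->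
  supp P u -> nbnd nu u r -> r < 1 -> exists s, unit_on nu P (1 - u) s.
Proof.
move=> P0 PD su hu r1; have [s [es bs ss]] := neumann_small nuP r1 hu.
exists (1 + s); split => //.
- by apply: suppB => //; exact: supp_dl.
- by apply: suppD; [exact: supp_dl|exact: ss].
- by apply: has_bndA; [exact: has_bnd_delta|exists r; exact: nbndN].
- by apply: has_bndA; [exact: has_bnd_delta|eexists; exact: bs].
Qed.

Lemma wiener_hopf_nneg u (r : R) : supp nneg u -> nbnd nu u r -> r < 1 ->
  wiener_hopf nu (1 - u) 0.
Proof.
move=> su hu r1; have [s us] := unit_on_neumann (P := nneg) isT nnegD su hu r1.
split; last by apply: wind_ev_near1 r1; exact: nbnd_wt1 hu.
by exists (1 - u), s, 1, 1; split; [|exact: unit_on1|rewrite mulr1 mul1r].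
Qed.

Lemma wiener_hopf_npos u (r : R) : supp npos u -> nbnd nu u r -> r < 1 ->
  wiener_hopf nu (1 - u) 0.
Proof.
move=> su hu r1; have [s us] := unit_on_neumann (P := npos) isT nposD su hu r1.
split; last by apply: wind_ev_near1 r1; exact: nbnd_wt1 hu.
by exists 1, 1, (1 - u), s; split; [exact: unit_on1| |rewrite !mul1r].
Qed.

(* The positive factor [1 + y] is found by asking that [(1 - u) * (1 + y)] have
   no positive part except 1, i.e. [y = [u]_+ + [u y]_+]; the bound 1/3 keeps
   both this factor and the remaining negative one within distance 1/2 of 1. *)
Lemma wiener_hopf_small u : nbnd nu u 3^-1 -> wiener_hopf nu (1 - u) 0.
Proof.
move=> hu.
have r0 : 0 <= 3^-1 :> R by rewrite invr_ge0.
have r1 : 3^-1 < 1 :> R by lra.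
split; last by apply: wind_ev_near1 r1; exact: nbnd_wt1 hu.
pose T f := lproj nneg (u * f).
have itb (j : nat) : nbnd nu (iter j T (lproj nneg u)) (3^-1 * 3^-1 ^+ j).
  elim: j => [|j IH]; first by rewrite expr0 mulr1; exact: nbnd_lproj.
  rewrite iterS exprS; have h := nbndM nuP hu IH.
  exact: (nbnd_lproj nuP nneg h).
have [||y [yE yb _]] := ell1_fixpoint nuP (T := T) (M := 3^-1) r0 r1 _ _ itb.
- by move=> f g; rewrite /T mulrDr lprojD.
- by move=> f b hf; apply: nbnd_lproj => //; exact: nbndM.
have yb' : nbnd nu y 2^-1.
  have e2 : 3^-1 / (1 - 3^-1) = 2^-1 :> R by field.
  by have := yb 0%N; rewrite big_ord0 subr0 expr0 mulr1 e2.
have ys : supp nneg y by rewrite yE; apply: suppD; exact: supp_lproj.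
pose neg : pred int := fun k => ~~ nneg k.
(* Since [y] is the nonnegative part of u + u y, only the strictly negative part survives in u + u y
   - y; its norm is at most 1/3 + 1/3 * 1/2 = 1/2. *)
pose m := lproj neg (u + u * y).
have mb : nbnd nu m 2^-1.
  apply: nbnd_lproj => //; apply: nbnd_le (nbndA nuP hu (nbndM nuP hu yb')); lra.
have ms : supp npos m.
  move=> k hk; apply: (supp_lproj (p := neg)); move: hk; rewrite /neg /npos /nneg; lia.
have h2 : 2^-1 < 1 :> R by lra.
have fact : (1 - u) * (1 + y) = 1 - m.
  have -> : (1 - u) * (1 + y) = 1 + y - (u + u * y) by ring.
  rewrite (lprojC (q := neg) (p := nneg) (u + u * y))//.
  by rewrite lprojD -/(T y) -yE -/m; ring.
have [s us] := unit_on_neumann (P := npos) isT nposD ms mb h2.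
have [s' us'] := unit_on_neumann (P := nneg) isT nnegD (suppN ys) (nbndN nuP yb') h2.
rewrite opprK in us'; case: (us') => a1 a2 a3 a4 a5.
exists s', (1 + y), (1 - m), s; split => //.
  by split => //; rewrite mulrC.
rewrite dl0 mul1r -fact mulrC -mulrA a3 mulr1//.
Qed.

End Weighted.

(** Substituting the monomial z for the variable makes compatibility with sums and products
    immediate; coefficients are computed once, in [ecoef_emb]. *)
Definition emb p : L := (map_poly (@lconst R) p).[dl R 1].

Lemma embD p q : emb (p + q) = emb p + emb q.
Proof. by rewrite /emb rmorphD hornerD. Qed.
Lemma embM p q : emb (p * q) = emb p * emb q.
Proof. by rewrite /emb rmorphM hornerM. Qed.
Lemma embC c : emb c%:P = lconst c.
Proof. by rewrite /emb map_polyC hornerC. Qed.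
Lemma embX : emb 'X = dl R 1.
Proof. by rewrite /emb map_polyX hornerX. Qed.

Lemma ecoef_emb p k : emb p k = if 0 <= k then p`_`|k| else 0.
Proof.
elim/poly_ind: p k => [|p c IH] k.
  by rewrite -polyC0 embC rmorph0 coef0 if_same.
rewrite embD embM embX embC ecoefD mulrC ecoef_dlM IH /= coefD coefC coefMX.
case: k => [[|n]|n] /=; last by rewrite addr0.
- by rewrite add0r.
- by rewrite subn1.
Qed.

Lemma has_bnd_emb nu p : beurling_weight nu -> has_bnd nu (emb p).
Proof.
move=> nuP; elim/poly_ind: p => [|p c IH].
  by rewrite -polyC0 embC; exact: has_bnd_delta.
rewrite embD embM embX embC; apply: has_bndA => //; last exact: has_bnd_delta.
by apply: has_bndM => //; exact: has_bnd_delta.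
Qed.

Lemma ev_emb nu z p : beurling_weight nu -> in_region nu z -> ev z (emb p) = p.[z].
Proof.
move=> nuP zP; elim/poly_ind: p => [|p c IH].
  by rewrite -polyC0 embC ev_lconst hornerC.
rewrite embD embM embX embC hornerMXaddC.
have [a ha] := has_bnd_emb p nuP.
have h1 := nbnd_delta nuP 1 (1 : C).
rewrite (evD zP (nbndM nuP ha h1) (nbnd_delta nuP 0 c)).
by rewrite (evM zP ha h1) IH ev_dl ev_lconst expr1z.
Qed.

(** Each linear factor is treated by the position of its root: z - b = z (1 - b/z) for a root
    inside, z - b = -b (1 - z/b) for a root outside. The conditions |b| < e^(-x) and |b| > e^x are
    what makes b/z, respectively z/b, of norm below 1 for [wexp x]. *)
Lemma wiener_hopf_poly (x : R) p : 0 <= x -> p != 0 ->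
  (forall z, root p z -> ~ ann x z) -> exists k, wiener_hopf (wexp x) (emb p) k.
Proof.
move=> x0 p0 hp.
have wP := wexpP x0.
have [r pE] := closed_field_poly_normal p.
have lc0 : lead_coef p != 0 by rewrite lead_coef_eq0.
have rr z : z \in r -> ~ ann x z.
  move=> zr; apply: hp; rewrite pE rootZ// root_prod_XsubC//.
have [k hk] : exists k, wiener_hopf (wexp x) (emb (\prod_(z <- r) ('X - z%:P))) k.
  elim: r {pE} rr => [|b r IH] hr.
    exists 0; rewrite big_nil -[1]/(1%:P) embC; apply: wiener_hopf_const => //; exact: oner_neq0.
  have [|k hk] := IH; first by move=> z zr; apply: hr; rewrite inE zr orbT.
  have hb := hr b (mem_head _ _).
  rewrite big_cons embM.
  have [j hj] : exists j, wiener_hopf (wexp x) (emb ('X - b%:P)) j; last first.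
    by exists (j + k); exact: wiener_hopfM.
  rewrite -polyCN embD embX embC.
  have [lo|lo] := ltP (cabs b) (expR (- x)).
    exists 1; rewrite (_ : _ + _ = dl R 1 * (1 - lconst b * dl R (- 1))); last first.
      by rewrite mulrBr mulr1 mulrCA dlVK mulr1 rmorphN.
    rewrite -[X in wiener_hopf _ _ X]addr0; apply: wiener_hopfM => //; first exact: wiener_hopf_dl.
    have hb1 := nbndM wP (nbnd_delta wP 0 b) (nbnd_delta wP (- 1) 1).
    apply: (wiener_hopf_npos wP _ hb1); first by apply: supp_nposM; [exact: supp_lconst|exact: supp_dl].
    rewrite /wexp /= cabs1 mulr0 expR0 mul1r !mulr1.
    by rewrite -ltr_pdivlMr ?expR_gt0// div1r -expRN.
  have [hi|hi] := ltP (expR x) (cabs b); last by case: hb; rewrite /ann lo hi.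
  have bp : 0 < cabs b by apply: lt_trans hi; exact: expR_gt0.
  have b0 : b != 0 by rewrite -cabs_gt0.
  exists 0; rewrite (_ : _ + _ = lconst (- b) * (1 - lconst b^-1 * dl R 1)); last first.
    rewrite mulrBr mulr1 mulrA -rmorphM /= mulNr divff// (rmorphN (@lconst R) 1) rmorph1; ring.
  rewrite -[X in wiener_hopf _ _ X]addr0; apply: wiener_hopfM => //.
    by apply: wiener_hopf_const => //; rewrite oppr_eq0.
  have hb1 := nbndM wP (nbnd_delta wP 0 b^-1) (nbnd_delta wP 1 1).
  apply: (wiener_hopf_nneg wP _ hb1); first by apply: supp_nnegM; [exact: supp_lconst|exact: supp_dl].
  rewrite /wexp /= cabs1 mulr0 expR0 mul1r !mulr1 cabsV.
  by rewrite mulrC ltr_pdivrMr// mul1r.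
exists (0 + k); rewrite pE -mul_polyC embM embC.
by apply: wiener_hopfM => //; exact: wiener_hopf_const.
Qed.

(** Multiplication by z^n turns [f] into a polynomial whose roots avoid the annulus. *)
Lemma wiener_hopf_laurent (x d : R) f n : 0 <= x -> supp (win n) f -> 0 < d ->
  (forall z, ann x z -> d <= cabs (ev z f)) -> exists k, wiener_hopf (wexp x) f k.
Proof.
move=> x0 sf d0 hd.
have wP := wexpP x0.
pose p := \poly_(i < (n + n)%N) f (i%:Z - n%:Z).
have fE : f = dl R (- n%:Z) * emb p.
  apply: ell1_eq => k; rewrite ecoef_dlM ecoef_emb opprK.
  have [kn|kn] := boolP (win n k).
    have h0 : 0 <= k + n%:Z by move: kn; rewrite /win; lia.
    rewrite h0 coef_poly ifT; last by move: kn; rewrite /win; lia.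
    by congr (f _); rewrite gez0_abs// addrK.
  rewrite sf//; case: ifP => // h0; rewrite coef_poly; case: ifP => // h1.
  by rewrite sf//; move: kn; rewrite /win; lia.
have z1 : ann x 1.
  by rewrite /ann cabs1 -{1}expR0 -[X in _ && (X <= _)]expR0 !ler_expR oppr_le0 x0.
have evE z : ann x z -> ev z f = z ^ (- n%:Z) * p.[z].
  move=> hz; have zP := ann_wexp hz; have [a ha] := has_bnd_emb p wP.
  by rewrite fE (evM zP (nbnd_delta wP _ _) ha) ev_dl (ev_emb _ wP zP).
have p0 : p != 0.
  apply/eqP => pz; have := hd 1 z1; rewrite evE// pz horner0 mulr0 cabs0 leNgt.
  by rewrite d0.
have [|k hk] := wiener_hopf_poly x0 p0.
  move=> z /rootP rz hz; have := hd z hz; rewrite evE// rz mulr0 cabs0 leNgt.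
  by rewrite d0.
exists (- n%:Z + k); rewrite fE; apply: wiener_hopfM => //; exact: wiener_hopf_dl.
Qed.

(** Factorizations are found for the exponential weight of a thicker annulus and then passed to
    [nu], which that weight dominates up to a constant. *)
Lemma wiener_hopf_sub (nu mu : int -> R) (K : R) f k : beurling_weight mu -> 0 <= K ->
  (forall j, nu j <= K * mu j) -> wiener_hopf mu f k -> wiener_hopf nu f k.
Proof.
move=> muP K0 hK.
have tr g : has_bnd mu g -> has_bnd nu g.
  move=> [a ha]; exists (K * a); rewrite /nbnd EFinM.
  have := lee_wpmul2l (_ : 0%:E <= K%:E)%E ha; rewrite lee_fin => /(_ K0).
  apply: le_trans; rewrite /nrm.
  rewrite -esumZl//; last by move=> j; rewrite lee_fin mulr_ge0// beurling_ge0.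
  by apply: le_esum => j _; rewrite -EFinM lee_fin mulrA ler_wpM2r.
case=> [[g [g' [h [h' [[a1 a2 a3 a4 a5] [b1 b2 b3 b4 b5] e]]]]] w]; split => //.
exists g, g', h, h'; split => //; split => //; exact: tr.
Qed.

(** * Inversion and factorization for a general Beurling weight *)

Section Main.
Variable nu : int -> R.
Hypothesis nuP : beurling_weight nu.

Lemma wiener_inverse f : has_bnd nu f ->
  (forall z, ann (A_nu nu) z -> ev z f != 0) ->
  exists2 v, f * v = 1 & has_bnd nu v.
Proof.
case=> a hf f0; have [d d0 hd] := ev_lower_bound nuP hf f0.
(* With |w| >= d, an error of d/4 leaves |P| >= 3d/4 on the annulus and 3d/8 on the thicker one. So
   1/P is at most 8/(3d) there, and its product with the error is 2/3 < 1. *)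
have d4 : 0 < d / 4 by rewrite divr_gt0.
have [n hn] := nbnd_tail nuP hf d4.
set P := lproj (win n) f in hn.
have hP : nbnd nu P a by exact: nbnd_lproj.
have d34 : 0 < 3 * d / 4 by rewrite divr_gt0 ?mulr_gt0.
have hdP z : ann (A_nu nu) z -> 3 * d / 4 <= cabs (ev z P).
  move=> hz; have zP := ann_nu nuP hz.
  have h1 := cabs_ev zP hn; rewrite (evB nuP zP hf hP) in h1.
  have h2 := hd z hz; move: h1 h2; generalize (ev z f) (ev z P) => x y h1 h2.
  have := ler_cabsD (x - y) y; rewrite subrK; lra.
have [e e0 he] := thicken_lower_bound nuP (supp_lproj (p := win n) f) hP d34 hdP.
have x0 : 0 <= A_nu nu + e by rewrite addr_ge0 ?A_nu_ge0// ltW.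
have wP := wexpP x0.
have d38 : 0 < 3 * d / 4 / 2 by rewrite divr_gt0.
(* The factorization serves here to produce an inverse of [P] with finite norm for the exponential
   weight. *)
have [k [[g [g' [h [h' [[_ _ e1 _ b1] [_ _ e2 _ b2] PE]]]]] _]] :=
  wiener_hopf_laurent x0 (supp_lproj (p := win n) f) d38 he.
rewrite -/P in PE.
pose Q := dl R (- k) * (g' * h').
have PQ : P * Q = 1.
  by rewrite PE /Q mulrACA dlVK mul1r mulrACA e1 e2 mulr1.
have [q hq] : has_bnd (wexp (A_nu nu + e)) Q.
  by apply: has_bndM => //; [exact: has_bnd_delta|exact: has_bndM].
have [D D0 hD] := nbnd_wexp nuP e0.
pose M := (3 * d / 4 / 2)^-1.
have [b hb] : has_bnd (wexp (A_nu nu + e)) P by exact: nbnd_win wP (supp_lproj (p := win n) f).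
have evQ z m : ann (A_nu nu + e) z -> cabs (ev z (Q ^+ m)) <= M ^+ m.
  move=> hz; have zP := ann_wexp hz.
  rewrite (evX wP zP m hq).1 cabsX lerXn2r ?nnegrE ?invr_ge0 ?(ltW d38)//.
  have := evM zP hb hq; rewrite PQ ev1 => /(congr1 (@cabs R)); rewrite cabs1 cabsM => E.
  have hz' := he z hz; rewrite /M -[leRHS]mul1r ler_pdivlMr//.
  by rewrite mulrC [leRHS]E; apply: ler_wpM2r.
have hQ m : nbnd nu (Q ^+ m) (D * M ^+ m).
  have [c hc] : has_bnd (wexp (A_nu nu + e)) (Q ^+ m) by apply: has_bndX => //; exists q.
  apply: hD => j.
  have cE (y : R) : `|y| <= A_nu nu + e ->
      cabs ((Q ^+ m) j) * expR y ^ j <= M ^+ m.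
    rewrite ler_norml => /andP[y1 y2].
    have cy : cabs (expR y)%:C%C = expR y by rewrite cabs_real ger0_norm// expR_ge0.
    have ay z : cabs z = expR y -> ann (A_nu nu + e) z.
      by move=> E; rewrite /ann E !ler_expR y1 y2.
    apply: (cauchy_coef wP (expR_gt0 y) _ hc) => [i|z zy]; last exact/evQ/ay.
    by rewrite -cy; have [] := ann_wexp (ay _ cy).
  (* The outer boundary circle serves the nonnegative indices, the inner one the negative
     indices. *)
  have [hj|hj] := leP 0 j.
    have := cE (A_nu nu + e); rewrite ger0_norm// lexx => /(_ isT).
    case: j hj {cE} => // j _; by rewrite /wexp -exprnP -expRM_natl [_%:R * _]mulrC.
  have := cE (- (A_nu nu + e)); rewrite normrN ger0_norm// lexx => /(_ isT).
  case: j hj {cE} => // j _; rewrite /wexp NegzE -invr_expz -exprnP expRN exprVn invrK -expRM_natl abszN.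
  by rewrite [j.+1%:R * _]mulrC.
pose u := (P - f) * Q.
have nu00 : 0 <= nu 0 by exact: beurling_ge0.
(* The constant [nu 0] is the norm of the unit, met at exponent 0. *)
have hX m : nbnd nu ((P - f) ^+ m) (nu 0 * (d / 4) ^+ m).
  elim: m => [|m IH].
    by rewrite !expr0; have := nbnd_delta nuP 0 (1 : C); rewrite cabs1.
  rewrite !exprS mulrCA; apply: nbndM => //.
  by rewrite -opprB; exact: nbndN.
have hu m : nbnd nu (u ^+ m) (nu 0 * D * (2 / 3) ^+ m).
  rewrite exprMn; apply: nbnd_le (nbndM nuP (hX m) (hQ m)).
  rewrite mulrACA -exprMn le_eqVlt; apply/orP; left; apply/eqP; congr (_ * _ ^+ _).
  by rewrite /M; field; lra.
have q0 : 0 <= 2 / 3 :> R by lra.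
have q1 : 2 / 3 < 1 :> R by lra.
have [s [sE sb]] := neumann_pow nuP q0 q1 (hu 1%N) hu.
exists (Q * s).
  rewrite (_ : f = P * (1 - u)); first by rewrite mulrACA PQ mul1r.
  rewrite /u mulrBr mulr1 mulrCA PQ mulr1; ring.
apply: has_bndM => //; last by eexists; exact: sb.
by have := hQ 1%N; rewrite expr1 => h1; eexists; exact: h1.
Qed.

(** The tolerance is fixed against the norm of the known inverse [v] before [P] is chosen; then [P]
    is inverted by a plain Neumann series and the remaining factor is close to 1 in norm. *)
Lemma beurling_wiener_hopf f : has_bnd nu f ->
  (forall z, ann (A_nu nu) z -> ev z f != 0) -> exists k, wiener_hopf nu f k.
Proof.
move=> bf f0; have [v fv [b hb]] := wiener_inverse bf f0; case: bf => a hf.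
have b0 := nbnd_ge0 nuP hb.
(* This tolerance gives (f - P) v norm at most 1/4, hence [s] norm at most 1/3, and u = - (e + e s)
   norm at most 1/4 + 1/12 = 1/3, as [wiener_hopf_small] requires. *)
have b4 : 0 < (4 * (b + 1))^-1 by rewrite invr_gt0; lra.
have [n hn] := nbnd_tail nuP hf b4.
set P := lproj (win n) f in hn.
have hP : nbnd nu P a by exact: nbnd_lproj.
pose e := (f - P) * v.
have he : nbnd nu e 4^-1.
  apply: nbnd_le (nbndM nuP hn hb).
  by rewrite mulrC ler_pdivrMr; lra.
have q1 : 4^-1 < 1 :> R by lra.
have [s [es bs _]] := neumann_small nuP q1 he.
have e3 : 4^-1 / (1 - 4^-1) = 3^-1 :> R by field.
rewrite e3 in bs.
pose V := v * (1 + s).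
have Pv : P * v = 1 - e by rewrite /e mulrBl fv; ring.
have PV : P * V = 1 by rewrite /V mulrA Pv.
pose u := (P - f) * V.
have hu : nbnd nu u 3^-1.
  have -> : u = - (e + e * s) by rewrite /u /V /e; ring.
  apply: nbndN => //; apply: nbnd_le (nbndA nuP he (nbndM nuP he bs)); lra.
have [B hB] : has_bnd nu V.
  apply: has_bndM => //; first by exists b.
  by apply: has_bndA => //; [exact: has_bnd_delta|eexists; exact: bs].
have B0 : 0 < B + 1 by have := nbnd_ge0 nuP hB; lra.
(* From P V = 1 and |V| <= B on the annulus, [P] is bounded below there and can be factored on a
   thicker annulus. *)
have hd z : ann (A_nu nu) z -> (B + 1)^-1 <= cabs (ev z P).
  move=> hz; have zP := ann_nu nuP hz.
  have := evM zP hP hB; rewrite PV ev1 => /(congr1 (@cabs R)); rewrite cabs1 cabsM => E.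
  rewrite -[leLHS]mul1r ler_pdivrMr// E ler_wpM2l//.
  apply: le_trans (cabs_ev zP hB) _; lra.
have Bi : 0 < (B + 1)^-1 by rewrite invr_gt0.
have [x x0 hx] := thicken_lower_bound nuP (supp_lproj (p := win n) f) hP Bi hd.
have Ax : 0 <= A_nu nu + x by rewrite addr_ge0 ?A_nu_ge0// ltW.
have Bi2 : 0 < (B + 1)^-1 / 2 by rewrite divr_gt0.
have [k hk] := wiener_hopf_laurent Ax (supp_lproj (p := win n) f) Bi2 hx.
have [K K0 hK] := beurling_growth nuP x0.
have hk' := wiener_hopf_sub (wexpP Ax) K0 hK hk.
exists (k + 0); rewrite (_ : f = P * (1 - u)).
  by apply: wiener_hopfM => //; exact: wiener_hopf_small.
by rewrite /u mulrBr mulr1 mulrCA PV mulr1; ring.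
Qed.

End Main.
End Factorization.

(** * Baxter's argument *)

Section Baxter.
Variable R : realType.
Local Notation C := R[i].
Local Notation L := (ell1 R).
Implicit Types (f g F G x y : L) (k : int) (m n : nat).

Definition from (m : int) : pred int := fun k => m <= k.
Definition upto (m : int) : pred int := fun k => k <= m.
Definition below (m : int) : pred int := fun k => k < m.
Definition above (m : int) : pred int := fun k => m < k.

Lemma ecoefM_from f g (m n : int) : supp (from m) f -> supp (from n) g -> (f * g) (m + n) = f m * g n.
Proof.
move=> sf sg; rewrite ecoefM -[RHS](csum_pt m); apply: eq_csum => j.
case: eqP => [->|/eqP jm]; first by rewrite addrAC subrr add0r.
have [lt|le] := ltP j m; first by rewrite sf ?mul0r// /from -ltNge.
by rewrite [X in _ * X]sg ?mulr0// /from; lia.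
Qed.

Lemma ecoefM_upto f g (m n : int) : supp (upto m) f -> supp (upto n) g -> (f * g) (m + n) = f m * g n.
Proof.
move=> sf sg; rewrite ecoefM -[RHS](csum_pt m); apply: eq_csum => j.
case: eqP => [->|/eqP jm]; first by rewrite addrAC subrr add0r.
have [lt|le] := ltP m j; first by rewrite sf ?mul0r// /upto -ltNge.
by rewrite [X in _ * X]sg ?mulr0// /upto; lia.
Qed.

(** The order is that of [R[i]], so a majorant automatically has real nonnegative coefficients. *)
Definition maj f F := forall k, `|f k| <= F k.

Lemma majD f g F G : maj f F -> maj g G -> maj (f + g) (F + G).
Proof. by move=> hf hg k; apply: le_trans (ler_normD _ _) _; exact: lerD. Qed.

Lemma maj_lproj (p q : pred int) f F : (forall k, p k -> q k) -> maj f F ->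
  maj (lproj p f) (lproj q F).
Proof.
move=> pq h k; rewrite !ecoef_lproj; case: ifPn => [/pq->//|_].
by rewrite normr0; case: ifP => // _; exact: le_trans (h k).
Qed.

Lemma maj_real f F k : maj f F -> F k = (complex.Re (F k))%:C%C /\ cabs (f k) <= complex.Re (F k).
Proof.
move=> h; have F0 : 0 <= F k by exact: le_trans (h k).
have e : F k = (complex.Re (F k))%:C%C by rewrite RRe_real// ger0_real.
by split=> //; have := h k; rewrite e -cabsE lecR.
Qed.

Lemma majM f g F G : maj f F -> maj g G -> maj (f * g) (F * G).
Proof.
move=> hf hg k; pose r j := complex.Re (F j) * complex.Re (G (k - j)).
have rF j := maj_real j hf; have rG j := maj_real j hg.
have r0 j : 0 <= r j.
  rewrite mulr_ge0//; first exact: le_trans (cabs_ge0 _) (rF j).2.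
  exact: le_trans (cabs_ge0 _) (rG _).2.
have rE j : F j * G (k - j) = (r j)%:C%C.
  by rewrite (rF j).1 (rG (k - j)).1 -rmorphM.
have fin : (\esum_(j in [set: int]) (r j)%:E < +oo)%E.
  apply: le_lt_trans (conv_summable F G k); apply: le_esum => j _.
  by rewrite rE cabs_real lee_fin ger0_norm.
rewrite [leRHS]ecoefM (eq_csum rE) csum_nneg// -cabsE lecR -lee_fin fineK ?esum_fin//.
rewrite ecoefM; apply: le_trans (cabs_csum (conv_summable f g k)) _.
apply: le_esum => j _; rewrite lee_fin cabsM; apply: ler_pM => //.
  exact: (rF j).2.
exact: (rG _).2.
Qed.

Lemma absP f : abs_summable (fun k => (cabs (f k))%:C%C : C).
Proof. by apply: esum_lt_trans (ecoefP f) => k; rewrite cabs_real ger0_norm. Qed.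
Definition labs f : L := Ell1 (absP f).

Lemma maj_labs f : maj f (labs f).
Proof. by move=> k /=; rewrite cabsE. Qed.

Variable nu : int -> R.
Hypothesis nuP : beurling_weight nu.

Lemma nbnd_labs f (a : R) : nbnd nu f a -> nbnd nu (labs f) a.
Proof. by apply: nbnd_mono => // k; rewrite /= cabs_real ger0_norm. Qed.

Section Operator.
Variables b c : L.

(** The truncated [b] is the source of smallness: only a coefficient of [b] above [n] can lift an
    index below [-n] to a nonnegative one, which is the content of [baxter_trunc]. *)
Definition baxter_op (n : nat) x : L :=
  lproj nneg (lproj (above n) b * lproj (below (- n%:Z)) (c * x)).

Lemma baxter_opD n : {morph baxter_op n : x y / x + y}.
Proof. by move=> x y; rewrite /baxter_op mulrDr lprojD mulrDr lprojD. Qed.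

Lemma nbnd_baxter_op n (e B X : R) x : nbnd nu (lproj (above n) b) e -> nbnd nu c B ->
  nbnd nu x X -> nbnd nu (baxter_op n x) (e * B * X).
Proof.
move=> hb hc hx; apply: nbnd_lproj => //; rewrite -mulrA; apply: nbndM => //.
by apply: nbnd_lproj => //; exact: nbndM.
Qed.

Lemma baxter_op_nneg n x : supp nneg (baxter_op n x).
Proof. exact: supp_lproj. Qed.

Lemma baxter_op_contraction : has_bnd nu b -> has_bnd nu c ->
  exists n0 : nat, forall n, (n0 <= n)%N -> forall x (X : R), nbnd nu x X ->
    nbnd nu (baxter_op n x) (2^-1 * X).
Proof.
move=> [a ha] [B hB]; have B0 := nbnd_ge0 nuP hB.
have e0 : 0 < (2 * (B + 1))^-1 by rewrite invr_gt0; lra.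
have [n0 h0] := nbnd_tail nuP ha e0.
exists n0 => n n0n x X hx; have X0 := nbnd_ge0 nuP hx.
apply: (@nbnd_le _ nu _ ((2 * (B + 1))^-1 * B * X)).
  by rewrite ler_wpM2r// mulrC ler_pdivrMr; lra.
have hbn : nbnd nu (lproj (above n) b) (2 * (B + 1))^-1.
  apply: (nbnd_mono nuP _ h0) => k.
  rewrite ecoefB !ecoef_lproj; case: ifPn => [kn|_]; last by rewrite cabs0.
  by rewrite ifF ?subr0//; move: kn; rewrite /above /win; lia.
exact: nbnd_baxter_op hbn hB hx.
Qed.

(** The difference of two solutions is fixed by the operator, hence its norm bound can be halved
    arbitrarily often. *)
Lemma baxter_op_inj n x y : (forall x (X : R), nbnd nu x X -> nbnd nu (baxter_op n x) (2^-1 * X)) ->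
  has_bnd nu x -> has_bnd nu y -> x - baxter_op n x = y - baxter_op n y -> x = y.
Proof.
move=> hK [X hX] [Y hY] e; apply/eqP; rewrite -subr_eq0; apply/eqP.
have dE : x - y = baxter_op n (x - y).
  apply: (addIr (baxter_op n y)); rewrite -baxter_opD subrK.
  have xE : x = y - baxter_op n y + baxter_op n x by rewrite -e subrK.
  by rewrite {1}xE; ring.
have hd := nbndB nuP hX hY.
have D0 := nbnd_ge0 nuP hd.
have itb j : nbnd nu (x - y) ((X + Y) * 2^-1 ^+ j).
  elim: j => [|j IH]; first by rewrite mulr1.
  by rewrite dE exprS mulrCA; exact: hK.
apply: (nbnd_eq0 nuP) => d d0.
have h0 : 0 <= 2^-1 :> R by lra.
have h1 : 2^-1 < 1 :> R by lra.
have [m hm] := geometric_small h0 h1 D0 d0.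
exact: nbnd_le hm (itb m).
Qed.

End Operator.

(** A larger [n] keeps fewer indices in both truncations, so the operator for [m] dominates. *)
Lemma baxter_op_maj (b c B D : L) n m x (X : L) : maj b B -> maj c D -> (m <= n)%N -> maj x X ->
  maj (baxter_op b c n x) (baxter_op B D m X).
Proof.
move=> hb hc mn hx; apply: maj_lproj => //; apply: majM.
  by apply: maj_lproj => // k; rewrite /above; lia.
by apply: maj_lproj; [move=> k; rewrite /below; lia|exact: majM].
Qed.

(* A single n-independent majorant of all the solutions: iterating from the
   same starting point, the operator for [n] is dominated termwise by the
   operator for [n0] built from the absolute values. *)
Lemma baxter_solve b c (eta : C) : has_bnd nu b -> has_bnd nu c ->
  exists (n0 : nat) (A : L), has_bnd nu A /\ forall n, (n0 <= n)%N ->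
    [/\ forall x (X : R), nbnd nu x X -> nbnd nu (baxter_op b c n x) (2^-1 * X) &
    exists x, [/\ has_bnd nu x, x = lconst eta + baxter_op b c n x & maj x A]].
Proof.
move=> hb hc.
have [n1 h1] := baxter_op_contraction hb hc.
have [n2 h2] : exists n0 : nat, forall n, (n0 <= n)%N -> forall x (X : R), nbnd nu x X ->
    nbnd nu (baxter_op (labs b) (labs c) n x) (2^-1 * X).
  case: hb hc => [a ha] [a' ha']; apply: baxter_op_contraction.
    by exists a; exact: nbnd_labs.
  by exists a'; exact: nbnd_labs.
pose n0 := maxn n1 n2.
have q0 : 0 <= 2^-1 :> R by lra.
have q1 : 2^-1 < 1 :> R by lra.
have solve (T : L -> L) e : {morph T : x y / x + y} ->
    (forall x (X : R), nbnd nu x X -> nbnd nu (T x) (2^-1 * X)) ->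
    exists s, [/\ s = lconst e + T s, has_bnd nu s & exists2 K : R, 0 <= K & forall m,
      nbnd nu (s - \sum_(k < m) iter k T (lconst e)) (K * 2^-1 ^+ m)].
  move=> TD TB; have h := nbnd_delta nuP 0 e.
  have itb (k : nat) : nbnd nu (iter k T (lconst e)) (nu 0 * cabs e * 2^-1 ^+ k).
    elim: k => [|k IH]; first by rewrite mulr1.
    by rewrite iterS exprS mulrCA; exact: TB.
  have [s [sE sb _]] := ell1_fixpoint nuP q0 q1 TD TB itb.
  exists s; split => //.
    by have := sb 0%N; rewrite big_ord0 subr0 => ?; eexists; eassumption.
  exists (nu 0 * cabs e / (1 - 2^-1)).
    by rewrite divr_ge0 ?mulr_ge0 ?(beurling_ge0 nuP)//; lra.
  by move=> m; rewrite mulrAC; exact: sb.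
have [A [_ hA [KA KA0 sA]]] := solve (baxter_op (labs b) (labs c) n0) (cabs eta)%:C%C
  (baxter_opD _ _ _) (h2 n0 (leq_maxr _ _)).
exists n0, A; split=> // n n0n.
have hn := h1 n (leq_trans (leq_maxl _ _) n0n); split=> //.
have [x [xE hx [Kx Kx0 sx]]] := solve (baxter_op b c n) eta (baxter_opD _ _ _) hn.
exists x; split => // j.
pose S m := \sum_(k < m) iter k (baxter_op b c n) (lconst eta).
pose SA m := \sum_(k < m) iter k (baxter_op (labs b) (labs c) n0) (lconst (cabs eta)%:C%C).
have it (k : nat) : maj (iter k (baxter_op b c n) (lconst eta))
   (iter k (baxter_op (labs b) (labs c) n0) (lconst (cabs eta)%:C%C)).
  elim: k => [|k IH].
    by move=> i /=; case: ifP => _; rewrite ?normr0// cabsE.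
  by rewrite !iterS; apply: baxter_op_maj => //; exact: maj_labs.
have mS m : maj (S m) (SA m).
  elim: m => [|m IH]; first by move=> i; rewrite /S /SA !big_ord0 normr0.
  by rewrite /S /SA !big_ord_recr /=; apply: majD.
(* The partial sums of the two iterations compare termwise, and both are geometrically close to
   their limits. *)
have near m : cabs (x j) <= complex.Re (A j) + (Kx + KA) * 2^-1 ^+ m.
  have [_ h3] := maj_real j (mS m).
  have h4 := nbnd_cabs nuP j (sx m); have h5 := nbnd_cabs nuP j (sA m).
  rewrite ecoefB in h4; rewrite ecoefB in h5.
  move: h3 h4 h5; rewrite -/(S m) -/(SA m).
  generalize (x j) (A j) (S m j) (SA m j) => x1 A1 S1 SA1 h3 h4 h5.
  have h6 := normr_Re_cabs (A1 - SA1); rewrite cReD in h6.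
  have h7 := ler_cabsD (x1 - S1) S1; rewrite subrK in h7.
  have h8 : `|complex.Re A1 + complex.Re (- SA1)| <= KA * 2^-1 ^+ m by exact: le_trans h5.
  have h9 : complex.Re (- SA1) = - complex.Re SA1 by case: (SA1).
  move: h8; rewrite h9 ler_norml => /andP[h8 _].
  rewrite mulrDl; lra.
(* Majorization in [R[i]] also requires [A] to have real coefficients, a property inherited from the
   partial sums. *)
have imA : complex.Im (A j) = 0.
  have imS m : complex.Im (SA m j) = 0 by have [-> _] := maj_real j (mS m).
  apply/eqP; rewrite -normr_eq0 eq_le normr_ge0 andbT.
  apply/ler_addgt0Pl => d d0; rewrite addr0.
  have [m hm] := geometric_small q0 q1 KA0 d0.
  apply: le_trans hm; apply: le_trans (nbnd_cabs nuP j (sA m)).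
  apply: le_trans (normr_Im_cabs _); rewrite ecoefB cImD.
  by have := imS m; rewrite -/(SA m); case: (SA m j) => ? ? /= ->; rewrite oppr0 addr0.
have -> : A j = (complex.Re (A j))%:C%C.
  by move: imA; case: (A j) => ? ? /= ->.
rewrite -cabsE lecR; apply/ler_addgt0Pl => d d0.
have [m hm] := geometric_small q0 q1 (addr_ge0 Kx0 KA0) d0.
by apply: le_trans (near m) _; rewrite addrC lerD2r.
Qed.

(** * Orthogonal polynomials as solutions of Baxter's equation *)

Section Polynomials.
Variables (f g g' h h' : L).
Hypotheses (gP : unit_on nu nneg g g') (hP : unit_on nu npos h h') (fE : f = g * h).
(** With [g] and [h] in the roles of w_+ and w_-, [b] and [c] are the quotients w_-/w_+ and
    w_+/w_-. *)
Let b := h * g'.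
Let c := g * h'.

Let gg : g * g' = 1. Proof. by case: gP. Qed.
Let hh : h * h' = 1. Proof. by case: hP. Qed.

(* [baxter_mono n q] says that z^n q(z) is a monic polynomial of degree n that
   is orthogonal to 1, z, ..., z^(n-1) for the weight with coefficients [f]. *)
Definition baxter_mono (n : nat) (q : L) : Prop :=
  [/\ supp (from (- n%:Z)) q, supp npos q, q 0 = 1 &
      forall k, - n%:Z <= k -> k < 0 -> (q * f) k = 0].

Let lt n : pred int := below (- n%:Z).

Lemma baxter_trunc n x : lproj nneg (b * lproj (lt n) x) =
  lproj nneg (lproj (above n) b * lproj (lt n) x).
Proof.
rewrite {1}(lprojC (p := above n) (q := upto n) b); last first.
  by move=> k; rewrite /above /upto leNgt.
rewrite mulrDl lprojD [X in _ + X](@lproj_supp0 _ _ (below 0)) ?addr0//; last first.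
  by move=> k; rewrite /below /nneg; lia.
apply: suppM (supp_lproj _) (supp_lproj _) _ => i j.
rewrite /upto /lt /below; lia.
Qed.

(** Here q = y/g, where [y] and c x differ by [be], supported below [-n]. Three products then give
    the claims: q g = y bounds the support of [q] from below; q h = x + b be has nonnegative part
    [h 0] by the equation, which bounds the support from above and normalizes [q 0]; and q f = g x +
    h be has a gap from -n to -1, which is orthogonality. *)
Lemma baxter_construct n x : x = lconst (h 0) + baxter_op b c n x ->
  baxter_mono n (g' * lproj (from (- n%:Z)) (c * x)) /\
  (g' * lproj (from (- n%:Z)) (c * x)) (- n%:Z) = g' 0 * (c * x) (- n%:Z).
Proof.
move=> xE; case: (gP) (hP) => sg sg' _ _ _ [sh sh' _ _ _].
set y := lproj (from _) _; set q := g' * y; set be := - lproj (lt n) (c * x).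
have sx : supp nneg x.
  by rewrite xE; apply: suppD; [exact: supp_lconst|exact: baxter_op_nneg].
have yE : y = c * x + be.
  rewrite /be {1}(lprojC (p := from (- n%:Z)) (q := lt n) (c * x)) ?addrK//.
  by move=> k; rewrite /from /lt /below ltNge.
have sy : supp (from (- n%:Z)) y by exact: supp_lproj.
have sbe : supp (lt n) be by apply: suppN; exact: supp_lproj.
have qg : q * g = y by rewrite /q mulrAC mulrC [g' * g]mulrC gg mulr1.
have qh : q * h = b * be + x.
  rewrite /q yE mulrDr mulrDl /b /c.
  rewrite (_ : g' * (g * h' * x) * h = (g * g') * (h * h') * x); last by ring.
  by rewrite gg hh !mul1r addrC; congr (_ + _); ring.
have qhn : lproj nneg (q * h) = lconst (h 0).
  rewrite qh lprojD (lproj_id sx) /be mulrN lprojN baxter_trunc -/(baxter_op b c n x).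
  by rewrite {2}xE addrC addrK.
have sqh : supp npos (q * h).
  move=> k; have [->|k0] := eqVneq k 0; first by rewrite /npos lexx.
  move=> kn.
  have := congr1 (fun u : L => u k) qhn; rewrite ecoef_lproj /= (negbTE k0) ifT//.
  by move: kn; rewrite /npos /nneg; lia.
have qh0 : (q * h) 0 = h 0.
  by have := congr1 (fun u : L => u 0) qhn; rewrite ecoef_lproj /=.
have qE : q = (q * h) * h' by rewrite -mulrA hh mulr1.
split; last first.
  have := ecoefM_from (m := 0) (n := - n%:Z) sg' sy; rewrite add0r => ->.
  by rewrite /y ecoef_lproj /from lexx.
split.
- apply: suppM sg' sy _ => i j; rewrite /nneg /from; lia.
- by rewrite qE; exact: supp_nposM.
- rewrite qE; have := ecoefM_upto (m := 0) (n := 0) sqh sh'; rewrite addr0 => ->.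
  rewrite qh0; have := ecoefM_upto (m := 0) (n := 0) sh sh'.
  by rewrite addr0 hh => <-.
- move=> k kn k0.
  have -> : q * f = h * be + g * x.
    rewrite fE mulrA qg yE mulrDl addrC /c; congr (_ + _); first by rewrite mulrC.
    by rewrite (_ : g * h' * x * h = g * x * (h * h')); [rewrite hh mulr1|ring].
  rewrite ecoefD.
  have -> : (h * be) k = 0.
    have s1 : supp (lt n) (h * be).
      by apply: suppM sh sbe _ => i j; rewrite /npos /lt /below; lia.
    by apply: s1; rewrite /lt /below; lia.
  by rewrite (supp_nnegM sg sx) ?addr0// /nneg -ltNge.
Qed.

(** The converse reading: orthogonality leaves a gap in q f, whose two sides [Gp] and [Gm] give x =
    Gp/g and be = Gm/h; the supports of q g and q h then force the equation. With the injectivity of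
    [baxter_op_inj] this yields uniqueness. *)
Lemma baxter_recover n q : has_bnd nu q -> baxter_mono n q ->
  exists x, [/\ has_bnd nu x, x = lconst (h 0) + baxter_op b c n x &
    q = g' * lproj (from (- n%:Z)) (c * x)].
Proof.
move=> bq [sq1 sq2 q0 hq]; case: (gP) (hP) => sg sg' _ bg bg' [sh sh' _ bh bh'].
pose G := q * (g * h).
have bG : has_bnd nu G.
  by have := has_bndM nuP bq (has_bndM nuP bg bh).
pose Gp := lproj nneg G; pose Gm := lproj (lt n) G.
have GE : G = Gp + Gm.
  apply: ell1_eq => k; rewrite ecoefD !ecoef_lproj /nneg /lt /below.
  case: (leP 0 k) => k0; first by rewrite ifF ?addr0//; lia.
  by rewrite add0r; case: (ltP k (- n%:Z)) => kn //; rewrite /G -fE hq.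
pose x := g' * Gp; pose be := h' * Gm.
have has_lproj p u : has_bnd nu u -> has_bnd nu (lproj p u).
  by move=> [a ha]; exists a; exact: nbnd_lproj.
have bx : has_bnd nu x by apply: has_bndM => //; exact: has_lproj.
have sx : supp nneg x by apply: supp_nnegM => //; exact: supp_lproj.
have sbe : supp (lt n) be.
  by apply: suppM sh' (supp_lproj _) _ => i j; rewrite /npos /lt /below; lia.
have qg : q * g = c * x + be.
  have -> : q * g = h' * G.
    by rewrite /G (_ : h' * _ = q * g * (h * h')); [rewrite hh mulr1|ring].
  rewrite GE mulrDr /c /x; congr (_ + _).
  by rewrite (_ : g * h' * _ = (g * g') * (h' * Gp)); [rewrite gg mul1r|ring].
have sqg : supp (from (- n%:Z)) (q * g).
  by apply: suppM sq1 sg _ => i j; rewrite /from /nneg; lia.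
have fl : forall k, lt n k = ~~ from (- n%:Z) k by move=> k; rewrite /from /lt /below ltNge.
have beE : be = - lproj (lt n) (c * x).
  have := congr1 (lproj (lt n)) qg; rewrite lprojD (lproj_id sbe).
  rewrite (lproj_supp0 sqg); last by move=> k; rewrite fl negbK.
  by move=> /esym/eqP; rewrite addrC addr_eq0 => /eqP.
have qgE : q * g = lproj (from (- n%:Z)) (c * x).
  by rewrite qg beE {1}(lprojC (p := from (- n%:Z)) (q := lt n) (c * x))// addrK.
have qh : q * h = x + b * be.
  have -> : q * h = g' * G.
    by rewrite /G (_ : g' * _ = q * h * (g * g')); [rewrite gg mulr1|ring].
  rewrite GE mulrDr /b /be; congr (_ + _).
  by rewrite (_ : h * g' * _ = (h * h') * (g' * Gm)); [rewrite hh mul1r|ring].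
have sqh : supp npos (q * h) by exact: supp_nposM.
have qhn : lproj nneg (q * h) = lconst (h 0).
  apply: ell1_eq => k; rewrite ecoef_lproj /=; case: eqP => [->|/eqP k0].
    by have := ecoefM_upto (m := 0) (n := 0) sq2 sh; rewrite addr0 q0 mul1r.
  by case: ifP => // kn; apply: sqh; move: kn; rewrite /nneg /npos; lia.
exists x; split => //; last by rewrite -qgE mulrCA mulrC [g' * g]mulrC gg mul1r.
rewrite -qhn qh lprojD (lproj_id sx) beE mulrN lprojN baxter_trunc -/(baxter_op b c n x).
by rewrite subrK.
Qed.

(** The coefficient at [-n] is g'(0) times that of c x_n, hence bounded by |g'(0)| times the
    coefficient at [-n] of the fixed sequence [labs c * A]. Different [n] read different indices of
    it, so the finite norm bounds the whole sum. *)
Lemma baxter_summable : exists n0 : nat, exists q : nat -> L,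
  (forall n, (n0 <= n)%N -> [/\ baxter_mono n (q n) &
     forall y, has_bnd nu y -> baxter_mono n y -> y = q n]) /\
  exists B : R, forall N : nat,
    \sum_(n < N) (if (n0 <= n)%N then nu n%:Z * cabs (q n (- n%:Z)) else 0) <= B.
Proof.
case: (gP) (hP) => sg sg' _ bg bg' [sh sh' _ bh bh'].
have bb : has_bnd nu b by exact: has_bndM.
have bc : has_bnd nu c by exact: has_bndM.
have [n0 [A [bA hn]]] := baxter_solve (h 0) bb bc.
have xP n : exists x, (n0 <= n)%N -> [/\ has_bnd nu x,
    x = lconst (h 0) + baxter_op b c n x & maj x A].
  have [le|lt'] := leqP n0 n; last by exists 0.
  by have [_ [x hx]] := hn n le; exists x.
have [x hx] := choice xP.
exists n0, (fun n => g' * lproj (from (- n%:Z)) (c * x n)); split.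
  move=> n le; have [bx xE _] := hx n le; have [hK _] := hn n le.
  split; first exact: (baxter_construct xE).1.
  move=> y by_ my; have [z [bz zE ->]] := baxter_recover by_ my.
  suff -> : z = x n by [].
  by apply: (baxter_op_inj hK) => //; rewrite {1}zE {1}xE !addrK.
have [B hB] : has_bnd nu (labs c * A).
  by apply: has_bndM => //; case: bc => a ha; exists a; exact: nbnd_labs.
have B0 := nbnd_ge0 nuP hB.
exists (cabs (g' 0) * B) => N.
apply: (@le_trans _ _ (cabs (g' 0) * \sum_(n < N) nu n%:Z * cabs ((labs c * A) (- n%:Z)))).
  rewrite mulr_sumr; apply: ler_sum => n _; case: ifPn => [le|_]; last first.
    by rewrite !mulr_ge0// beurling_ge0.
  have [bx xE mx] := hx n le.
  rewrite (baxter_construct xE).2 cabsM mulrCA ler_wpM2l// ler_wpM2l ?(beurling_ge0 nuP)//.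
  have m1 := majM (maj_labs c) mx.
  have [e1 e2] := maj_real (- n%:Z) m1.
  by rewrite e1 cabs_real; apply: le_trans e2 (ler_norm _).
rewrite ler_wpM2l// -lee_fin; apply: le_trans hB.
pose e (n : nat) : int := - n%:Z.
have te k : (0 <= (nu k * cabs ((labs c * A) k))%:E)%E by rewrite lee_fin mulr_ge0// beurling_ge0.
rewrite /nrm (esumID (range e))//; apply: le_trans (leeDl _ _); last by apply: esum_ge0.
rewrite setTI esum_image; last by move=> i j _ _; rewrite /e => /oppr_inj[].
rewrite -nneseries_esumT//; apply: le_trans (nneseries_lim_ge N _) => //.
rewrite -sumEFin big_mkord; apply: lee_sum => n _.
by rewrite /e lee_fin (beurling_even nuP).
Qed.

End Polynomials.
End Baxter.

(** * Fourier coefficients and orthogonality *)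

Section CircleIntegral.
Variable R : realType.
Local Notation C := R[i].
Local Notation D := (`[- pi, pi]%classic : set R).
Local Notation mu := (@lebesgue_measure R).
Implicit Types (F G : R -> C) (g h : R -> R) (k : int).

Let mD : @measurable _ (g_sigma_algebraType R.-ocitv.-measurable) D.
Proof. exact: measurable_itv. Qed.

Definition cintegrable F : Prop :=
  mu.-integrable D (EFin \o (fun t => complex.Re (F t))) /\
  mu.-integrable D (EFin \o (fun t => complex.Im (F t))).

Lemma integrableD_EFin g h : mu.-integrable D (EFin \o g) -> mu.-integrable D (EFin \o h) ->
  mu.-integrable D (EFin \o (fun t => g t + h t)).
Proof.
move=> hg hh; have := integrableD mD hg hh.
by congr (integrable _ _ _); apply/funext => t /=; rewrite EFinD.
Qed.

Lemma integrableZ_EFin (c : R) g : mu.-integrable D (EFin \o g) ->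
  mu.-integrable D (EFin \o (fun t => c * g t)).
Proof.
move=> hg; have := integrableZl mD c hg.
by congr (integrable _ _ _); apply/funext => t /=; rewrite EFinM.
Qed.

Lemma cintD F G : cintegrable F -> cintegrable G ->
  cintegrable (fun t => F t + G t) /\ cint (fun t => F t + G t) = cint F + cint G.
Proof.
move=> [f1 f2] [g1 g2].
have eR : (fun t => complex.Re (F t + G t)) = (fun t => complex.Re (F t) + complex.Re (G t)).
  by apply/funext => t; rewrite cReD.
have eI : (fun t => complex.Im (F t + G t)) = (fun t => complex.Im (F t) + complex.Im (G t)).
  by apply/funext => t; rewrite cImD.
split; first by split; rewrite ?eR ?eI; exact: integrableD_EFin.
rewrite /cint eR eI (RintegralD mD f1 g1) (RintegralD mD f2 g2).
by [].
Qed.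

Lemma cintZ (c : C) F : cintegrable F ->
  cintegrable (fun t => c * F t) /\ cint (fun t => c * F t) = c * cint F.
Proof.
move=> [f1 f2].
have eR : (fun t => complex.Re (c * F t)) =
    (fun t => complex.Re c * complex.Re (F t) + (- complex.Im c) * complex.Im (F t)).
  by apply/funext => t; rewrite cReM mulNr.
have eI : (fun t => complex.Im (c * F t)) =
    (fun t => complex.Re c * complex.Im (F t) + complex.Im c * complex.Re (F t)).
  by apply/funext => t; rewrite cImM.
have Z1 (r : R) := integrableZ_EFin r f1; have Z2 (r : R) := integrableZ_EFin r f2.
split; first by split; rewrite ?eR ?eI; exact: integrableD_EFin.
rewrite /cint eR eI (RintegralD mD (Z1 _) (Z2 _)).
rewrite (RintegralD mD (Z2 _) (Z1 _)).
rewrite !(RintegralZl _ mD f1) !(RintegralZl _ mD f2).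
by apply/eqP; rewrite eq_complex cReM cImM /= mulNr !eqxx.
Qed.

Lemma bounded_trig (f : R -> R) (m : R) : continuous f -> (forall t, `|f t| <= 1) ->
  forall g, mu.-integrable D (EFin \o g) -> mu.-integrable D (EFin \o (fun t => f (m * t) * g t)).
Proof.
move=> cf bf g hg.
have mf : measurable_fun D (fun t => f (m * t)).
  apply: subspace_continuous_measurable_fun; first exact: mD.
  apply: continuous_subspaceT => t.
  apply: (@continuous_comp _ _ _ (fun t => m * t) f); last exact: cf.
  by apply: cvgMr; exact: cvg_id.
have bd : [bounded f (m * t) | t in D].
  by exists 1; split => // M M1 t _ /=; apply: le_trans (bf _) (ltW M1).
have := integrableMr mD mf bd hg.
by congr (integrable _ _ _); apply/funext => t /=; rewrite EFinM.
Qed.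

Lemma cintegrable_expiM (m : R) F : cintegrable F -> cintegrable (fun t => expi (m * t) * F t).
Proof.
move=> [f1 f2].
have C1 t : `|cos t| <= 1 :> R by rewrite ler_norml cos_geN1 cos_le1.
have S1 t : `|sin t| <= 1 :> R by rewrite ler_norml sin_geN1 sin_le1.
have c1 g := @bounded_trig _ m (@continuous_cos R) C1 g.
have s1 g := @bounded_trig _ m (@continuous_sin R) S1 g.
split.
  rewrite (_ : (fun t => complex.Re _) =
    (fun t => cos (m * t) * complex.Re (F t) + (- 1) * (sin (m * t) * complex.Im (F t)))).
    by apply: integrableD_EFin; [exact: c1|apply: integrableZ_EFin; exact: s1].
  by apply/funext => t; rewrite cReM mulN1r.
rewrite (_ : (fun t => complex.Im _) =
    (fun t => cos (m * t) * complex.Im (F t) + sin (m * t) * complex.Re (F t))).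
  by apply: integrableD_EFin; [exact: c1|exact: s1].
by apply/funext => t; rewrite cImM.
Qed.

Section Coefficients.
Variables (w : C -> C) (f : ell1 R).
Hypotheses (wL1 : L1circ w) (wf : forall k, f k = fourier w k).

Lemma cint_fourier k : cint (fun t => expi (- (k%:~R * t)) * w (expi t)) = Complex (2 * pi) 0 * f k.
Proof.
rewrite wf /fourier mulrC divfK// complexr0 -(rmorph0 (real_complex R)).
by rewrite (inj_eq (@complexI R)) mulf_neq0// ?pnatr_eq0// gt_eqF// pi_gt0.
Qed.

(** Multiplying by the variable shifts the frequency by one on both sides, so induction on [p]
    reduces everything to integrals of the weight against characters. *)
Lemma cint_poly (p : {poly C}) k :
  cintegrable (fun t => p.[expi t] * (expi (- (k%:~R * t)) * w (expi t))) /\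
  cint (fun t => p.[expi t] * (expi (- (k%:~R * t)) * w (expi t))) =
  Complex (2 * pi) 0 * (emb p * f) k.
Proof.
have base j : cintegrable (fun t => expi (- (j%:~R * t)) * w (expi t)).
  rewrite (_ : (fun t => _) = (fun t => expi ((- j%:~R) * t) * w (expi t))).
    by apply: cintegrable_expiM.
  by apply/funext => t; rewrite mulNr.
elim/poly_ind: p k => [|p c IH] k.
  have [h1 h2] := cintZ 0 (base k).
  have e : (fun t => (0 : {poly C}).[expi t] * (expi (- (k%:~R * t)) * w (expi t))) =
     (fun t => 0 * (expi (- (k%:~R * t)) * w (expi t))).
    by apply/funext => t; rewrite horner0.
  by rewrite e; split => //; rewrite h2 mul0r -polyC0 embC ecoef_lconstM mul0r mulr0.
have [h1 h2] := IH (k - 1); have [h3 h4] := cintZ c (base k).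
have [h5 h6] := cintD h1 h3.
have e : (fun t => (p * 'X + c%:P).[expi t] * (expi (- (k%:~R * t)) * w (expi t))) =
  (fun t => p.[expi t] * (expi (- ((k - 1)%:~R * t)) * w (expi t)) +
            c * (expi (- (k%:~R * t)) * w (expi t))).
  apply/funext => t; rewrite hornerMXaddC mulrDl; congr (_ + _).
  rewrite -mulrA; congr (_ * _); rewrite mulrA -expiD; congr (expi _ * _).
  by rewrite rmorphB /= rmorph1; ring.
rewrite e; split => //.
have -> : (emb (p * 'X + c%:P) * f) k = (emb p * f) (k - 1) + c * f k.
  have -> : emb (p * 'X + c%:P) * f = dl R 1 * (emb p * f) + lconst c * f.
    by rewrite embD embM embX embC; ring.
  by rewrite ecoefD ecoef_dlM ecoef_lconstM.
rewrite h6 h2 h4 cint_fourier; generalize ((emb p * f) (k - 1)) (f k) => x y.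
by rewrite [RHS]mulrDr [c * (_ * y)]mulrCA.
Qed.

Lemma cint_monic_OP (p : {poly C}) (k : nat) :
  cint (fun t => p.[expi t] * (expi t) ^- k * w (expi t)) = 0 <-> (emb p * f) k%:Z = 0.
Proof.
have -> : (fun t => p.[expi t] * (expi t) ^- k * w (expi t)) =
    (fun t => p.[expi t] * (expi (- (k%:Z%:~R * t)) * w (expi t))).
  by apply/funext => t; rewrite -mulrA expiN expiMz.
rewrite (cint_poly p k).2; split=> [/eqP|->]; last by rewrite mulr0.
rewrite mulf_eq0 complexr0 -(rmorph0 (real_complex R)) (inj_eq (@complexI R)).
by rewrite mulf_eq0 pnatr_eq0 (gt_eqF (pi_gt0 R)) /= => /eqP.
Qed.

(** The shift by [-n] puts the leading coefficient at index 0 and the constant term at [-n], and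
    moves the orthogonality conditions to the indices from -n to -1. *)
Lemma monic_OP_baxter (n : nat) (p : {poly C}) :
  monic_OP w n p <-> size p = n.+1 /\ baxter_mono f n (dl R (- n%:Z) * emb p).
Proof.
have shiftE k : (dl R (- n%:Z) * emb p * f) k = (emb p * f) (k + n%:Z).
  by rewrite -mulrA ecoef_dlM opprK.
have orth : (forall k : nat, (k < n)%N -> cint (fun t => p.[expi t] * (expi t) ^- k * w (expi t)) = 0) <->
   (forall k : int, - n%:Z <= k -> k < 0 -> (dl R (- n%:Z) * emb p * f) k = 0).
  split=> [h k k1 k2|h k kn]; last first.
    by apply/cint_monic_OP; have := h (k%:Z - n%:Z); rewrite shiftE subrK; apply; lia.
  rewrite shiftE (_ : k + n%:Z = absz (k + n%:Z)); last by lia.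
  by apply/cint_monic_OP/h; lia.
split.
  move=> [mp [sp op]]; split=> //; split.
  - by move=> k kn; rewrite ecoef_dlM ecoef_emb ifF//; move: kn; rewrite /from; lia.
  - move=> k kn; rewrite ecoef_dlM ecoef_emb; case: ifP => // _.
    by rewrite nth_default// sp; move: kn; rewrite /npos; lia.
  - rewrite ecoef_dlM ecoef_emb sub0r opprK /=.
    by move/monicP: mp; rewrite lead_coefE sp.
  - exact/orth.
move=> [sp [_ _ p1 op]]; split; last by split=> //; exact/orth.
apply/monicP; rewrite lead_coefE sp /=.
by move: p1; rewrite ecoef_dlM ecoef_emb sub0r opprK.
Qed.

Lemma baxter_mono_poly (n : nat) (q : ell1 R) : baxter_mono f n q ->
  exists p, monic_OP w n p /\ dl R (- n%:Z) * emb p = q.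
Proof.
move=> hq; case: (hq) => s1 s2 q0 _.
pose p := \poly_(i < n.+1) q (i%:Z - n%:Z).
have pE : dl R (- n%:Z) * emb p = q.
  apply: ell1_eq => k; rewrite ecoef_dlM ecoef_emb opprK.
  have [k0|k0] := leP 0 (k + n%:Z); last by rewrite s1// /from; lia.
  rewrite coef_poly; case: ifP => kn; first by congr (q _); lia.
  by rewrite s2// /npos; lia.
exists p; split => //; apply/monic_OP_baxter; rewrite pE; split => //.
by rewrite size_poly_eq// subrr q0 oner_neq0.
Qed.

Lemma dl_emb_inj (n : nat) (p q : {poly C}) : dl R (- n%:Z) * emb p = dl R (- n%:Z) * emb q -> p = q.
Proof.
move=> e; apply/polyP => i.
have E k : (dl R (- n%:Z) * emb p) k = (dl R (- n%:Z) * emb q) k by rewrite e.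
by have := E (i%:Z - n%:Z); rewrite !ecoef_dlM !ecoef_emb opprK subrK.
Qed.

End Coefficients.

(** * The Fourier series of the weight on the annulus *)

Section Extension.
Variables (nu : int -> R) (w : C -> C).
Hypotheses (nuP : beurling_weight nu) (wW : in_W nu w).

(** The grouped terms n and -(n + 1) correspond to the constructors [Posz n] and [Negz n], so each
    integer is met once. *)
Lemma in_W_nbnd : exists a, nbnd nu (fourier w) a.
Proof.
case: wW => _; set a := fun j => nu j * cabs (fourier w j) => cv.
have a0 j : 0 <= a j by rewrite /a mulr_ge0// beurling_ge0.
exists (limn (zseries a)); rewrite /nbnd /nrm esum_int; last by move=> k; rewrite lee_fin; exact: a0.
rewrite -esumD; [|by move=> n _; rewrite lee_fin; exact: a0|by move=> n _; rewrite lee_fin; exact: a0].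
under eq_esum do rewrite -EFinD.
apply: esum_nat_le => [n|n]; first by apply: addr_ge0; exact: a0.
have nd : {homo zseries a : m p / (m <= p)%N >-> m <= p}.
  by apply/nondecreasing_seqP => m; rewrite /zseries /series /= big_nat_recr//= lerDl addr_ge0.
have := nondecreasing_cvgn_le nd cv n; apply: le_trans.
rewrite /zseries /series /= big_mkord; apply: ler_sum => i _.
by rewrite lerD// NegzE.
Qed.

Definition fourier_ell1 : ell1 R :=
  let: exist a ha := cid in_W_nbnd in Ell1 (nbnd_summable nuP ha).

Lemma fourier_ell1E k : fourier_ell1 k = fourier w k.
Proof. by rewrite /fourier_ell1; case: cid. Qed.

Lemma has_bnd_fourier : has_bnd nu fourier_ell1.
Proof.
have [a ha] := in_W_nbnd; exists a; move: ha; congr (nbnd nu _ a).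
by apply/funext => k; rewrite fourier_ell1E.
Qed.

Lemma fpartial_csum z N : in_region nu z ->
  fpartial w z N = csum (fun k : int => if (- N%:Z <= k) && (k < N%:Z) then fourier_ell1 k * z ^ k else 0).
Proof.
move=> zP; have [a ha] := has_bnd_fourier; have ts := ev_summable zP ha.
have tp (P : pred int) : abs_summable (fun k => if P k then fourier_ell1 k * z ^ k else 0).
  by apply: esum_lt_trans ts => k; case: ifP; rewrite ?cabs0.
elim: N => [|N IH].
  rewrite /fpartial big_ord0 -[LHS](@csum0 R int); apply: eq_csum => k.
  by rewrite ifF//; lia.
rewrite /fpartial big_ord_recr /= -/(fpartial w z N) IH.
rewrite -(csum_pt (N%:Z) (_ * z ^ N%:Z)) -(csum_pt (- N.+1%:Z) (_ * z ^ (- N.+1%:Z))).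
rewrite -csumD; [|exact: abs_summable_pt|exact: abs_summable_pt].
rewrite -csumD; [|exact: tp|by apply: abs_summableD; exact: abs_summable_pt].
apply: eq_csum => k; rewrite -!fourier_ell1E.
have [->|k1] := eqVneq k N%:Z.
  rewrite [X in X + _]ifF; last by lia.
  have -> : (N%:Z == - N.+1%:Z) = false by apply/eqP; lia.
  by rewrite add0r addr0 ifT//; lia.
have [->|k2] := eqVneq k (- N.+1%:Z).
  rewrite [X in X + _]ifF; last by lia.
  by rewrite !add0r ifT//; lia.
by rewrite !addr0; congr (if _ then _ else _); lia.
Qed.

(** The window -N <= k < N of a partial sum contains [win n] as soon as n <= N, so the remainder is
    dominated by the norm of a tail. *)
Lemma fext_ev z : in_region nu z -> fext w z = ev z fourier_ell1.
Proof.
move=> zP; have [a ha] := has_bnd_fourier; have ts := ev_summable zP ha.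
have near (e : R) : 0 < e -> \forall N \near \oo, cabs (ev z fourier_ell1 - fpartial w z N) <= e.
  move=> e0; have [n hn] := nbnd_tail nuP ha e0.
  exists n => // N /= nN; rewrite fpartial_csum//.
  have tp : abs_summable (fun k => - (if (- N%:Z <= k) && (k < N%:Z) then fourier_ell1 k * z ^ k else 0)).
    by apply: esum_lt_trans ts => k; rewrite cabsN; case: ifP; rewrite ?cabs0.
  have tp' : abs_summable (fun k => (if (- N%:Z <= k) && (k < N%:Z) then fourier_ell1 k * z ^ k else 0)).
    by apply: esum_lt_trans ts => k; case: ifP; rewrite ?cabs0.
  rewrite /ev -(csumN tp') -(csumD ts tp) -lee_fin.
  apply: le_trans (cabs_csum (abs_summableD ts tp)) _.
  apply: le_trans (ev_nbnd zP hn); apply: le_esum => k _; rewrite lee_fin mul1r.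
  rewrite ecoefB ecoef_lproj; case: ifPn => kN; first by rewrite subrr cabs0.
  rewrite subr0 ifF ?subr0//; move: kN; rewrite /win; lia.
have lR : (fun N => complex.Re (fpartial w z N)) @ \oo --> complex.Re (ev z fourier_ell1).
  apply/cvgrPdist_le => e e0; apply: filterS (near e e0) => N; apply: le_trans.
  by apply: le_trans (normr_Re_cabs _); rewrite cReD; case: (fpartial w z N).
have lI : (fun N => complex.Im (fpartial w z N)) @ \oo --> complex.Im (ev z fourier_ell1).
  apply/cvgrPdist_le => e e0; apply: filterS (near e e0) => N; apply: le_trans.
  by apply: le_trans (normr_Im_cabs _); rewrite cImD; case: (fpartial w z N).
by rewrite /fext (cvg_lim _ lR)// (cvg_lim _ lI)//; case: (ev z fourier_ell1).
Qed.

End Extension.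
End CircleIntegral.

Theorem theorem2 (R : realType) (nu : int -> R) (w : R[i] -> R[i]) :
  beurling_weight nu ->
  in_W nu w ->
  (forall z, z \in annulus nu -> fext w z != 0) ->
  wind (fun t => fext w (expi t)) 0 ->
  exists n0 : nat,
    (forall n : nat, (n0 <= n)%N -> exists! Phi : {poly R[i]}, monic_OP w n Phi) /\
    (exists Phi : nat -> {poly R[i]},
       (forall n : nat, (n0 <= n)%N -> monic_OP w n (Phi n)) /\
       cvgn (series (fun n : nat =>
               if (n0 <= n)%N then nu n%:Z * cabs (Phi n).[0] else 0))).
Proof.
move=> nuP wW w0 wind0.
pose f := fourier_ell1 nuP wW.
have fE : forall k, f k = fourier w k := fourier_ell1E nuP wW.
have wL1 : L1circ w by case: (wW).
have f0 z : ann (A_nu nu) z -> ev z f != 0.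
  move=> hz; rewrite -fext_ev; last exact: ann_nu.
  by apply: w0; rewrite inE.
have [k [[g [g' [h [h' [gP hP fgh]]]]] wk]] :=
  beurling_wiener_hopf nuP (has_bnd_fourier nuP wW) f0.
have circ (t : R) : ann (A_nu nu) (expi t).
  by rewrite /ann cabs_expi -expR0 !ler_expR oppr_le0 A_nu_ge0.
(* The curve has winding number [k] by the factorization and 0 by hypothesis. *)
have k0 : k = 0.
  apply: (wind_unique (F := fun t => ev (expi t) f)) wk _ => [t|]; first exact/f0.
  by apply: eq_wind wind0 => t; apply: fext_ev; exact: ann_nu.
rewrite k0 dl0 mul1r in fgh.
have [n0 [q [hq [B hB]]]] := baxter_summable nuP gP hP fgh.
have exPhi n : exists p : {poly R[i]}, (n0 <= n)%N ->
    monic_OP w n p /\ dl R (- n%:Z) * emb p = q n.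
  (* Below [n0] the polynomial 0 is a placeholder, excluded from the series by its condition. *)
  have [le|lt] := leqP n0 n; last by exists 0.
  by have [hm _] := hq n le; have [p hp] := baxter_mono_poly wL1 fE hm; exists p.
have [Phi hPhi] := choice exPhi.
exists n0; split.
  move=> n le; have [h1 h2] := hPhi n le; exists (Phi n); split => // p hp.
  (* A polynomial has finite norm for every Beurling weight, so uniqueness among sequences of finite
     norm applies to any competitor. *)
  have [_ uq] := hq n le; apply: (dl_emb_inj (n := n)); rewrite h2; apply/esym/uq.
    by apply: has_bndM => //; [exact: has_bnd_delta|exact: has_bnd_emb].
  by have [] := (monic_OP_baxter wL1 fE n p).1 hp.
exists Phi; split; first by move=> n le; have [] := hPhi n le.
have t0 n : 0 <= (if (n0 <= n)%N then nu n%:Z * cabs (Phi n).[0] else 0).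
  by case: ifP => // _; rewrite mulr_ge0// beurling_ge0.
apply: nondecreasing_is_cvgn.
  by apply/nondecreasing_seqP => m; rewrite /series /= big_nat_recr//= lerDl.
exists B => _ [N _ <-]; apply: le_trans (hB N); rewrite /series /= big_mkord.
apply: ler_sum => n _; case: ifP => // le; have [_ <-] := hPhi n le.
by rewrite ecoef_dlM subrr ecoef_emb horner_coef0.
Qed.
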